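(* Let $m=m_n$ be positive integers with $\frac mn\to1$ as $n\to\infty$. Suppose $(\mathbf{X}_n)_{n\ge1}$ is a sequence of $n\times m$ random matrices such that the entries of $\mathbf{X}_n$ are independent zero mean unit variance random variables with $$\sup_{n\ge1}\ \sup_{1\le i\le n,\,1\le j\le m}\mathbb{E}|\mathbf{X}_n(i,j)|^k<\infty\quad\text{for all }k\ge1.$$ Suppose $(\mathbf{B}_n)_{n\ge1}$ is a sequence of symmetric deterministic $n\times n$ matrices such that $$\sup_{k\ge1}\sup_{n\ge1}\frac1n\max\Big\{(\mathrm{Tr}(|\mathbf{B}_n|^k))^{1/k},\ (\mathrm{Tr}(|\mathbf{I}_n-\mathbf{B}_n|^k))^{1/k}\Big\}<\infty,$$ where $|\mathbf{M}|$ denotes the matrix with entries $|\mathbf{M}(i,j)|$ and $\mathbf{I}_n$ is the $n\times n$ identity matrix, and such that $\mathbb{E}\frac1n\mathrm{Tr}\,\mathbf{B}_n^k$ converges as $n\to\infty$ for all $k\ge1$. (a) $\frac1n\mathbf{X}_n^\top\mathbf{B}_n\mathbf{X}_n$ and $\frac1n\mathbf{X}_n^\top(\mathbf{I}_n-\mathbf{B}_n)\mathbf{X}_n$ are asymptotically free only if there is some constant $p\in[0,1]$ such that $\mathbb{E}\frac1n\mathrm{Tr}(\mathbf{B}_n^k)\to p$ for all $k\ge1$. (b) $\frac1n\mathbf{X}_n^\top\mathbf{B}_n\mathbf{X}_n$ converges to a free Poisson variable with rate $p\in(0,1]$ only if $\mathbb{E}\frac1n\mathrm{Tr}(\mathbf{B}_n^k)\to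 p$ for all $k\ge1$.
   Context: A non-commutative probability space is a pair $(\mathcal{A},\varphi)$ with $\mathcal{A}$ a unital algebra over $\mathbb{C}$ and $\varphi:\mathcal{A}\to\mathbb{C}$ linear with $\varphi(\mathbf{1}_{\mathcal{A}})=1$. The $m\times m$ random matrices with entries having all moments finite form such a space with state $A\mapsto\mathbb{E}\frac1m\mathrm{Tr}(A)$. Matrices $A_1^{(n)},\ldots,A_r^{(n)}$ of this kind converge (jointly, in distribution in the algebraic sense) to $\mathfrak{a}_1,\ldots,\mathfrak{a}_r$ in $(\mathcal{A},\varphi)$ if $\mathbb{E}\frac1m\mathrm{Tr}(P(A_1^{(n)},\ldots,A_r^{(n)}))\to\varphi(P(\mathfrak{a}_1,\ldots,\mathfrak{a}_r))$ for every non-commutative polynomial $P$; they are asymptotically free if they converge jointly to freely independent $\mathfrak{a}_1,\ldots,\mathfrak{a}_r$. Unital subalgebras $(\mathcal{A}_i)_{i\in I}$ are freely independent if $\varphi(a_1\cdots a_k)=0$ whenever $k\ge1$, $a_j\in\mathcal{A}_{i_j}$, $\varphi(a_j)=0$ for all $j$, and $i_1\ne i_2,\ldots,i_{k-1}\ne i_k$. Elements are free if the unital subalgebras they generate are free. Free cumulants $\kappa_n:\mathcal{A}^n\to\mathbb{C}$ are the multilinear functionals determined by $\varphi(a_1\cdots a_n)=\sum_{\pi\in NC(n)}\prod_{V\in\pi}\kappa_{|V|}(a_{i}:i\in V)$ (indices in each block in increasing order), $NC(n)$ being the set of non-crossing partitions of $\{1,\ldots,n\}$; $\kappa_n(a):=\kappa_n(a,\ldots,a)$.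 A variable $\mathfrak{p}$ is free Poisson with rate $\lambda>0$ and jump size $\alpha>0$ if $\kappa_n(\mathfrak{p})=\lambda\alpha^n$ for all $n\ge1$. *)

(* Defs.v *)
From HB Require Import structures.
From mathcomp Require Import all_boot all_order all_algebra.
Set Implicit Arguments.
Unset Strict Implicit.
Unset Printing Implicit Defensive.

(* Stated before the library of classical sets is imported, whose notations
   hide those of finite sets. *)
Definition noncrossing (n : nat) (pi : {set {set 'I_n}}) : bool :=
  [forall V in pi, forall W in pi, (V != W) ==>
    ~~ [exists a in V, exists b in W, exists c in V, exists d in W,
         [&& a < b, b < c & c < d]]].

Definition NC (n : nat) : {set {set {set 'I_n}}} :=
  [set pi | partition pi [set: 'I_n] & noncrossing pi].

Definition one_block (n : nat) : {set {set 'I_n}} := [set [set: 'I_n]].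

Lemma NC_block (n : nat) (pi : {set {set 'I_n}}) (V : {set 'I_n}) :
  pi \in NC n -> pi != one_block n -> V \in pi -> 0 < #|V| < n.
Proof.
rewrite inE => /andP[part_pi _] piN1 Vpi.
have V0 : 0 < #|V|.
  rewrite card_gt0; apply: contraTneq Vpi => ->.
  by case/and3P: part_pi.
have Vle : #|V| <= n by have := max_card V; rewrite card_ord.
rewrite V0 /= ltn_neqAle Vle andbT.
apply: contra piN1 => /eqP Vn.
have VT : V = [set: 'I_n].
  by apply/eqP; rewrite eqEcard subsetT cardsT card_ord Vn /=.
rewrite eqEsubset /one_block sub1set -VT Vpi andbT.
apply/subsetP => W Wpi; rewrite inE; apply/eqP.
case/and3P: part_pi => _ /trivIsetP tI n0.
apply/eqP; apply: contraT => WV.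
have := tI _ _ Wpi Vpi WV; rewrite VT -setI_eq0 setIT => /eqP W0.
by rewrite W0 (negbTE n0) in Wpi.
Qed.

Lemma one_block_NC (n : nat) : 0 < n -> one_block n \in NC n.
Proof.
move=> n0; rewrite inE; apply/andP; split.
  apply/and3P; split.
  - by rewrite /cover big_set1.
  - by apply/trivIsetP => A B /set1P-> /set1P->; rewrite eqxx.
  - rewrite inE eq_sym; apply/set0Pn; exists (Ordinal n0).
    by rewrite inE.
apply/forall_inP => V /set1P->; apply/forall_inP => W /set1P->.
by rewrite eqxx.
Qed.

From mathcomp Require Import complex.
From mathcomp Require Import all_classical all_reals all_analysis.
Import Order.TTheory GRing.Theory Num.Theory.
Import numFieldNormedType.Exports.
Local Open Scope classical_set_scope.
Local Open Scope ring_scope.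

(* Non-commutative polynomials in r variables, as formal finite linear
   combinations of words: (c, [:: i_1; ...; i_k]) stands for the monomial
   c x_{i_1} ... x_{i_k}.  Repeated words are allowed. *)
Definition ncpoly (C : Type) (r : nat) : Type := seq (C * seq 'I_r).

Definition nceval (C : comNzRingType) (A : algType C) (r : nat)
    (q : ncpoly C r) (a : 'I_r -> A) : A :=
  \sum_(t <- q) t.1 *: \prod_(i <- t.2) a i.

(* The same evaluation for square matrices of arbitrary size, which do not
   form an algType in general (the size may be 0). *)
Definition nceval_mx (C : comNzRingType) (m r : nat)
    (q : ncpoly C r) (M : 'I_r -> 'M[C]_m) : 'M[C]_m :=
  \sum_(t <- q) t.1 *: \prod_(i <- t.2) M i.

Record ncps (R : realType) := NCPS {
  ncps_alg :> algType R[i];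
  ncps_state : {scalar ncps_alg};
  ncps_state1 : ncps_state 1 = 1 }.

Definition generated_subalg (C : comNzRingType) (A : algType C) (a : A)
    : set A :=
  smallest [set S : set A | GRing.subalg_closed (mem S)] [set a].

Definition free_subsets (R : realType) (S : ncps R) (I : Type)
    (F : I -> set S) : Prop :=
  forall (k : nat) (i : nat -> I) (a : nat -> S),
    (0 < k)%N ->
    (forall j, (j < k)%N -> F (i j) (a j) /\ ncps_state S (a j) = 0) ->
    (forall j, (j.+1 < k)%N -> i j <> i j.+1) ->
    ncps_state S (\prod_(0 <= j < k) a j) = 0.

Definition freely_independent (R : realType) (S : ncps R) (I : Type)
    (a : I -> S) : Prop :=
  free_subsets (fun i => generated_subalg (a i)).

(* [enum V] is increasing, so this lists the entries of [s] with index in [V]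
   in increasing order. *)
Definition restrict_seq (A : nmodType) (s : seq A) (V : {set 'I_(size s)})
    : seq A :=
  [seq s`_(i : 'I_(size s)) | i <- enum V].

(* Moment-cumulant formula solved for the term of the one-block partition;
   the first argument is fuel, at least the number of arguments. *)
Fixpoint free_cumulant_rec (R : realType) (S : ncps R) (k : nat) (s : seq S)
    : R[i] :=
  if k is k'.+1 then
    ncps_state S (\prod_(x <- s) x) -
    \sum_(pi in NC (size s) | pi != one_block (size s))
      \prod_(V in pi) free_cumulant_rec k' (restrict_seq V)
  else 0.

(* kappa_n (a_1, ..., a_n) is [free_cumulant [:: a_1; ...; a_n]]. *)
Definition free_cumulant (R : realType) (S : ncps R) (s : seq S) : R[i] :=
  free_cumulant_rec (size s) s.

Lemma size_restrict_seq (A : nmodType) (s : seq A) (V : {set 'I_(size s)}) :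
  size (restrict_seq V) = #|V|.
Proof. by rewrite size_map -cardE. Qed.

Lemma free_cumulant_recE (R : realType) (S : ncps R) (k l : nat) (s : seq S) :
  (0 < size s <= k)%N -> (size s <= l)%N ->
  free_cumulant_rec k s = free_cumulant_rec l s.
Proof.
elim: k l s => [|k IH] l s /andP[s0 sk] sl.
  by have := leq_trans s0 sk.
case: l sl => [sl|l sl]; first by have := leq_trans s0 sl.
rewrite /=; congr (_ - _); apply: eq_bigr => pi /andP[NCpi piN1].
apply: eq_bigr => V Vpi.
have /andP[V0 Vs] := NC_block NCpi piN1 Vpi.
by apply: IH; rewrite size_restrict_seq ?V0 -ltnS;
  [apply: leq_trans sk | apply: leq_trans sl].
Qed.

Lemma moment_cumulant (R : realType) (S : ncps R) (s : seq S) :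
  (0 < size s)%N ->
  ncps_state S (\prod_(x <- s) x) =
  \sum_(pi in NC (size s)) \prod_(V in pi) free_cumulant (restrict_seq V).
Proof.
move=> s0.
rewrite (bigD1 (one_block (size s))) ?one_block_NC //= big_set1.
have -> : restrict_seq [set: 'I_(size s)]%SET = s.
  rewrite /restrict_seq enum_setT -enumT.
  rewrite (map_comp (nth 0 s) (@nat_of_ord (size s))) val_enum_ord.
  exact: mkseq_nth.
rewrite {1}/free_cumulant; move: (s0); rewrite -{1}(prednK s0) => _.
have -> : free_cumulant_rec (size s) s
    = free_cumulant_rec (size s).-1.+1 s by rewrite prednK.
rewrite /= -[LHS](subrK (\sum_(pi in NC (size s) |
  pi != one_block (size s)) \prod_(V in pi)
    free_cumulant (restrict_seq V))).
congr (_ - _ + _); apply: eq_bigr => pi /andP[NCpi piN1].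
apply: eq_bigr => V Vpi.
have /andP[V0 Vs] := NC_block NCpi piN1 Vpi.
apply: free_cumulant_recE; rewrite size_restrict_seq ?V0 //=.
by rewrite -ltnS prednK.
Qed.

Definition free_poisson (R : realType) (S : ncps R) (a : S)
    (rate jump : R) : Prop :=
  [/\ 0 < rate, 0 < jump &
    forall n, (0 < n)%N ->
      free_cumulant (nseq n a) = real_complex R (rate * jump ^+ n)].

Section RandomMatrices.
Context (d : measure_display) (T : measurableType d) (R : realType).
Context (P : probability T R).

Definition mutually_independent (I : finType) (X : I -> {RV P >-> R}) : Prop :=
  forall (J : {set I}) (E : I -> set R), (forall i, measurable (E i)) ->
    P (\bigcap_(i in [set i | i \in J]) (X i @^-1` E i)) =
    (\prod_(i in J) P (X i @^-1` E i))%E.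

Definition cexpectation (f : T -> R[i]) : R[i] :=
  Complex (fine 'E_P[fun w => complex.Re (f w)])
          (fine 'E_P[fun w => complex.Im (f w)]).

Definition mx_state (m : nat) (M : T -> 'M[R[i]]_m) : R[i] :=
  cexpectation (fun w => m%:R^-1 * \tr (M w)).

(* Limits in R[i] are taken in R[i]^o, which carries the topology of the
   complex modulus. *)
Definition converges_jointly (r : nat) (m : nat -> nat)
    (M : forall n, 'I_r -> T -> 'M[R[i]]_(m n))
    (S : ncps R) (a : 'I_r -> S) : Prop :=
  forall q : ncpoly R[i] r,
    (fun n => mx_state (fun w => nceval_mx q (fun i => M n i w)) : R[i]^o)
      @ \oo --> (ncps_state S (nceval q a) : R[i]^o).

Definition asymptotically_free (r : nat) (m : nat -> nat)
    (M : forall n, 'I_r -> T -> 'M[R[i]]_(m n)) : Prop :=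
  exists (S : ncps R) (a : 'I_r -> S),
    freely_independent a /\ converges_jointly M a.

Definition converges_to_free_poisson (m : nat -> nat)
    (M : forall n, T -> 'M[R[i]]_(m n)) (rate jump : R) : Prop :=
  exists (S : ncps R) (a : S), free_poisson a rate jump /\
    converges_jointly (fun n (_ : 'I_1) => M n) (fun _ => a).

Definition random_mx (n m : nat) (X : 'I_n -> 'I_m -> {RV P >-> R})
    (w : T) : 'M[R]_(n, m) :=
  \matrix_(i, j) X i j w.

Definition sandwich (n m : nat) (X : 'I_n -> 'I_m -> {RV P >-> R})
    (B : 'M[R]_n) (w : T) : 'M[R[i]]_m :=
  map_mx (real_complex R)
    (n%:R^-1 *: ((random_mx X w)^T *m B *m random_mx X w)).

End RandomMatrices.

Definition abs_mx (R : realType) (n : nat) (M : 'M[R]_n) : 'M[R]_n :=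
  map_mx Num.norm M.

(* Main.v *)
Require Import Defs.
From HB Require Import structures.
From mathcomp Require Import all_boot all_order all_algebra.
From mathcomp Require Import zify ring lra.
Set Implicit Arguments.
Unset Strict Implicit.
Unset Printing Implicit Defensive.
Import Order.TTheory GRing.Theory Num.Theory.
Local Open Scope ring_scope.

(** Both parts come down to moments of order at most four.

    Write [tau p] for the limit of the normalized traces of [p (B n)]. For a
    fixed word, the normalized trace of a product of matrices
    [n^-1 X^T p_l (B n) X] is a sum, over tuples of columns of [X], of products
    of bilinear forms in these columns. Sorting the tuples by which of their
    entries coincide, a column that occurs just once in the tuple is integrated
    out and multiplies two neighbouring matrices ([Ex_bil_contract]), while a
    quadratic form [x^T p (B n) x / n] in one column concentrates at [tau p]
    ([Ex_prod_qf]). So each coincidence pattern contributes a product of values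
    of [tau], except for the crossing pattern of length four, which vanishes
    ([pbil_1212_near]); this gives the limits [mean_trace1_cvg], ...,
    [mean_trace4_cvg]. In the language of free probability, the limit of
    [n^-1 X^T p (B n) X] has the values of [tau] on products of the polynomials
    as its free cumulants.

    If [X^T B X / n] and [X^T (I - B) X / n] are asymptotically free, then their
    mixed cumulants [tau (x (1 - x))] and [tau (x^2 (1 - x)^2)] vanish. If
    [X^T B X / n] tends to a free Poisson variable of rate [p] and jump size 1,
    then [tau (x^k) = p] for [k <= 4], whence again [tau (x^2 (1 - x)^2) = 0].
    By the Cauchy-Schwarz inequality for [tau] this forces
    [tau (x^k) = tau (x^(k+1))] for all [k >= 1] ([tau_power]), and
    [tau x] lies in [[0, 1]] as [tau (x)^2 <= tau (x^2) = tau x].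

    Two technical points carry the estimates. The matrices [B n] may have
    unbounded norms, so all bounds are in terms of traces: second moments of
    quadratic forms are computed exactly ([Ex_quad2], [norm_quad_cov_le]), and
    higher moments of the form of [p] are controlled by second moments of the
    form of a power of [p] ([qf_pow2_le]). And independence enters only through
    the factorization of the expectations of polynomials in disjoint sets of
    entries ([Ex_mul_polyIn]). *)

(** * Non-crossing partitions of at most four points *)

(** Peeling off the block of a fixed point [x]: [U] is the complement of that
    block. *)
Lemma sum_partition_block (T : finType) (K : nmodType)
    (F : {set {set T}} -> K) (D : {set T}) (x : T) : x \in D ->
  \sum_(pi | partition pi D) F pi =
  \sum_(U : {set T} | U \subset D :\ x)
    \sum_(pi | partition pi U) F ((D :\: U) |: pi).
Proof.
move=> Dx.
have DUx (U : {set T}) : U \subset D :\ x -> x \in D :\: U.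
  by rewrite subsetD1 => /andP[_ xU]; rewrite inE xU.
have notin_pi (U : {set T}) pi : U \subset D :\ x -> partition pi U ->
    D :\: U \notin pi.
  move=> UD pU; apply: contraTN (DUx U UD) => DUpi.
  by rewrite !inE (subsetP (partitionS pU DUpi) _ (DUx U UD)).
rewrite (partition_big (fun pi => D :\: pblock pi x)
  (fun U : {set T} => U \subset D :\ x)) /=; last first.
  move=> pi pD; rewrite subsetD1 subsetDl inE mem_pblock.
  by rewrite (cover_partition pD) Dx.
apply: eq_bigr => U UD.
rewrite (reindex_onto (fun pi => (D :\: U) |: pi)
                      (fun pi => pi :\ (D :\: U))) /=; last first.
  move=> pi /andP[pD /eqP <-].
  have sD : pblock pi x \subset D.
    have xc : x \in cover pi by rewrite (cover_partition pD).
    by apply: partitionS pD _; apply: pblock_mem.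
  rewrite setDDr setDv set0U (setIidPr sD) setD1K // pblock_mem //.
  by rewrite (cover_partition pD).
apply: eq_bigl => pi; apply/andP/idP; last first.
  move=> pU; split; last by rewrite setU1K // notin_pi.
  have UD' : U \subset D by apply: subset_trans UD (subsetDl _ _).
  have pD : partition ((D :\: U) |: pi) D.
    have eD : (D :\: U) :|: U = D by rewrite -{2}(setIidPr UD') setUC setID.
    rewrite -[X in partition _ X]eD.
    apply: partitionU1 => //; first by apply/set0Pn; exists x; apply: DUx.
    by rewrite -setI_eq0 setIDAC setDIl setDv setI0.
  rewrite pD /= (def_pblock (partition_trivIset pD) _ (DUx U UD)) ?setU11 //.
  by rewrite setDDr setDv set0U (setIidPr UD').
case=> /andP[pD /eqP eU] /eqP epi.
have := partitionD1 pD (setU11 _ _); rewrite epi.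
have UD' : U \subset D by apply: subset_trans UD (subsetDl _ _).
by rewrite setDDr setDv set0U (setIidPr UD').
Qed.

(** Choosing the complement of the block of a given point yields the recursion
    of the Touchard polynomials. *)
Lemma sum_partition_expr_card (T : finType) (K : comNzRingType) (x : K)
    (f : nat -> K) (N : nat) :
  f 0%N = 1 ->
  (forall n, (n < N)%N -> f n.+1 = x * \sum_(k < n.+1) f k *+ 'C(n, k)) ->
  forall D : {set T}, (#|D| <= N)%N ->
    \sum_(pi | partition pi D) x ^+ #|pi| = f #|D|.
Proof.
move=> f0 fS D; move: {2}#|D|.+1 (ltnSn #|D|) => n.
elim: n D => // n IH D Dn DN.
have [->|/set0Pn[a Da]] := eqVneq D set0.
  rewrite (eq_bigl (pred1 set0)); last by move=> pi; rewrite partition_set0.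
  by rewrite big_pred1_eq !cards0 f0 expr0.
rewrite (sum_partition_block _ Da).
have cD : #|D| = #|D :\ a|.+1 by rewrite (cardsD1 a) Da.
rewrite cD in Dn DN *.
rewrite fS //.
transitivity (\sum_(U : {set T} | U \subset D :\ a) x * f #|U|).
  apply: eq_bigr => U UD.
  have Ux : (#|U| <= #|D :\ a|)%N by rewrite subset_leq_card.
  rewrite -IH; last 2 first.
  - by apply: leq_ltn_trans Ux _; rewrite -ltnS.
  - by apply: leq_trans Ux _; apply: ltnW.
  rewrite big_distrr /=; apply: eq_bigr => pi pU.
  rewrite cardsU1; suff -> : D :\: U \notin pi by rewrite exprS.
  have DUa : a \in D :\: U.
    by move: UD; rewrite subsetD1 => /andP[_ xU]; rewrite inE xU.
  apply: contraTN (DUa) => DUpi.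
  by rewrite !inE (subsetP (partitionS pU DUpi) _ DUa).
rewrite -big_distrr /=; congr (_ * _).
rewrite (partition_big (fun U : {set T} => inord #|U| : 'I_#|D :\ a|.+1) predT)
  //=.
apply: eq_bigr => k _.
rewrite -cards_draws -sumr_const; apply: eq_big => [U|U].
  rewrite inE; case: (boolP (U \subset _)) => //= UD.
  by rewrite -(inj_eq val_inj) /= inordK // ltnS subset_leq_card.
case/andP => UD /eqP <-; rewrite inordK // ltnS subset_leq_card //.
Qed.

(** A crossing takes four points, and on exactly four points it can only be the
    one of [{0, 2}] with [{1, 3}]. *)
Lemma NC_small (n : nat) : (n <= 3)%N ->
  NC n = [set pi | partition pi [set: 'I_n]].
Proof.
move=> n3; apply/setP => pi; rewrite !inE andb_idr // => _.
apply/forall_inP => V _; apply/forall_inP => W _; apply/implyP => _.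
apply/existsP => -[a /andP[_ /existsP[b /andP[_ /existsP[c /andP[_]]]]]].
case/existsP => e /andP[_ /and3P[ab bc ce]].
by have := ltn_ord e; lia.
Qed.

Definition crossing4 : {set {set 'I_4}} :=
  [set [set inord 0; inord 2]; [set inord 1; inord 3]].

Lemma inord4_eq (i j : nat) : (i < 4)%N -> (j < 4)%N ->
  (inord i == inord j :> 'I_4) = (i == j).
Proof. by move=> i4 j4; rewrite -(inj_eq val_inj) /= !inordK. Qed.

Lemma partition_crossing4 : partition crossing4 [set: 'I_4].
Proof.
set W : {set 'I_4} := [set inord 1; inord 3].
set V : {set 'I_4} := [set inord 0; inord 2].
have dVW : [disjoint V & W].
  rewrite -setI_eq0 -subset0; apply/subsetP => i; rewrite !inE.
  by case/andP => /orP[] /eqP-> /orP[]; rewrite inord4_eq.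
have pW : partition [set W] W.
  apply/and3P; split; first by rewrite /cover big_set1.
  - by apply/trivIsetP => A C /set1P-> /set1P->; rewrite eqxx.
  - by rewrite inE eq_sym; apply/set0Pn; exists (inord 1); rewrite !inE eqxx.
have <- : V :|: W = [set: 'I_4].
  apply/eqP; rewrite eqEcard subsetT cardsT card_ord cardsU.
  by rewrite (disjoint_setI0 dVW) cards0 !cards2 !inord4_eq.
apply: partitionU1 => //; apply/set0Pn.
by exists (inord 0); rewrite !inE eqxx.
Qed.

Lemma noncrossing_crossing4 : noncrossing crossing4 = false.
Proof.
apply/negbTE; rewrite negb_forall_in.
apply/existsP; exists [set inord 0; inord 2]; rewrite set21 /=.
rewrite negb_forall_in; apply/existsP; exists [set inord 1; inord 3].
rewrite set22 /= negb_imply negbK; apply/andP; split.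
  apply: contraTneq (set21 (inord 0 : 'I_4) (inord 2)) => ->.
  by rewrite !inE negb_or !inord4_eq.
apply/existsP; exists (inord 0); rewrite set21.
apply/existsP; exists (inord 1); rewrite set21.
apply/existsP; exists (inord 2); rewrite set22.
apply/existsP; exists (inord 3); rewrite set22.
by rewrite !inordK.
Qed.

Lemma NC4E : NC 4 = [set pi | partition pi [set: 'I_4]] :\ crossing4.
Proof.
apply/setP => pi; rewrite !inE [LHS]andbC.
case: (boolP (partition pi _)) => [pT|]; rewrite ?andbF // !andbT.
apply/idP/idP; first by apply: contraTneq => ->; rewrite noncrossing_crossing4.
apply: contraR; rewrite negb_forall_in => /existsP[V /andP[Vpi]].
rewrite negb_forall_in => /existsP[W /andP[Wpi]].
rewrite negb_imply negbK => /andP[VW].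
case/existsP => a /andP[aV /existsP[b /andP[bW /existsP[c /andP[cV]]]]].
case/existsP => e /andP[eW /and3P[ab bc ce]].
have e4 := ltn_ord e.
have Ea : a = inord 0 by apply: val_inj; rewrite /= inordK //; lia.
have Eb : b = inord 1 by apply: val_inj; rewrite /= inordK //; lia.
have Ec : c = inord 2 by apply: val_inj; rewrite /= inordK //; lia.
have Ee : e = inord 3 by apply: val_inj; rewrite /= inordK //; lia.
subst a b c e.
have tI := partition_trivIset pT; move/trivIsetP: (tI) => tIP.
have dVW := disjoint_setI0 (tIP _ _ Vpi Wpi VW).
have cVW := cardsUI V W; rewrite dVW cards0 addn0 in cVW.
have cT : (#|V| + #|W| <= 4)%N.
  by have := max_card (V :|: W); rewrite card_ord cVW.
have sV : [set inord 0; inord 2] \subset V.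
  by apply/subsetP => i; rewrite !inE => /orP[] /eqP->.
have sW : [set inord 1; inord 3] \subset W.
  by apply/subsetP => i; rewrite !inE => /orP[] /eqP->.
have := subset_leq_card sV; have := subset_leq_card sW.
rewrite !cards2 !inord4_eq //= => cW cV'.
have EV : [set inord 0; inord 2] = V.
  apply/eqP; rewrite eqEcard sV cards2 inord4_eq //=.
  by rewrite -(leq_add2r 2) (leq_trans _ cT) // leq_add2l.
have EW : [set inord 1; inord 3] = W.
  apply/eqP; rewrite eqEcard sW cards2 inord4_eq //=.
  by rewrite -(leq_add2l 2) (leq_trans _ cT) // leq_add2r.
have ET : V :|: W = [set: 'I_4].
  apply/eqP; rewrite eqEcard subsetT cardsT card_ord cVW.
  by rewrite (leq_trans _ (leq_add cV' cW)).
rewrite eqEsubset /crossing4 EV EW; apply/andP; split; last first.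
  by apply/subsetP => U; rewrite !inE => /orP[] /eqP->.
apply/subsetP => U Upi; rewrite !inE.
have [i iU] : exists i, i \in U.
  by apply/set0Pn; exact: (partition_neq0 pT Upi).
have := in_setT i; rewrite -ET inE => /orP[iV|iW].
- by rewrite -(def_pblock tI Upi iU) (def_pblock tI Vpi iV) eqxx.
- by rewrite -(def_pblock tI Upi iU) (def_pblock tI Wpi iW) eqxx orbT.
Qed.

Section NCsums.
Context (K : comNzRingType) (x : K).

(* The Touchard polynomials of degree at most four. *)
Let touchard : seq K :=
  [:: 1; x; x + x ^+ 2; x + 3%:R * x ^+ 2 + x ^+ 3;
      x + 7%:R * x ^+ 2 + 6%:R * x ^+ 3 + x ^+ 4].

Let sum_partition_ord (n : nat) : (n <= 4)%N ->
  \sum_(pi | partition pi [set: 'I_n]) x ^+ #|pi| = touchard`_n.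
Proof.
move=> n4; rewrite (@sum_partition_expr_card _ _ x (nth 0 touchard) 4) //.
- by rewrite cardsT card_ord.
- have C32 : 'C(3, 1 + (1 + 0)) = 3%N by [].
  move=> [|[|[|[|//]]]] _; rewrite !big_ord_recl big_ord0 /= /bump /=;
    rewrite ?bin0 ?binn ?bin1 ?C32 /=; ring.
- by rewrite cardsT card_ord.
Qed.

Lemma sum_NC_small (n : nat) : (n <= 3)%N ->
  \sum_(pi in NC n) x ^+ #|pi| =
  [:: 1; x; x + x ^+ 2; x + 3%:R * x ^+ 2 + x ^+ 3]`_n.
Proof.
move=> n3; rewrite NC_small // (eq_bigl _ _ (fun pi => in_set _ _)).
by rewrite sum_partition_ord ?(leq_trans n3) //; case: n n3 => [|[|[|[|]]]].
Qed.

Lemma sum_NC4 : \sum_(pi in NC 4) x ^+ #|pi| =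
  x + 6%:R * x ^+ 2 + 6%:R * x ^+ 3 + x ^+ 4.
Proof.
have := sum_partition_ord (leqnn 4).
rewrite (bigD1 crossing4) ?partition_crossing4 //= => E.
have c2 : #|crossing4| = 2%N.
  rewrite cards2; suff -> : [set inord 0; inord 2] != [set inord 1; inord 3] :>
      {set 'I_4} by [].
  apply: contraTneq (set21 (inord 0 : 'I_4) (inord 2)) => ->.
  by rewrite !inE negb_or !inord4_eq.
rewrite c2 in E; rewrite NC4E.
rewrite (eq_bigl (fun pi => partition pi setT && (pi != crossing4))).
  by move/(canRL (addKr _)): E => ->; ring.
by move=> pi; rewrite !inE andbC.
Qed.

End NCsums.

From mathcomp Require Import complex.
From mathcomp Require Import all_classical all_reals all_analysis.
From mathcomp Require Import measurable_realfun.
Import numFieldNormedType.Exports.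
Local Open Scope classical_set_scope.
Local Open Scope ring_scope.

(** * Random variables with moments of all orders *)

Section Moments.
Context (d : measure_display) (T : measurableType d) (R : realType).
Context (P : probability T R).
Implicit Types f g h : T -> R.

Definition Ex f : R := fine 'E_P[f].

(** These random variables form an algebra, on which [Ex] is a positive linear
    functional. *)
Definition all_moments f : Prop :=
  measurable_fun setT f /\
  forall k : nat, P.-integrable setT (fun w => (`|f w| ^+ k)%:E).

Lemma ExE f : Ex f = fine (\int[P]_w (f w)%:E).
Proof. by rewrite /Ex unlock. Qed.

Lemma all_moments_integrable f : all_moments f ->
  P.-integrable setT (EFin \o f).
Proof.
move=> [mf /(_ 1%N) fi]; apply/integrableP; split; first exact/measurable_EFinP.
move/integrableP: fi => [_]; apply: le_lt_trans; rewrite le_eqVlt; apply/orP;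
    left.
by apply/eqP; apply: eq_integral => w _ /=; rewrite expr1 normr_id.
Qed.

Lemma all_moments_le f g : measurable_fun setT f -> all_moments g ->
  (forall w, `|f w| <= `|g w|) -> all_moments f.
Proof.
move=> mf [mg ig] fg; split=> // k; apply: le_integrable (ig k) => //.
  apply/measurable_EFinP; apply: measurable_funX.
  exact: measurableT_comp.
move=> w _ /=; rewrite lee_fin [leLHS]ger0_norm ?exprn_ge0 //.
by rewrite [leRHS]ger0_norm ?exprn_ge0 // lerXn2r ?nnegrE ?normr_ge0.
Qed.

Lemma all_moments_cst (c : R) : all_moments (fun=> c).
Proof.
split=> // k.
exact: finite_measure_integrable_cst.
Qed.

Lemma norm_add_expr_le (a b : R) k :
  `|a + b| ^+ k <= 2%:R ^+ k * (`|a| ^+ k + `|b| ^+ k).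
Proof.
wlog ab : a b / `|a| <= `|b|.
  move=> H; have [/H//|/ltW/H] := leP `|a| `|b|.
  by rewrite addrC [X in _ * X]addrC.
apply: (@le_trans _ _ ((2%:R * `|b|) ^+ k)).
  rewrite lerXn2r ?nnegrE ?mulr_ge0 // (le_trans (ler_normD _ _)) //.
  by rewrite mulr_natl mulr2n lerD2r.
by rewrite exprMn ler_wpM2l ?exprn_ge0 // lerDr exprn_ge0.
Qed.

Lemma all_moments_add f g : all_moments f -> all_moments g ->
  all_moments (fun w => f w + g w).
Proof.
move=> [mf fi] [mg gi]; split=> [|k]; first exact: measurable_funD.
have i2 : P.-integrable setT (fun w =>
    ((2%:R ^+ k * (`|f w| ^+ k))%:E + (2%:R ^+ k * (`|g w| ^+ k))%:E)%E).
  apply: integrableD => //.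
    by under eq_fun do rewrite EFinM; apply: integrableZl => //; apply: fi.
  by under eq_fun do rewrite EFinM; apply: integrableZl => //; apply: gi.
apply: le_integrable i2 => //.
  apply/measurable_EFinP; apply: measurable_funX.
  by apply: measurableT_comp => //; exact: measurable_funD.
move=> w _ /=; rewrite lee_fin -mulrDr.
have p0 : 0 <= 2%:R ^+ k * (`|f w| ^+ k + `|g w| ^+ k) :> R.
  by rewrite mulr_ge0 ?exprn_ge0 ?addr_ge0 ?exprn_ge0.
rewrite [leRHS]ger0_norm // ger0_norm ?exprn_ge0 //.
exact: norm_add_expr_le.
Qed.

Lemma all_moments_mul f g : all_moments f -> all_moments g ->
  all_moments (fun w => f w * g w).
Proof.
move=> [mf fi] [mg gi]; split=> [|k]; first exact: measurable_funM.
have i2 : P.-integrable setT (fun w =>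
    ((`|f w| ^+ (2 * k))%:E + (`|g w| ^+ (2 * k))%:E)%E).
  by apply: integrableD.
apply: le_integrable i2 => //.
  apply/measurable_EFinP; apply: measurable_funX.
  by apply: measurableT_comp => //; exact: measurable_funM.
move=> w _ /=; rewrite lee_fin.
rewrite [leRHS]ger0_norm ?addr_ge0 ?exprn_ge0 //.
rewrite [leLHS]ger0_norm ?exprn_ge0 // normrM exprMn mulnC !exprM.
set a := `|f w| ^+ k; set b := `|g w| ^+ k.
have : 0 <= a by rewrite exprn_ge0.
have : 0 <= b by rewrite exprn_ge0.
nra.
Qed.

Lemma all_moments_sum (I : Type) (s : seq I) (Q : pred I) (f : I -> T -> R) :
  (forall i, all_moments (f i)) ->
  all_moments (fun w => \sum_(i <- s | Q i) f i w).
Proof.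
move=> fi; elim: s => [|i s IH].
  by under eq_fun do rewrite big_nil; apply: all_moments_cst.
under eq_fun do rewrite big_cons.
by case: (Q i) => //; apply: all_moments_add.
Qed.

Lemma all_moments_prod (I : Type) (s : seq I) (Q : pred I) (f : I -> T -> R) :
  (forall i, all_moments (f i)) ->
  all_moments (fun w => \prod_(i <- s | Q i) f i w).
Proof.
move=> fi; elim: s => [|i s IH].
  by under eq_fun do rewrite big_nil; apply: all_moments_cst.
under eq_fun do rewrite big_cons.
by case: (Q i) => //; apply: all_moments_mul.
Qed.

Lemma all_moments_exp f k : all_moments f -> all_moments (fun w => f w ^+ k).
Proof.
move=> fi; elim: k => [|k IH]; first exact: all_moments_cst.
by under eq_fun do rewrite exprS; apply: all_moments_mul.
Qed.

Lemma all_moments_scale (c : R) f : all_moments f ->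
  all_moments (fun w => c * f w).
Proof. by apply: all_moments_mul; exact: all_moments_cst. Qed.

Lemma all_moments_opp f : all_moments f -> all_moments (fun w => - f w).
Proof.
by move=> fi; under eq_fun do rewrite -mulN1r; exact: all_moments_scale.
Qed.

Lemma all_moments_sub f g : all_moments f -> all_moments g ->
  all_moments (fun w => f w - g w).
Proof. by move=> fi gi; apply: all_moments_add => //; exact: all_moments_opp.
    Qed.

Lemma all_moments_norm f : all_moments f -> all_moments (fun w => `|f w|).
Proof.
move=> fi; apply: all_moments_le (fi) _ => [|w]; last by rewrite normr_id.
by case: fi => mf _; exact: measurableT_comp.
Qed.

Lemma Ex_cst (c : R) : Ex (fun=> c) = c.
Proof. by rewrite /Ex (expectation_cst P c). Qed.

Lemma ExD f g : all_moments f -> all_moments g ->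
  Ex (fun w => f w + g w) = Ex f + Ex g.
Proof.
move=> /all_moments_integrable fi /all_moments_integrable gi.
rewrite !ExE -fineD ?integrable_fin_num // -integralD //.
Qed.

Lemma ExZ (c : R) f : all_moments f -> Ex (fun w => c * f w) = c * Ex f.
Proof.
move=> /all_moments_integrable fi; rewrite !ExE.
under eq_integral do rewrite EFinM.
by rewrite integralZl // fineM ?integrable_fin_num.
Qed.

Lemma ExN f : all_moments f -> Ex (fun w => - f w) = - Ex f.
Proof.
move=> fi; rewrite -mulN1r -ExZ //; congr Ex; apply/funext => w.
by rewrite mulN1r.
Qed.

Lemma ExB f g : all_moments f -> all_moments g ->
  Ex (fun w => f w - g w) = Ex f - Ex g.
Proof.
by move=> fi gi; rewrite ExD ?ExN //; exact: all_moments_opp.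
Qed.

Lemma Ex_sum (I : Type) (s : seq I) (Q : pred I) (f : I -> T -> R) :
  (forall i, all_moments (f i)) ->
  Ex (fun w => \sum_(i <- s | Q i) f i w) = \sum_(i <- s | Q i) Ex (f i).
Proof.
move=> fi; elim: s => [|i s IH].
  by under eq_fun do rewrite big_nil; rewrite Ex_cst big_nil.
under eq_fun do rewrite big_cons; rewrite big_cons.
by case: (Q i) => //; rewrite ExD ?IH //; exact: all_moments_sum.
Qed.

Lemma Ex_ge0 f : (forall w, 0 <= f w) -> 0 <= Ex f.
Proof.
by move=> f0; rewrite ExE fine_ge0 // integral_ge0 // => w _; rewrite lee_fin.
Qed.

Lemma Ex_le f g : all_moments f -> all_moments g ->
  (forall w, f w <= g w) -> Ex f <= Ex g.
Proof.
move=> fi gi fg; rewrite -subr_ge0 -ExB //; apply: Ex_ge0 => w.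
by rewrite subr_ge0.
Qed.

Lemma Ex_norm_le f g : all_moments f -> all_moments g ->
  (forall w, `|f w| <= g w) -> `|Ex f| <= Ex g.
Proof.
move=> fi gi fg; rewrite ler_norml -ExN //; apply/andP; split; apply: Ex_le =>
    //.
- exact: all_moments_opp.
- by move=> w; rewrite lerNl (le_trans _ (fg w)) // -normrN ler_norm.
- by move=> w; rewrite (le_trans _ (fg w)) // ler_norm.
Qed.

Lemma cvg_nondecreasing_integral (g : (T -> R)^nat) (f : T -> R) :
  (forall n, measurable_fun setT (g n)) -> (forall n w, 0 <= g n w) ->
  (forall w, nondecreasing_seq (g^~ w)) ->
  (forall w, (g n w)%:E @[n --> \oo] --> (f w)%:E) ->
  (\int[P]_w (g n w)%:E @[n --> \oo] --> \int[P]_w (f w)%:E)%E.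
Proof.
move=> mg g0 ndg cg.
have -> : (\int[P]_w (f w)%:E = \int[P]_w limn (fun n => (g n w)%:E))%E.
  by apply: eq_integral => w _; rewrite (cvg_lim _ (cg w)).
apply: (cvg_monotone_convergence (mu := P) measurableT) => //.
- by move=> n; apply/measurable_EFinP.
- by move=> n w _; rewrite lee_fin.
- by move=> w _ m n mn; rewrite lee_fin ndg.
Qed.

Lemma integral_EFin_Ex f : all_moments f ->
  (\int[P]_w (f w)%:E = (Ex f)%:E)%E.
Proof.
by move=> /all_moments_integrable fi; rewrite ExE fineK // integrable_fin_num.
Qed.

Lemma all_moments_bounded f (c : R) : measurable_fun setT f ->
  (forall w, `|f w| <= c) -> all_moments f.
Proof.
move=> mf fc; apply: all_moments_le mf (all_moments_cst c) _ => w.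
by rewrite (le_trans (fc w)) ?ler_norm.
Qed.

Lemma all_moments_indic (Y : {RV P >-> R}) (A : set R) : measurable A ->
  all_moments (fun w => \1_A (Y w)).
Proof.
move=> mA; apply: (@all_moments_bounded _ 1).
  have mi : measurable_fun setT (\1_A : R -> R) by exact: measurable_indic.
  exact: measurableT_comp mi _.
by move=> w; rewrite indicE; case: (_ \in _); rewrite ?normr1 ?normr0.
Qed.

Lemma all_moments_indicT (A : set T) : measurable A -> all_moments \1_A.
Proof.
move=> mA; apply: (@all_moments_bounded _ 1); first exact: measurable_indic.
by move=> w; rewrite indicE; case: (_ \in _); rewrite ?normr1 ?normr0.
Qed.

(** * Products of functions of independent variables *)

Section Independence.
Import HBNNSimple.
Context (I : finType) (X : I -> {RV P >-> R}).
Hypothesis X_indep : mutually_independent X.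

(** Multiplicativity passes from indicators to non-negative functions of one
    of the variables, by linearity and monotone convergence; [Z] stands for the
    product of the remaining factors. *)
Lemma integral_mul_indep (Y : {RV P >-> R}) (Z : T -> R) (h : R -> R) :
  measurable_fun setT Z -> (forall w, 0 <= Z w) ->
  (\int[P]_w (Z w)%:E < +oo)%E ->
  measurable_fun setT h -> (forall x, 0 <= h x) ->
  (forall A : set R, measurable A ->
     \int[P]_w (\1_A (Y w) * Z w)%:E =
     (\int[P]_w (\1_A (Y w))%:E) * \int[P]_w (Z w)%:E)%E ->
  (\int[P]_w (h (Y w) * Z w)%:E =
   (\int[P]_w (h (Y w))%:E) * \int[P]_w (Z w)%:E)%E.
Proof.
move=> mZ Z0 Zoo mh h0 H.
have mhe : measurable_fun setT (EFin \o h) by exact/measurable_EFinP.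
pose g := nnsfun_approx measurableT mhe.
have mY : measurable_fun setT Y by [].
have mgY n : measurable_fun setT (fun w => g n (Y w)).
  exact: measurableT_comp.
have ndg := nd_nnsfun_approx measurableT mhe.
have cg x : (g n x)%:E @[n --> \oo] --> (h x)%:E.
  by apply: (cvg_nnsfun_approx measurableT mhe) => // y _; rewrite lee_fin.
have Hg n : (\int[P]_w (g n (Y w) * Z w)%:E =
   (\int[P]_w (g n (Y w))%:E) * \int[P]_w (Z w)%:E)%E.
  have mind y : measurable_fun setT (fun w => \1_(g n @^-1` [set y]) (Y w) : R).
    have mi : measurable_fun setT (\1_(g n @^-1` [set y]) : R -> R).
      exact: measurable_indic.
    exact: (measurableT_comp mi mY).
  have i0 y w : (0 <= (y * \1_(g n @^-1` [set y]) (Y w))%:E)%E.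
    by rewrite EFinM nnfun_muleindic_ge0.
  transitivity (\int[P]_w (\sum_(y \in range (g n))
      (y * \1_(g n @^-1` [set y]) (Y w))%:E * (Z w)%:E))%E.
    apply: eq_integral => w _; rewrite EFinM [in LHS]fimfunE -fsumEFin //.
    by rewrite ge0_mule_fsuml.
  rewrite ge0_integral_fsum //; last 2 first.
  - by move=> y; apply: emeasurable_funM; apply/measurable_EFinP => //;
      apply: measurable_funM.
  - by move=> y w _; rewrite mule_ge0 // lee_fin.
  transitivity (\sum_(y \in range (g n))
     (\int[P]_w (y * \1_(g n @^-1` [set y]) (Y w))%:E * \int[P]_w (Z w)%:E))%E.
    apply: eq_fsbigr => y; rewrite inE => -[x _ yE].
    have y0 : (0 <= y%:E)%E by rewrite lee_fin -yE.
    under eq_integral do rewrite -EFinM -mulrA EFinM.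
    rewrite ge0_integralZl //; last 2 first.
    - by apply/measurable_EFinP; apply: measurable_funM.
    - by move=> w _; rewrite lee_fin mulr_ge0.
    under [X in (_ = X * _)%E]eq_integral do rewrite EFinM.
    rewrite [X in (_ = X * _)%E]ge0_integralZl //; first by rewrite H // muleA.
    exact/measurable_EFinP.
  transitivity ((\sum_(y \in range (g n))
     \int[P]_w (y * \1_(g n @^-1` [set y]) (Y w))%:E) * \int[P]_w (Z w)%:E)%E.
    by rewrite ge0_mule_fsuml // => y; apply: integral_ge0.
  congr (_ * _)%E.
  under [RHS]eq_integral do rewrite fimfunE -fsumEFin //.
  rewrite ge0_integral_fsum // => y.
  by apply/measurable_EFinP; apply: measurable_funM.
have Lh : (\int[P]_w (g n (Y w) * Z w)%:E @[n --> \oo] -->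
    \int[P]_w (h (Y w) * Z w)%:E)%E.
  apply: cvg_nondecreasing_integral => [n|n w|w m n mn|w].
  - exact: measurable_funM.
  - by rewrite mulr_ge0.
  - by rewrite ler_wpM2r //; have /lefP := ndg _ _ mn; apply.
  - under eq_fun do rewrite EFinM; rewrite EFinM.
    by apply: cvgeZr => //; exact: cg.
have Rh : (\int[P]_w (g n (Y w))%:E @[n --> \oo] --> \int[P]_w (h (Y w))%:E)%E.
  apply: cvg_nondecreasing_integral => [n|n w|w m n mn|w] //.
  by have /lefP := ndg _ _ mn; apply.
have Zfin : (\int[P]_w (Z w)%:E)%E \is a fin_num.
  by rewrite ge0_fin_numE // integral_ge0 // => w _; rewrite lee_fin.
apply: (cvg_unique (@ereal_hausdorff R) Lh).
have -> : (fun n => \int[P]_w (g n (Y w) * Z w)%:E)%E =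
    (fun n => (\int[P]_w (g n (Y w))%:E) * \int[P]_w (Z w)%:E)%E.
  by apply/funext => n; exact: Hg.
exact: cvgeZr.
Qed.


Lemma Ex_mul_indep (Y : {RV P >-> R}) (Z : T -> R) (h : R -> R) :
  all_moments Z -> (forall w, 0 <= Z w) ->
  all_moments (fun w => h (Y w)) ->
  measurable_fun setT h -> (forall x, 0 <= h x) ->
  (forall A : set R, measurable A ->
     Ex (fun w => \1_A (Y w) * Z w) = Ex (fun w => \1_A (Y w)) * Ex Z) ->
  Ex (fun w => h (Y w) * Z w) = Ex (fun w => h (Y w)) * Ex Z.
Proof.
move=> aZ Z0 ah mh h0 H.
have aA A : measurable A -> all_moments (fun w => \1_A (Y w)).
  exact: all_moments_indic.
apply: EFin_inj; rewrite EFinM -!integral_EFin_Ex //; last first.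
  exact: all_moments_mul.
apply: integral_mul_indep => //; first by case: aZ.
  by rewrite integral_EFin_Ex // ltry.
move=> A mA; rewrite !integral_EFin_Ex ?H //; first exact: aA.
by apply: all_moments_mul => //; exact: aA.
Qed.

(* Outside [s] only indicators are allowed; for empty [s] this is the
   hypothesis on [X]. *)
Let Ex_prod_indep_rec (s : seq I) (h : I -> R -> R) :
  (forall i, measurable_fun setT (h i)) -> (forall i x, 0 <= h i x) ->
  (forall i, all_moments (fun w => h i (X i w))) ->
  (forall i, i \notin s -> exists2 A : set R, measurable A & h i = \1_A) ->
  Ex (fun w => \prod_i h i (X i w)) = \prod_i Ex (fun w => h i (X i w)).
Proof.
elim: s h => [|k s IH] h mh h0 ah hs.
  have /choice[A HA] : forall i, exists A : set R, measurable A /\ h i = \1_A.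
    by move=> i; have [//|A mA hA] := hs i; exists A.
  have mA i : measurable (A i) by case: (HA i).
  have hA i : h i = \1_(A i) by case: (HA i).
  pose E := \bigcap_(i in [set i | i \in [set: I]%SET]) (X i @^-1` A i).
  have -> : (fun w => \prod_i h i (X i w)) = \1_E.
    apply/funext => w; rewrite indicE.
    have [wE|wE] := boolP (w \in E).
      rewrite big1 // => i _; rewrite hA indicE mem_set //.
      by move: wE; rewrite inE => /(_ i); apply; rewrite /= finset.in_setT.
    have [i iA] : exists i, X i w \notin A i.
      apply/existsP; rewrite -[X in is_true X]negbK negb_exists.
      apply: contra wE => /forallP H; apply/mem_set => i _ /=.
      by apply/set_mem; have := H i; rewrite negbK.
    by rewrite (bigD1 i) //= hA indicE (negbTE iA) mul0r.
  have mE : measurable E.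
    rewrite /E; apply: fin_bigcap_measurable => [|i _]; first exact:
        finite_finset.
    exact: measurable_funPTI.
  apply: EFin_inj; rewrite -integral_EFin_Ex; last first.
    exact: all_moments_indicT.
  rewrite integral_indic // setIT -prodEFin.
  have PE : P E = (\prod_(i in [set: I]%SET) P (X i @^-1` A i))%E.
    exact: X_indep.
  apply: (eq_trans PE).
  rewrite (eq_bigl predT); last by move=> i; rewrite finset.in_setT.
  apply: eq_bigr => i _.
  rewrite -integral_EFin_Ex // hA.
  transitivity (\int[P]_w (\1_(X i @^-1` A i) w)%:E)%E => //.
  by rewrite integral_indic // ?setIT //; exact: measurable_funPTI.
pose Z w := \prod_(i | i != k) h i (X i w).
have key A : measurable A -> Ex (fun w => \1_A (X k w) * Z w) =
    Ex (fun w => \1_A (X k w)) * \prod_(i | i != k) Ex (fun w => h i (X i w)).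
  move=> mA; pose h' i := if i == k then \1_A else h i.
  have hk : h' k = \1_A by rewrite /h' eqxx.
  have hN i : i != k -> h' i = h i by rewrite /h' => /negbTE ->.
  have := IH h'; rewrite (bigD1 k) //= hk.
  under eq_bigr => i ik do rewrite hN //.
  move=> <-.
  - congr Ex; apply/funext => w; rewrite [RHS](bigD1 k) //= hk.
    by congr (_ * _); apply: eq_bigr => i ik; rewrite hN.
  - move=> i; rewrite /h'; case: eqP => // _; exact: measurable_indic.
  - by move=> i x; rewrite /h'; case: eqP => // _; rewrite indicE.
  - by move=> i; rewrite /h'; case: eqP => // _; exact: all_moments_indic.
  - move=> i si; rewrite /h'; case: eqP => [_|/eqP ik]; first by exists A.
    by apply: hs; rewrite inE negb_or ik.
have aZ : all_moments Z by apply: all_moments_prod.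
have EZ : Ex Z = \prod_(i | i != k) Ex (fun w => h i (X i w)).
  have := key setT measurableT; rewrite indicT.
  rewrite Ex_cst mul1r => <-.
  by congr Ex; apply/funext => w; rewrite mul1r.
rewrite [RHS](bigD1 k) //= -EZ.
have -> : (fun w => \prod_i h i (X i w)) = (fun w => h k (X k w) * Z w).
  by apply/funext => w; rewrite (bigD1 k).
apply: Ex_mul_indep => //.
  by move=> w; apply: prodr_ge0.
by move=> A mA; rewrite key // EZ.
Qed.

Lemma Ex_prod_indep_ge0 (h : I -> R -> R) :
  (forall i, measurable_fun setT (h i)) -> (forall i x, 0 <= h i x) ->
  (forall i, all_moments (fun w => h i (X i w))) ->
  Ex (fun w => \prod_i h i (X i w)) = \prod_i Ex (fun w => h i (X i w)).
Proof.
move=> mh h0 ah; apply: (Ex_prod_indep_rec (s := enum I)) => // i.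
by rewrite mem_enum.
Qed.

(** Positive and negative parts are split one variable at a time, so that at
    each stage only linearity of [Ex] is used. *)
Lemma Ex_prod_indep (h : I -> R -> R) :
  (forall i, measurable_fun setT (h i)) ->
  (forall i, all_moments (fun w => h i (X i w))) ->
  Ex (fun w => \prod_i h i (X i w)) = \prod_i Ex (fun w => h i (X i w)).
Proof.
suff H (s : seq I) : forall h : I -> R -> R,
    (forall i, measurable_fun setT (h i)) ->
    (forall i, all_moments (fun w => h i (X i w))) ->
    (forall i x, i \notin s -> 0 <= h i x) ->
    Ex (fun w => \prod_i h i (X i w)) = \prod_i Ex (fun w => h i (X i w)).
  by move=> mh ah; apply: (H (enum I)) => // i x; rewrite mem_enum.
elim: s => [|k s IH] {}h mh ah h0.
  by apply: Ex_prod_indep_ge0 => // i x; apply: h0.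
pose hp x : R := (h k x + `|h k x|) / 2%:R.
pose hm x : R := (`|h k x| - h k x) / 2%:R.
pose g (u : R -> R) i := if i == k then u else h i.
pose Z w := \prod_(i | i != k) h i (X i w).
have aZ : all_moments Z by apply: all_moments_prod.
have key (u : R -> R) : measurable_fun setT u -> (forall x, 0 <= u x) ->
    all_moments (fun w => u (X k w)) ->
    Ex (fun w => u (X k w) * Z w) =
    Ex (fun w => u (X k w)) * \prod_(i | i != k) Ex (fun w => h i (X i w)).
  move=> mu u0 au.
  have hk : g u k = u by rewrite /g eqxx.
  have hN i : i != k -> g u i = h i by rewrite /g => /negbTE ->.
  have := IH (g u); rewrite (bigD1 k) //= hk.
  under eq_bigr => i ik do rewrite hN //.
  move=> <-.
  - congr Ex; apply/funext => w; rewrite [RHS](bigD1 k) //= hk.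
    by congr (_ * _); apply: eq_bigr => i ik; rewrite hN.
  - by move=> i; rewrite /g; case: eqP.
  - by move=> i; rewrite /g; case: eqP => [->|_].
  - move=> i x si; rewrite /g; case: eqP => // /eqP ik.
    by apply: h0; rewrite inE negb_or ik.
have mn : measurable_fun setT (fun x => `|h k x|) by exact: measurableT_comp.
have mp : measurable_fun setT hp.
  by apply: measurable_funM => //; exact: measurable_funD.
have mm : measurable_fun setT hm.
  by apply: measurable_funM => //; exact: measurable_funB.
have an := all_moments_norm (ah k).
have ap : all_moments (fun w => hp (X k w)).
  by apply: all_moments_mul; [exact: all_moments_add|exact: all_moments_cst].
have am : all_moments (fun w => hm (X k w)).
  by apply: all_moments_mul; [exact: all_moments_sub|exact: all_moments_cst].
have hE x : h k x = hp x - hm x by rewrite /hp /hm; field.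
have -> : (fun w => \prod_i h i (X i w)) =
    (fun w => hp (X k w) * Z w - hm (X k w) * Z w).
  by apply/funext => w; rewrite (bigD1 k) //= -mulrBl -hE.
rewrite ExB ?key //; try exact: all_moments_mul.
- rewrite [RHS](bigD1 k) //= -mulrBl -ExB //.
  by congr (Ex _ * _); apply/funext => w; rewrite hE.
- by move=> x; rewrite /hm divr_ge0 // subr_ge0 ler_norm.
- by move=> x; rewrite /hp divr_ge0 // -lerBlDl sub0r -normrN ler_norm.
Qed.

End Independence.
End Moments.

(** * Polynomials in independent variables *)

Section PolynomialVariables.
Context (d : measure_display) (T : measurableType d) (R : realType).
Context (P : probability T R).
Context (I : finType) (X : I -> {RV P >-> R}).
Hypothesis X_indep : mutually_independent X.
Hypothesis X_all_moments : forall i, all_moments P (X i).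

Definition monomial (s : seq I) (w : T) : R := \prod_(i <- s) X i w.

Lemma monomial_count s w :
  monomial s w = \prod_i X i w ^+ count_mem i s.
Proof.
rewrite /monomial; elim: s => [|k s IH].
  by rewrite big_nil big1 // => i _; rewrite expr0.
rewrite big_cons IH /=.
under [RHS]eq_bigr do rewrite exprD.
rewrite big_split /=; congr (_ * _).
rewrite (bigD1 k) //= eqxx expr1 big1 ?mulr1 // => i ik.
by rewrite eq_sym (negbTE ik).
Qed.

Lemma Ex_monomial s :
  Ex P (monomial s) = \prod_i Ex P (fun w => X i w ^+ count_mem i s).
Proof.
rewrite -(Ex_prod_indep X_indep (h := fun i x => x ^+ count_mem i s)).
- by congr Ex; apply/funext => w; rewrite monomial_count.
- by move=> i; exact: measurable_funX.
- by move=> i; exact: all_moments_exp.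
Qed.

Lemma all_moments_monomial s : all_moments P (monomial s).
Proof. exact: all_moments_prod. Qed.

(** An explicit list of monomials, so that expectations of products are reduced
    to joint moments by bilinearity alone. *)
Definition polyIn (D : pred I) (f : T -> R) : Prop :=
  exists2 l : seq (R * seq I), all (fun t => all D t.2) l &
    f = fun w => \sum_(t <- l) t.1 * monomial t.2 w.

Lemma polyIn_all_moments D f : polyIn D f -> all_moments P f.
Proof.
move=> [l _ ->]; apply: all_moments_sum => t.
by apply: all_moments_scale; exact: all_moments_monomial.
Qed.

Lemma polyIn_cst D (c : R) : polyIn D (fun=> c).
Proof.
exists [:: (c, [::])] => //; apply/funext => w.
by rewrite big_seq1 /monomial big_nil mulr1.
Qed.

Lemma polyIn_var (D : pred I) i : D i -> polyIn D (X i).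
Proof.
move=> Di; exists [:: (1, [:: i])]; first by rewrite /= Di.
by apply/funext => w; rewrite big_seq1 /monomial big_seq1 mul1r.
Qed.

Lemma polyIn_add D f g : polyIn D f -> polyIn D g ->
  polyIn D (fun w => f w + g w).
Proof.
move=> [l lD ->] [l' lD' ->]; exists (l ++ l'); first by rewrite all_cat lD.
by apply/funext => w; rewrite big_cat.
Qed.

Lemma polyIn_mul D f g : polyIn D f -> polyIn D g ->
  polyIn D (fun w => f w * g w).
Proof.
move=> [l lD ->] [l' lD' ->].
exists [seq (t.1 * u.1, t.2 ++ u.2) | t <- l, u <- l'].
  apply/allP => _ /allpairsP[[t u] /= [tl ul ->]] /=.
  by rewrite all_cat (allP lD _ tl) (allP lD' _ ul).
apply/funext => w; rewrite big_allpairs_dep mulr_suml; apply: eq_bigr => t _.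
rewrite mulr_sumr; apply: eq_bigr => u _ /=.
by rewrite /monomial big_cat /=; ring.
Qed.

Lemma polyIn_sum D (J : Type) (s : seq J) (Q : pred J) (f : J -> T -> R) :
  (forall j, polyIn D (f j)) -> polyIn D (fun w => \sum_(j <- s | Q j) f j w).
Proof.
move=> fD; elim: s => [|j s IH].
  by under eq_fun do rewrite big_nil; exact: polyIn_cst.
under eq_fun do rewrite big_cons.
by case: (Q j) => //; exact: polyIn_add.
Qed.

Lemma polyIn_prod D (J : eqType) (s : seq J) (f : J -> T -> R) :
  (forall j, j \in s -> polyIn D (f j)) ->
  polyIn D (fun w => \prod_(j <- s) f j w).
Proof.
elim: s => [|j s IH] fD.
  by under eq_fun do rewrite big_nil; exact: polyIn_cst.
under eq_fun do rewrite big_cons; apply: polyIn_mul.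
  by apply: fD; rewrite mem_head.
by apply: IH => k ks; apply: fD; rewrite inE ks orbT.
Qed.

(** For monomials without a common variable this is the factorization of the
    joint moments, since each variable occurs on one side only. *)
Lemma Ex_mul_polyIn (D D' : pred I) f g :
  (forall i, D i -> D' i -> False) -> polyIn D f -> polyIn D' g ->
  Ex P (fun w => f w * g w) = Ex P f * Ex P g.
Proof.
move=> dis [l lD ->] [l' lD' ->].
have am (c : R) s : all_moments P (fun w => c * monomial s w).
  by apply: all_moments_scale; exact: all_moments_monomial.
rewrite !Ex_sum // mulr_suml.
transitivity (Ex P (fun w => \sum_(t <- l)
    \sum_(u <- l') (t.1 * monomial t.2 w) * (u.1 * monomial u.2 w))).
  congr Ex; apply/funext => w; rewrite mulr_suml; apply: eq_bigr => t _.
  by rewrite mulr_sumr.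
have am2 (t u : R * seq I) :
    all_moments P (fun w => (t.1 * monomial t.2 w) * (u.1 * monomial u.2 w)).
  exact: all_moments_mul.
rewrite Ex_sum; last by move=> t; exact: all_moments_sum.
rewrite [LHS]big_seq [RHS]big_seq; apply: eq_bigr => t tl.
rewrite Ex_sum // mulr_sumr.
rewrite [LHS]big_seq [RHS]big_seq; apply: eq_bigr => u ul.
have tD := allP lD _ tl; have uD := allP lD' _ ul.
rewrite !ExZ; try exact: all_moments_monomial.
transitivity (Ex P (fun w => (t.1 * u.1) * monomial (t.2 ++ u.2) w)).
  by congr Ex; apply/funext => w; rewrite /monomial big_cat /=; ring.
rewrite ExZ; last exact: all_moments_monomial.
rewrite mulrACA; congr (_ * _).
rewrite !Ex_monomial -big_split; apply: eq_bigr => i _ /=.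
rewrite count_cat.
have E1 : Ex P (fun w => X i w ^+ 0) = 1.
  by under eq_fun do rewrite expr0; rewrite Ex_cst.
have [it|it] := boolP (i \in t.2).
  have /count_memPn -> : i \notin u.2.
    by apply/negP => iu; exact: (dis i (allP tD _ it) (allP uD _ iu)).
  by rewrite addn0 E1 mulr1.
by move/count_memPn: it => ->; rewrite add0n E1 mul1r.
Qed.

End PolynomialVariables.

(** * Bilinear and quadratic forms in independent columns *)

Lemma sum_delta_l (K : pzSemiRingType) (J : finType) (a : J) (F : J -> K) :
  \sum_b (a == b)%:R * F b = F a.
Proof.
rewrite (bigD1 a) //= eqxx mul1r big1 ?addr0 // => b.
by rewrite eq_sym => /negbTE ->; rewrite mul0r.
Qed.

Definition frob (R : pzRingType) (m n : nat) (U : 'M[R]_(m, n)) : R :=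
  \sum_a \sum_b U a b ^+ 2.

Lemma frobE (R : pzRingType) (m n : nat) (U : 'M[R]_(m, n)) :
  frob U = \tr (U *m U^T).
Proof.
by apply: eq_bigr => a _; rewrite mxE; apply: eq_bigr => b _; rewrite mxE expr2.
Qed.

(** Rank one matrices arise when two bilinear forms share a column. *)
Lemma frob_outer (R : comPzRingType) (m n : nat) (u : 'cV[R]_m) (v : 'rV[R]_n) :
  frob (u *m v) = (u^T *m u) 0 0 * (v *m v^T) 0 0.
Proof.
rewrite /frob !mxE mulr_suml; apply: eq_bigr => a _.
rewrite mulr_sumr; apply: eq_bigr => b _.
by rewrite !mxE big_ord1 exprMn !expr2 mulrACA mulrA.
Qed.

Section Columns.
Context (d : measure_display) (T : measurableType d) (R : realType).
Context (P : probability T R) (N M : nat).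
Context (X : 'I_N -> 'I_M -> {RV P >-> R}).

Definition entry (ij : 'I_N * 'I_M) : {RV P >-> R} := X ij.1 ij.2.

Hypothesis X_indep : mutually_independent entry.
Hypothesis X_all_moments : forall i j, all_moments P (X i j).
Hypothesis X_mean : forall i j, Ex P (X i j) = 0.
Hypothesis X_square : forall i j, Ex P (fun w => X i j w ^+ 2) = 1.

Let entry_all_moments ij : all_moments P (entry ij) := X_all_moments ij.1 ij.2.

(** The factors that an expectation over column [j] treats as constants. *)
Definition free_of (j : 'I_M) : (T -> R) -> Prop :=
  polyIn entry (fun ij => ij.2 != j).

Definition mx_free_of (m n : nat) (j : 'I_M) (U : T -> 'M[R]_(m, n)) : Prop :=
  forall a b, free_of j (fun w => U w a b).

Definition colX (j : 'I_M) (w : T) : 'cV[R]_N := \col_i X i j w.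

Definition bil (A : 'M[R]_N) (j k : 'I_M) (w : T) : R :=
  ((colX j w)^T *m A *m colX k w) 0 0.

Definition quad (j : 'I_M) (U : 'M[R]_N) (w : T) : R :=
  \sum_(p : 'I_N * 'I_N) U p.1 p.2 * (X p.1 j w * X p.2 j w).

(** The covariance of the quadratic forms with matrices [U] and [V] in column
    [j]: the two Gaussian pairings, and a diagonal term that accounts for the
    fourth cumulants of the entries. *)
Definition quad_cov (j : 'I_M) (U V : 'M[R]_N) : R :=
  \sum_a \sum_b U a b * V a b + \sum_a \sum_b U a b * V b a +
  \sum_a (Ex P (fun w => X a j w ^+ 4) - 3%:R) * (U a a * V a a).

Lemma free_of_all_moments j f : free_of j f -> all_moments P f.
Proof. exact: (polyIn_all_moments entry_all_moments). Qed.

Lemma free_of_var i j k : k != j -> free_of j (X i k).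
Proof. by move=> kj; apply: (@polyIn_var _ _ _ _ _ entry _ (i, k)). Qed.

Lemma mx_free_of_col j k : k != j -> mx_free_of j (colX k).
Proof.
by move=> kj a b; under eq_fun do rewrite mxE; exact: free_of_var.
Qed.

Lemma mx_free_of_cst m n j (A : 'M[R]_(m, n)) : mx_free_of j (fun=> A).
Proof. by move=> a b; exact: polyIn_cst. Qed.

Lemma mx_free_of_mul m n p j (U : T -> 'M[R]_(m, n)) (V : T -> 'M[R]_(n, p)) :
  mx_free_of j U -> mx_free_of j V -> mx_free_of j (fun w => U w *m V w).
Proof.
move=> fU fV a b; under eq_fun do rewrite mxE.
by apply: polyIn_sum => k; apply: polyIn_mul; [exact: fU|exact: fV].
Qed.

Lemma mx_free_of_tr m n j (U : T -> 'M[R]_(m, n)) :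
  mx_free_of j U -> mx_free_of j (fun w => (U w)^T).
Proof. by move=> fU a b; under eq_fun do rewrite mxE; exact: fU. Qed.

Lemma free_of_bil A j k l : k != j -> l != j -> free_of j (bil A k l).
Proof.
move=> kj lj; rewrite /bil.
have : mx_free_of j (fun w => (colX k w)^T *m A *m colX l w); last exact.
apply: mx_free_of_mul; last exact: mx_free_of_col.
apply: mx_free_of_mul; last exact: mx_free_of_cst.
by apply: mx_free_of_tr; exact: mx_free_of_col.
Qed.

Lemma polyIn_bil A j k : polyIn entry predT (bil A j k).
Proof.
rewrite /bil; under eq_fun do rewrite mxE.
apply: polyIn_sum => a; apply: polyIn_mul.
  under eq_fun do rewrite mxE.
  apply: polyIn_sum => b; apply: polyIn_mul; last exact: polyIn_cst.
  by under eq_fun do rewrite !mxE; apply: (@polyIn_var _ _ _ _ _ entry _ (b,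
      j)).
by under eq_fun do rewrite !mxE; apply: (@polyIn_var _ _ _ _ _ entry _ (a, k)).
Qed.

Lemma all_moments_bil A j k : all_moments P (bil A j k).
Proof. exact: (polyIn_all_moments entry_all_moments (polyIn_bil A j k)). Qed.

Lemma bil_quad A j w : bil A j j w = quad j A w.
Proof.
rewrite /bil /quad mxE.
under eq_bigr do rewrite mxE mulr_suml.
rewrite exchange_big pair_big /=; apply: eq_bigr => p _.
by rewrite !mxE; ring.
Qed.

Lemma Ex_col_factor j (s : seq 'I_N) f : free_of j f ->
  Ex P (fun w => (\prod_(a <- s) X a j w) * f w) =
  Ex P (fun w => \prod_(a <- s) X a j w) * Ex P f.
Proof.
move=> fj.
apply: (Ex_mul_polyIn X_indep entry_all_moments (D := fun ij => ij.2 == j))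
  fj => [i /= ->//|].
apply: polyIn_prod => a _.
by apply: (@polyIn_var _ _ _ _ _ entry _ (a, j)); rewrite /= eqxx.
Qed.

(** A centred entry that occurs only once kills the expectation. *)
Lemma Ex_isolated j a (s : seq 'I_N) : a \notin s ->
  Ex P (fun w => X a j w * \prod_(b <- s) X b j w) = 0.
Proof.
move=> sa.
rewrite (Ex_mul_polyIn X_indep entry_all_moments (D := pred1 (a, j))
  (D' := predC1 (a, j))).
- by rewrite X_mean mul0r.
- by move=> i /= ->.
- by apply: (@polyIn_var _ _ _ _ _ entry _ (a, j)); rewrite /= eqxx.
apply: polyIn_prod => b bs.
apply: (@polyIn_var _ _ _ _ _ entry _ (b, j)).
by rewrite /= xpair_eqE negb_and (memPn sa).
Qed.

Lemma Ex_pair j a b : Ex P (fun w => X a j w * X b j w) = (a == b)%:R.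
Proof.
have [->|ab] := eqVneq a b.
  by rewrite -[RHS](X_square b j); congr Ex; apply/funext => w; rewrite expr2.
transitivity (Ex P (fun w => X a j w * \prod_(b <- [:: b]) X b j w)); last
    first.
  by rewrite Ex_isolated ?inE.
by congr Ex; apply/funext => w; rewrite big_seq1.
Qed.

(** The three pairings of the four indices contribute, with a correction where
    all of them agree. *)
Lemma Ex_quadruple j a b c e :
  Ex P (fun w => X a j w * X b j w * (X c j w * X e j w)) =
  (a == b)%:R * (c == e)%:R + (a == c)%:R * (b == e)%:R +
  (a == e)%:R * (b == c)%:R +
  (Ex P (fun w => X a j w ^+ 4) - 3%:R) *
    ((a == b)%:R * (a == c)%:R * (a == e)%:R).
Proof.
have iso (x y z t : 'I_N) : x \notin [:: y; z; t] ->
    (forall w, X a j w * X b j w * (X c j w * X e j w) =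
      X x j w * (X y j w * X z j w * X t j w)) ->
    Ex P (fun w => X a j w * X b j w * (X c j w * X e j w)) = 0.
  move=> xs E; rewrite -(@Ex_isolated j _ _ xs); congr Ex; apply/funext => w.
  by rewrite E !big_cons big_nil mulr1 !mulrA.
have sq2 x y : x != y ->
    Ex P (fun w => X x j w ^+ 2 * X y j w ^+ 2) = 1.
  move=> xy.
  rewrite (Ex_mul_polyIn X_indep entry_all_moments (D := pred1 (x, j))
    (D' := predC1 (x, j))) ?X_square ?mulr1 //.
  - by move=> i /= ->.
  - under eq_fun do rewrite expr2.
    by apply: polyIn_mul; apply: (@polyIn_var _ _ _ _ _ entry _ (x, j));
      rewrite /= eqxx.
  - under eq_fun do rewrite expr2.
    by apply: polyIn_mul; apply: (@polyIn_var _ _ _ _ _ entry _ (y, j));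
      rewrite /= xpair_eqE negb_and eq_sym xy.
have two x y : x != y -> (forall w, X a j w * X b j w * (X c j w * X e j w) =
      X x j w ^+ 2 * X y j w ^+ 2) ->
    Ex P (fun w => X a j w * X b j w * (X c j w * X e j w)) = 1.
  by move=> xy E; rewrite -(sq2 _ _ xy); congr Ex; apply/funext => w; rewrite E.
have [ab|ab] := eqVneq a b; last first.
  have [ac|ac] := eqVneq a c.
    have [be|be] := eqVneq b e.
      subst c e; rewrite (two a b ab); last by move=> w; ring.
      by rewrite (negbTE ab) /=; ring.
    rewrite (iso b a c e); last by move=> w; ring.
      by subst c; rewrite [b == a]eq_sym (negbTE ab) /=; ring.
    by rewrite !inE !negb_or [b == a]eq_sym ab -ac [b == a]eq_sym ab be.
  have [ae|ae] := eqVneq a e.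
    have [bc|bc] := eqVneq b c.
      by subst c e; rewrite (two a b ab) => [|w]; rewrite /=; ring.
    rewrite (iso b a c e); last by move=> w; ring.
      by rewrite /=; ring.
    by rewrite !inE !negb_or -ae [b == a]eq_sym ab bc.
  rewrite (iso a b c e); [by rewrite /=; ring| |by move=> w; ring].
  by rewrite !inE !negb_or ab ac ae.
subst b; have [ce|ce] := eqVneq c e.
  have [ac|ac] := eqVneq a c.
    subst c e; rewrite eqxx.
    rewrite (_ : (fun w => X a j w * _ * _) = (fun w => X a j w ^+ 4)).
      by rewrite /=; ring.
    by apply/funext => w; ring.
  subst e; rewrite (two a c ac); last by move=> w; ring.
  by rewrite ?(negbTE ac) /=; ring.
have [ac|ac] := eqVneq a c.
  subst c; rewrite (iso e a a a); last by move=> w; ring.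
    by rewrite (negbTE ce) /=; ring.
  by rewrite !inE !negb_or eq_sym ce.
rewrite (iso c a a e); last by move=> w; ring.
  by rewrite /=; ring.
by rewrite !inE !negb_or eq_sym ac ce.
Qed.

(** Column [j] is independent of the remaining entries, so its entries can be
    integrated out first. *)
Lemma Ex_quad j (U : T -> 'M[R]_N) (Z : T -> R) :
  mx_free_of j U -> free_of j Z ->
  Ex P (fun w => quad j (U w) w * Z w) = Ex P (fun w => \tr (U w) * Z w).
Proof.
move=> fU fZ.
have fUZ a b : free_of j (fun w => U w a b * Z w).
  by apply: polyIn_mul => //; exact: fU.
have am (p : 'I_N * 'I_N) : all_moments P
    (fun w => \prod_(a <- [:: p.1; p.2]) X a j w * (U w p.1 p.2 * Z w)).
  apply: all_moments_mul; first exact: all_moments_prod.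
  exact: (free_of_all_moments (fUZ _ _)).
transitivity (Ex P (fun w => \sum_(p : 'I_N * 'I_N)
    \prod_(a <- [:: p.1; p.2]) X a j w * (U w p.1 p.2 * Z w))).
  congr Ex; apply/funext => w; rewrite /quad mulr_suml; apply: eq_bigr => p _.
  by rewrite !big_cons big_nil; ring.
rewrite Ex_sum //.
under eq_bigr => p _.
  rewrite Ex_col_factor //.
  rewrite (_ : (fun w => \prod_(a <- _) _) = (fun w => X p.1 j w * X p.2 j w)).
    rewrite Ex_pair.
  over.
    by apply/funext => w; rewrite !big_cons big_nil mulr1.
rewrite -(pair_bigA _ (fun a b => (a == b)%:R * Ex P (fun w => U w a b * Z w)))
    /=.
under eq_bigr do rewrite sum_delta_l.
rewrite -Ex_sum; last by move=> i; exact: (free_of_all_moments (fUZ _ _)).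
by congr Ex; apply/funext => w; rewrite /mxtrace mulr_suml.
Qed.

Lemma sum_quadruple j (U V : 'M[R]_N) :
  \sum_(p : 'I_N * 'I_N) \sum_(q : 'I_N * 'I_N)
    Ex P (fun w => X p.1 j w * X p.2 j w * (X q.1 j w * X q.2 j w)) *
    (U p.1 p.2 * V q.1 q.2) =
  \tr U * \tr V + quad_cov j U V.
Proof.
have [k kE] : exists k, forall a, k a = Ex P (fun w => X a j w ^+ 4) - 3%:R.
  by eexists.
under eq_bigr => p _ do under eq_bigr => q _ do
  rewrite Ex_quadruple -kE !mulrDl.
under eq_bigr => p _ do rewrite !big_split /=.
rewrite !big_split /= /quad_cov -!addrA; congr (_ + (_ + (_ + _))).
- transitivity (\sum_(p : 'I_N * 'I_N) ((p.1 == p.2)%:R * U p.1 p.2) * \tr V).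
    apply: eq_bigr => p _.
    transitivity (\sum_(q : 'I_N * 'I_N)
        ((p.1 == p.2)%:R * U p.1 p.2) * ((q.1 == q.2)%:R * V q.1 q.2)).
      by apply: eq_bigr => q _; ring.
    rewrite -mulr_sumr; congr (_ * _).
    rewrite -(pair_bigA _ (fun a b => (a == b)%:R * V a b)) /=.
    by apply: eq_bigr => a _; rewrite sum_delta_l.
  rewrite -mulr_suml; congr (_ * _).
  rewrite -(pair_bigA _ (fun a b => (a == b)%:R * U a b)) /=.
  by apply: eq_bigr => a _; rewrite sum_delta_l.
- rewrite -(pair_bigA _ (fun a b => \sum_(q : 'I_N * 'I_N)
    (a == q.1)%:R * (b == q.2)%:R * (U a b * V q.1 q.2))) /=.
  apply: eq_bigr => a _; apply: eq_bigr => b _.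
  rewrite -(pair_bigA _ (fun c e => (a == c)%:R * (b == e)%:R * (U a b * V c
      e))) /=.
  under eq_bigr => c _ do under eq_bigr => e _ do rewrite -mulrA mulrCA.
  under eq_bigr => c _ do rewrite sum_delta_l.
  by rewrite sum_delta_l.
- rewrite -(pair_bigA _ (fun a b => \sum_(q : 'I_N * 'I_N)
    (a == q.2)%:R * (b == q.1)%:R * (U a b * V q.1 q.2))) /=.
  apply: eq_bigr => a _; apply: eq_bigr => b _.
  rewrite -(pair_bigA _ (fun c e => (a == e)%:R * (b == c)%:R * (U a b * V c
      e))) /=.
  under eq_bigr => c _ do under eq_bigr => e _ do rewrite -mulrA.
  under eq_bigr => c _ do rewrite sum_delta_l.
  by rewrite sum_delta_l.
- rewrite -(pair_bigA _ (fun a b => \sum_(q : 'I_N * 'I_N)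
    k a *
    ((a == b)%:R * (a == q.1)%:R * (a == q.2)%:R) * (U a b * V q.1 q.2))) /=.
  apply: eq_bigr => a _; rewrite -kE.
  transitivity (\sum_b (a == b)%:R * \sum_c (a == c)%:R * \sum_e (a == e)%:R *
     (k a * (U a b * V c e))).
    apply: eq_bigr => b _; rewrite mulr_sumr.
    rewrite -(pair_bigA _ (fun c e => k a *
      ((a == b)%:R * (a == c)%:R * (a == e)%:R) * (U a b * V c e))) /=.
    apply: eq_bigr => c _; rewrite !mulr_sumr; apply: eq_bigr => e _; ring.
  by rewrite !sum_delta_l.
Qed.

Lemma Ex_quad2 j (U V : T -> 'M[R]_N) (Z : T -> R) :
  mx_free_of j U -> mx_free_of j V -> free_of j Z ->
  Ex P (fun w => quad j (U w) w * quad j (V w) w * Z w) =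
  Ex P (fun w => (\tr (U w) * \tr (V w) + quad_cov j (U w) (V w)) * Z w).
Proof.
move=> fU fV fZ.
pose G (p q : 'I_N * 'I_N) w := U w p.1 p.2 * V w q.1 q.2 * Z w.
have fG p q : free_of j (G p q).
  by apply: polyIn_mul => //; apply: polyIn_mul; [exact: fU|exact: fV].
pose m (p q : 'I_N * 'I_N) w := \prod_(a <- [:: p.1; p.2; q.1; q.2]) X a j w.
have mE p q : m p q = (fun w => X p.1 j w * X p.2 j w * (X q.1 j w * X q.2 j
    w)).
  by apply/funext => w; rewrite /m !big_cons big_nil; ring.
have am p q : all_moments P (fun w => m p q w * G p q w).
  apply: all_moments_mul; first exact: all_moments_prod.
  exact: (free_of_all_moments (fG _ _)).
transitivity (Ex P (fun w => \sum_p \sum_q m p q w * G p q w)).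
  congr Ex; apply/funext => w; rewrite /quad !mulr_suml; apply: eq_bigr => p _.
  rewrite mulr_sumr mulr_suml; apply: eq_bigr => q _.
  by rewrite mE /G; ring.
rewrite Ex_sum; last by move=> p; exact: all_moments_sum.
transitivity (\sum_p \sum_q Ex P (m p q) * Ex P (G p q)).
  apply: eq_bigr => p _; rewrite Ex_sum //; apply: eq_bigr => q _.
  exact: Ex_col_factor.
have amG (c : R) p q : all_moments P (fun w => c * G p q w).
  by apply: all_moments_scale; exact: (free_of_all_moments (fG _ _)).
transitivity (Ex P (fun w => \sum_p \sum_q Ex P (m p q) * G p q w)).
  rewrite Ex_sum; last by move=> p; exact: all_moments_sum.
  apply: eq_bigr => p _; rewrite Ex_sum //; apply: eq_bigr => q _.
  by rewrite ExZ //; exact: (free_of_all_moments (fG _ _)).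
congr Ex; apply/funext => w; rewrite -sum_quadruple mulr_suml.
apply: eq_bigr => p _; rewrite mulr_suml; apply: eq_bigr => q _.
by rewrite mE /G mulrA.
Qed.


(** The weight [t] balances two matrices of different sizes, in place of the
    geometric mean of their Frobenius norms. *)
Lemma norm_quad_cov_le (K t : R) j (U V : 'M[R]_N) : 0 < t ->
  (forall i, Ex P (fun w => X i j w ^+ 4) <= K) ->
  `|quad_cov j U V| <= (K + 5%:R) / 2%:R * (t * frob U + t^-1 * frob V).
Proof.
move=> t0 XK.
have amgm (x y : R) : `|x * y| <= (t * x ^+ 2 + t^-1 * y ^+ 2) / 2%:R.
  rewrite ler_pdivlMr // -subr_ge0.
  have tE : t * t^-1 = 1 by rewrite divff // gt_eqF.
  have sq z : 0 <= t * (x + z * t^-1 * y) ^+ 2.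
    by rewrite mulr_ge0 ?sqr_ge0 // ltW.
  rewrite normrM; have := sq 1; have := sq (-1).
  have eq z : t * (x + z * t^-1 * y) ^+ 2 =
      t * x ^+ 2 + (t * t^-1) * (z * x * y *+ 2 + z ^+ 2 * t^-1 * y ^+ 2).
    by ring.
  rewrite !eq tE !mul1r sqrrN expr1n mul1r => h1 h2.
  rewrite -normrM; case: (ger0P (x * y)) => _; lra.
have b1 : `|\sum_a \sum_b U a b * V a b| <= (t * frob U + t^-1 * frob V) / 2%:R.
  rewrite (le_trans (ler_norm_sum _ _ _)) // /frob !mulr_sumr -big_split
      mulr_suml.
  apply: ler_sum => a _ /=.
  rewrite (le_trans (ler_norm_sum _ _ _)) // !mulr_sumr -big_split mulr_suml.
  by apply: ler_sum => b _ /=.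
have b2 : `|\sum_a \sum_b U a b * V b a| <= (t * frob U + t^-1 * frob V) / 2%:R.
  have -> : frob V = \sum_a \sum_b V b a ^+ 2 by rewrite /frob exchange_big.
  rewrite (le_trans (ler_norm_sum _ _ _)) // /frob !mulr_sumr -big_split
      mulr_suml.
  apply: ler_sum => a _ /=.
  rewrite (le_trans (ler_norm_sum _ _ _)) // !mulr_sumr -big_split mulr_suml.
  by apply: ler_sum => b _ /=.
have b3 : `|\sum_a (Ex P (fun w => X a j w ^+ 4) - 3%:R) * (U a a * V a a)| <=
    (K + 3%:R) * ((t * frob U + t^-1 * frob V) / 2%:R).
  rewrite (le_trans (ler_norm_sum _ _ _)) // /frob !mulr_sumr -big_split
      mulr_suml.
  rewrite mulr_sumr; apply: ler_sum => a _ /=; rewrite normrM.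
  have m0 : 0 <= Ex P (fun w => X a j w ^+ 4).
    by apply: Ex_ge0 => w; rewrite exprn_even_ge0.
  apply: ler_pM => //.
    by have := XK a; rewrite ler_norml => mK; apply/andP; split; lra.
  have row_le (W : 'M[R]_N) : W a a ^+ 2 <= \sum_b W a b ^+ 2.
    by rewrite (bigD1 a) //= lerDl sumr_ge0 // => b _; exact: sqr_ge0.
  apply: (le_trans (amgm _ _)); rewrite ler_pM2r //.
  by apply: lerD; rewrite ler_pM2l ?invr_gt0.
rewrite /quad_cov (le_trans (ler_normD _ _)) //.
rewrite (le_trans (lerD (ler_normD _ _) (lexx _))) //.
rewrite (le_trans (lerD (lerD b1 b2) b3)) // le_eqVlt; apply/orP; left.
by apply/eqP; field; rewrite gt_eqF.
Qed.

(** Seen from column [j] alone, the product of two bilinear forms is a quadratic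
    form of rank one. *)
Lemma bil_mul_quad (A C : 'M[R]_N) i j k w :
  bil A i j w * bil C j k w =
  quad j (C *m colX k w *m ((colX i w)^T *m A)) w.
Proof.
rewrite /bil /quad -[X in _ * X]/(((colX j w)^T *m C *m colX k w) 0 0).
rewrite -(mulmxA (colX j w)^T C) !mxE mulrC mulr_suml.
rewrite -(pair_bigA _ (fun a b => (C *m colX k w *m ((colX i w)^T *m A)) a b *
   (X a j w * X b j w))) /=.
apply: eq_bigr => a _; rewrite mulr_sumr; apply: eq_bigr => b _.
rewrite [in RHS]mxE big_ord1 !mxE; ring.
Qed.

Lemma Ex_bil_contract (A C : 'M[R]_N) i j k (Z : T -> R) :
  i != j -> k != j -> free_of j Z ->
  Ex P (fun w => bil A i j w * bil C j k w * Z w) =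
  Ex P (fun w => bil (A *m C) i k w * Z w).
Proof.
move=> ij kj fZ.
have -> : (fun w => bil A i j w * bil C j k w * Z w) =
  (fun w => quad j (C *m colX k w *m ((colX i w)^T *m A)) w * Z w).
  by apply/funext => w; rewrite bil_mul_quad.
rewrite Ex_quad //.
  congr Ex; apply/funext => w; congr (_ * _).
  by rewrite mxtrace_mulC /bil -[RHS]trace_mx11 !mulmxA.
do 2?apply: mx_free_of_mul; try exact: mx_free_of_cst;
  try apply: mx_free_of_tr; exact: mx_free_of_col.
Qed.

Lemma Ex_bil_trace (A : 'M[R]_N) j : Ex P (bil A j j) = \tr A.
Proof.
transitivity (Ex P (fun w => quad j A w * 1)).
  by congr Ex; apply/funext => w; rewrite bil_quad mulr1.
rewrite (Ex_quad (U := fun=> A) (Z := fun=> 1)) ?Ex_cst ?mulr1 //.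
- exact: mx_free_of_cst.
- exact: polyIn_cst.
Qed.

Lemma Ex_bil2 (A C : 'M[R]_N) j :
  Ex P (fun w => bil A j j w * bil C j j w) =
  \tr A * \tr C + quad_cov j A C.
Proof.
transitivity (Ex P (fun w => quad j A w * quad j C w * 1)).
  by congr Ex; apply/funext => w; rewrite !bil_quad mulr1.
rewrite (Ex_quad2 (U := fun=> A) (V := fun=> C) (Z := fun=> 1)) //.
- by rewrite Ex_cst mulr1.
- exact: mx_free_of_cst.
- exact: mx_free_of_cst.
- exact: polyIn_cst.
Qed.

Lemma mx_free_of_outer (A C : 'M[R]_N) i k j : i != j -> k != j ->
  mx_free_of j (fun w => C *m colX k w *m ((colX i w)^T *m A)).
Proof.
move=> ij kj; do 2?apply: mx_free_of_mul; try exact: mx_free_of_cst;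
  try apply: mx_free_of_tr; exact: mx_free_of_col.
Qed.

(** Here and below, the digits list the columns of a word of length four; the
    second column is integrated out, which leaves forms in the first one. *)
Lemma Ex_bil_1122 (A1 A2 A3 A4 : 'M[R]_N) i j : i != j ->
  Ex P (fun w => bil A1 i i w * bil A2 i j w * bil A3 j j w *
                 bil A4 j i w) =
  Ex P (fun w => (\tr A3 * bil (A2 *m A4) i i w +
    quad_cov j A3 (A4 *m colX i w *m ((colX i w)^T *m A2))) *
    bil A1 i i w).
Proof.
move=> ij.
transitivity (Ex P (fun w => quad j A3 w *
    quad j (A4 *m colX i w *m ((colX i w)^T *m A2)) w * bil A1 i i w)).
  by congr Ex; apply/funext => w; rewrite -bil_mul_quad -bil_quad; ring.
rewrite (Ex_quad2 (U := fun=> A3)) //.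
- congr Ex; apply/funext => w; congr ((_ * _ + _) * _).
  by rewrite mxtrace_mulC /bil -[RHS]trace_mx11 !mulmxA.
- exact: mx_free_of_cst.
- exact: mx_free_of_outer.
- exact: free_of_bil.
Qed.

Lemma Ex_bil_1212 (A1 A2 A3 A4 : 'M[R]_N) i j : i != j ->
  Ex P (fun w => bil A1 i j w * bil A2 j i w * bil A3 i j w *
                 bil A4 j i w) =
  Ex P (fun w => bil (A1 *m A2) i i w * bil (A3 *m A4) i i w +
    quad_cov j (A2 *m colX i w *m ((colX i w)^T *m A1))
      (A4 *m colX i w *m ((colX i w)^T *m A3))).
Proof.
move=> ij.
transitivity (Ex P (fun w =>
    quad j (A2 *m colX i w *m ((colX i w)^T *m A1)) w *
    quad j (A4 *m colX i w *m ((colX i w)^T *m A3)) w * 1)).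
  by congr Ex; apply/funext => w; rewrite -!bil_mul_quad; ring.
rewrite (Ex_quad2 (Z := fun=> 1)) //.
- congr Ex; apply/funext => w; rewrite mulr1; congr (_ * _ + _).
    by rewrite mxtrace_mulC /bil -[RHS]trace_mx11 !mulmxA.
  by rewrite mxtrace_mulC /bil -[RHS]trace_mx11 !mulmxA.
- exact: mx_free_of_outer.
- exact: mx_free_of_outer.
- exact: polyIn_cst.
Qed.

Lemma frob_outer_bil (A C : 'M[R]_N) i w :
  frob (C *m colX i w *m ((colX i w)^T *m A)) =
  bil (C^T *m C) i i w * bil (A *m A^T) i i w.
Proof.
by rewrite frob_outer !trmx_mul !trmxK /bil !mulmxA.
Qed.

Lemma all_moments_quad_cov_outer (A1 A2 A3 A4 : 'M[R]_N) i j : i != j ->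
  all_moments P (fun w =>
    quad_cov j (A2 *m colX i w *m ((colX i w)^T *m A1))
      (A4 *m colX i w *m ((colX i w)^T *m A3))).
Proof.
move=> ij.
pose U w := A2 *m colX i w *m ((colX i w)^T *m A1).
pose V w := A4 *m colX i w *m ((colX i w)^T *m A3).
have aU a b : all_moments P (fun w => U w a b).
  by apply: (free_of_all_moments (mx_free_of_outer _ _ ij ij _ _)).
have aV a b : all_moments P (fun w => V w a b).
  by apply: (free_of_all_moments (mx_free_of_outer _ _ ij ij _ _)).
rewrite /quad_cov; do 2?apply: all_moments_add.
- by do 2?(apply: all_moments_sum => ?); apply: all_moments_mul.
- by do 2?(apply: all_moments_sum => ?); apply: all_moments_mul.
- by apply: all_moments_sum => ?; apply: all_moments_scale; apply:
    all_moments_mul.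
Qed.

Lemma all_moments_quad_cov_cst (A2 A3 A4 : 'M[R]_N) i j : i != j ->
  all_moments P (fun w =>
    quad_cov j A3 (A4 *m colX i w *m ((colX i w)^T *m A2))).
Proof.
move=> ij.
pose V w := A4 *m colX i w *m ((colX i w)^T *m A2).
have aV a b : all_moments P (fun w => V w a b).
  by apply: (free_of_all_moments (mx_free_of_outer _ _ ij ij _ _)).
rewrite /quad_cov; do 2?apply: all_moments_add.
- by do 2?(apply: all_moments_sum => ?); apply: all_moments_scale.
- by do 2?(apply: all_moments_sum => ?); apply: all_moments_scale.
- by apply: all_moments_sum => ?; do 2?apply: all_moments_scale.
Qed.

End Columns.

(** * Families of random variables with bounded moments *)

(** By the identity of Lagrange. *)
Lemma sum_cauchy_schwarz (R : realFieldType) (J : finType) (u v : J -> R) :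
  (\sum_i u i * v i) ^+ 2 <= (\sum_i u i ^+ 2) * (\sum_i v i ^+ 2).
Proof.
have H : 0 <= \sum_i \sum_k (u i * v k - u k * v i) ^+ 2.
  by apply: sumr_ge0 => i _; apply: sumr_ge0 => k _; exact: sqr_ge0.
have E : \sum_i \sum_k (u i * v k - u k * v i) ^+ 2 =
    ((\sum_i u i ^+ 2) * (\sum_i v i ^+ 2) - (\sum_i u i * v i) ^+ 2) *+ 2.
  have e1 (f g : J -> R) : \sum_i \sum_k f i * g k = (\sum_i f i) * (\sum_k g
      k).
    by rewrite mulr_suml; apply: eq_bigr => i _; rewrite mulr_sumr.
  transitivity (\sum_i \sum_k (u i ^+ 2 * v k ^+ 2 +
      (v i ^+ 2 * u k ^+ 2 - (u i * v i) * (u k * v k) *+ 2))).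
    by apply: eq_bigr => i _; apply: eq_bigr => k _; ring.
  under eq_bigr do rewrite !big_split /= sumrN sumrMnl.
  rewrite !big_split /= sumrN sumrMnl !e1; ring.
by move: H; rewrite E pmulrn_lge0 // subr_ge0.
Qed.

Section BoundedMoments.
Context (d : measure_display) (T : measurableType d) (R : realType).
Context (P : probability T R) (J : Type).
Implicit Types f g : J -> T -> R.

(** Asking for all moments makes the notion stable under products. *)
Definition bounded_moments f : Prop :=
  (forall i, all_moments P (f i)) /\
  forall k : nat, exists C : R, forall i, Ex P (fun w => `|f i w| ^+ k) <= C.

(** Convergence to zero in quadratic mean, at the speed [s]. *)
Definition l2_small (s : J -> R) f : Prop :=
  (forall i, all_moments P (f i)) /\
  exists C : R, forall i, Ex P (fun w => f i w ^+ 2) <= C * s i ^+ 2.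

Let absX f k i : (forall i, all_moments P (f i)) ->
  all_moments P (fun w => `|f i w| ^+ k).
Proof. by move=> fi; apply: all_moments_exp; exact: all_moments_norm. Qed.

Lemma bounded_moments_cst (c : J -> R) : (exists C, forall i, `|c i| <= C) ->
  bounded_moments (fun i _ => c i).
Proof.
move=> [C cC]; split=> [i|k]; first exact: all_moments_cst.
exists (C ^+ k) => i; rewrite Ex_cst lerXn2r ?nnegrE //.
exact: le_trans (cC i).
Qed.

Lemma bounded_moments_norm f : bounded_moments f ->
  bounded_moments (fun i w => `|f i w|).
Proof.
move=> [fi fb]; split=> [i|k]; first exact: all_moments_norm.
have [C HC] := fb k; exists C => i; rewrite (le_trans _ (HC i)) //.
by under eq_fun do rewrite normr_id.
Qed.

Lemma bounded_moments_add f g : bounded_moments f -> bounded_moments g ->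
  bounded_moments (fun i w => f i w + g i w).
Proof.
move=> [fi fb] [gi gb]; split=> [i|k]; first exact: all_moments_add.
have [C HC] := fb k; have [C' HC'] := gb k.
exists (2%:R ^+ k * (C + C')) => i.
apply: (@le_trans _ _ (Ex P (fun w => 2%:R ^+ k * (`|f i w| ^+ k + `|g i w| ^+
    k)))).
  apply: Ex_le => [||w]; last exact: norm_add_expr_le.
  - by apply: (@absX (fun i w => f i w + g i w)) => // j; exact:
      all_moments_add.
  - by apply: all_moments_scale; apply: all_moments_add; exact: absX.
rewrite ExZ; last by apply: all_moments_add; exact: absX.
rewrite ExD; [|exact: absX|exact: absX].
by rewrite ler_wpM2l ?exprn_ge0 // lerD.
Qed.

Lemma bounded_moments_mul f g : bounded_moments f -> bounded_moments g ->
  bounded_moments (fun i w => f i w * g i w).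
Proof.
move=> [fi fb] [gi gb]; split=> [i|k]; first exact: all_moments_mul.
have [C HC] := fb (k * 2)%N; have [C' HC'] := gb (k * 2)%N.
exists (C + C') => i.
apply: (@le_trans _ _ (Ex P (fun w => `|f i w| ^+ (k * 2) + `|g i w| ^+ (k *
    2)))).
  apply: Ex_le => [||w].
  - by apply: (@absX (fun i w => f i w * g i w)) => // j; exact:
      all_moments_mul.
  - by apply: all_moments_add; exact: absX.
  - rewrite normrM exprMn !exprM.
    set a := `|f i w| ^+ k; set b := `|g i w| ^+ k.
    have : 0 <= a by rewrite exprn_ge0.
    have : 0 <= b by rewrite exprn_ge0.
    nra.
by rewrite ExD ?lerD //; exact: absX.
Qed.

Lemma bounded_moments_prod (I : Type) (s : seq I) (f : I -> J -> T -> R) :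
  (forall i, bounded_moments (f i)) ->
  bounded_moments (fun j w => \prod_(i <- s) f i j w).
Proof.
move=> fb; elim: s => [|i s IH].
  under eq_fun do under eq_fun do rewrite big_nil.
  by apply: bounded_moments_cst; exists 1 => _; rewrite normr1.
under eq_fun do under eq_fun do rewrite big_cons.
exact: bounded_moments_mul.
Qed.

Lemma bounded_moments_exp f k : bounded_moments f ->
  bounded_moments (fun j w => f j w ^+ k).
Proof.
move=> fb; elim: k => [|k IH].
  by apply: (bounded_moments_cst (c := fun=> 1)); exists 1 => _; rewrite normr1.
under eq_fun do under eq_fun do rewrite exprS.
exact: bounded_moments_mul.
Qed.

Lemma bounded_moments_Ex f : bounded_moments f ->
  exists C, forall i, `|Ex P (f i)| <= C.
Proof.
move=> [fi fb]; have [C HC] := fb 1%N; exists C => i.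
rewrite (le_trans _ (HC i)) //; apply: Ex_norm_le => //; exact: absX.
Qed.

(** Moments of order [2 ^ l] are enough, as they control the lower ones. *)
Lemma bounded_moments_pow2 f : (forall i, all_moments P (f i)) ->
  (forall l, exists C : R, forall i, Ex P (fun w => f i w ^+ (2 ^ l.+1)) <= C)
      ->
  bounded_moments f.
Proof.
move=> fi fb; split=> // k; have [C HC] := fb k; exists (1 + C) => i.
have a2 : all_moments P (fun w => f i w ^+ (2 ^ k.+1)) by exact:
    all_moments_exp.
apply: (@le_trans _ _ (Ex P (fun w => 1 + f i w ^+ (2 ^ k.+1)))).
  apply: Ex_le => [||w]; first exact: absX.
    by apply: all_moments_add => //; exact: all_moments_cst.
  have -> : f i w ^+ (2 ^ k.+1) = `|f i w| ^+ (2 ^ k.+1).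
    by rewrite expnS !exprM real_normK ?num_real.
  have [le1|gt1] := leP `|f i w| 1.
    by rewrite ler_wpDr ?exprn_ge0 // exprn_ile1.
  rewrite ler_wpDl // ler_weXn2l ?ltW //.
  by rewrite (leq_trans (ltnW (ltn_expl k (ltnSn 1)))) // leq_exp2l.
by rewrite ExD ?Ex_cst ?lerD2l //; exact: all_moments_cst.
Qed.

(** Cauchy-Schwarz, in the arithmetic-geometric form with weight [s]. *)
Lemma l2_small_mul (s : J -> R) f g : (forall i, 0 < s i) ->
  l2_small s f -> bounded_moments g ->
  exists C, forall i, `|Ex P (fun w => f i w * g i w)| <= C * s i.
Proof.
move=> s0 [fi [C HC]] [gi gb].
have [C' HC'] := gb 2%N; exists (C + C') => i.
have f2 : all_moments P (fun w => f i w ^+ 2) by exact: all_moments_exp.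
have g2 : all_moments P (fun w => `|g i w| ^+ 2) by exact: absX.
apply: (@le_trans _ _ (Ex P (fun w => (s i)^-1 * f i w ^+ 2 + s i * `|g i w| ^+
    2))).
  apply: Ex_norm_le; first exact: all_moments_mul.
    by apply: all_moments_add; apply: all_moments_scale.
  move=> w; rewrite -(real_normK (num_real (f i w))) normrM.
  set a := `|f i w|; set b := `|g i w|.
  have a0 : 0 <= a := normr_ge0 _; have b0 : 0 <= b := normr_ge0 _.
  have : 0 <= s i * ((s i)^-1 * a - b) ^+ 2 by rewrite mulr_ge0 ?sqr_ge0 ?ltW.
  have -> : s i * ((s i)^-1 * a - b) ^+ 2 =
      (s i)^-1 * a ^+ 2 + s i * b ^+ 2 - (a * b) *+ 2.
    by field; rewrite gt_eqF.
  have : 0 <= a * b by exact: mulr_ge0.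
  lra.
rewrite ExD; try exact: all_moments_scale.
rewrite !ExZ // mulrDl lerD //.
  by rewrite ler_pdivrMl // (le_trans (HC i)) // expr2 [leRHS]mulrCA.
by rewrite mulrC ler_wpM2r // ltW.
Qed.

End BoundedMoments.

(** * Sums over tuples sorted by coincidence pattern *)

Lemma sum_index (K : pzRingType) (J : finType) (s : seq J) (G : nat -> K) :
  \sum_j G (index j s) =
  \sum_(j <- undup s) G (index j s) +
  (#|J|%:R - (size (undup s))%:R) * G (size s).
Proof.
rewrite (bigID (mem (undup s))) /=; congr (_ + _).
  by rewrite -big_uniq ?undup_uniq.
rewrite (eq_bigr (fun=> G (size s))); last first.
  by move=> j; rewrite mem_undup => /memNindex ->.
rewrite sumr_const -[LHS]mulr_natl; congr (_ * _).
apply/esym/eqP; rewrite subr_eq -natrD; apply/eqP; congr (_%:R).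
rewrite -(cardC (mem (undup s))) (card_uniqP (undup_uniq s)) addnC.
by congr (_ + _)%N; apply: eq_card.
Qed.

Section PatternSums.
Context (K : comPzRingType) (m : nat) (x : K).

(** The first occurrence numbers [index j2 [:: j1]], [index j3 [:: j1; j2]],
    ... of a tuple encode which of its entries coincide; an entry is new exactly
    when its number is maximal, and is then given the weight [x]. *)
Lemma sum_pattern2 (v : nat -> K) :
  \sum_(j1 < m) \sum_(j2 < m) x ^+ (index j2 [:: j1] == 1)%N * v (index j2 [::
      j1]) =
  m%:R * (v 0%N + (m%:R - 1) * x * v 1%N).
Proof.
rewrite (eq_bigr (fun=> v 0%N + (m%:R - 1) * x * v 1%N)); last first.
  move=> j1 _.
  rewrite (sum_index _ (fun a => x ^+ (a == 1)%N * v a)) card_ord /= big_seq1.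
  by rewrite /= eqxx /=; ring.
by rewrite sumr_const card_ord mulr_natl.
Qed.

Lemma sum_pattern3 (v : nat -> nat -> K) :
  \sum_(j1 < m) \sum_(j2 < m) \sum_(j3 < m)
    x ^+ ((index j2 [:: j1] == 1) + (index j3 [:: j1; j2] == 2))%N *
      v (index j2 [:: j1]) (index j3 [:: j1; j2]) =
  m%:R * (v 0%N 0%N + (m%:R - 1) * x * (v 0%N 2%N + v 1%N 0%N + v 1%N 1%N) +
          (m%:R - 1) * x * ((m%:R - 2%:R) * x) * v 1%N 2%N).
Proof.
pose G (a : nat) : K := if a == 0%N then v 0%N 0%N + (m%:R - 1) * x * v 0%N 2%N
  else x * (v 1%N 0%N + v 1%N 1%N) + x * ((m%:R - 2%:R) * x) * v 1%N 2%N.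
transitivity (\sum_(j1 < m) \sum_(j2 < m) G (index j2 [:: j1])).
  apply: eq_bigr => j1 _; apply: eq_bigr => j2 _.
  rewrite (sum_index _ (fun b => x ^+ ((index j2 [:: j1] == 1) + (b == 2))%N *
      v (index j2 [:: j1]) b)) card_ord.
  have [<-|ne] := eqVneq j1 j2.
    by rewrite /= !inE !eqxx /= big_seq1 /= !eqxx /G /=; ring.
  rewrite /= !inE (negbTE ne) /= !big_cons big_nil /= !eqxx (negbTE ne) /G /=.
  ring.
rewrite (eq_bigr (fun=> G 0%N + (m%:R - 1) * G 1%N)); last first.
  by move=> j1 _; rewrite sum_index card_ord /= big_seq1 /= eqxx.
by rewrite sumr_const card_ord mulr_natl /G /=; congr (_ *+ _); ring.
Qed.

Lemma sum_pattern4 (v : nat -> nat -> nat -> K) :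
  \sum_(j1 < m) \sum_(j2 < m) \sum_(j3 < m) \sum_(j4 < m)
    x ^+ ((index j2 [:: j1] == 1) + (index j3 [:: j1; j2] == 2) +
          (index j4 [:: j1; j2; j3] == 3))%N *
      v (index j2 [:: j1]) (index j3 [:: j1; j2]) (index j4 [:: j1; j2; j3]) =
  m%:R * (v 0%N 0%N 0%N +
    (m%:R - 1) * x * (v 0%N 0%N 3%N + v 0%N 2%N 0%N + v 0%N 2%N 2%N + v 1%N 0%N
        0%N + v 1%N 0%N 1%N + v 1%N 1%N 0%N
      + v 1%N 1%N 1%N) +
    (m%:R - 1) * x * ((m%:R - 2%:R) * x) *
      (v 0%N 2%N 3%N + v 1%N 0%N 3%N + v 1%N 1%N 3%N + v 1%N 2%N 0%N + v 1%N
          2%N 1%N + v 1%N 2%N 2%N) +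
    (m%:R - 1) * x * ((m%:R - 2%:R) * x) * ((m%:R - 3%:R) * x) * v 1%N 2%N 3%N).
Proof.
pose H (a b : nat) : K :=
  if a == 0%N then
    if b == 0%N then v 0%N 0%N 0%N + (m%:R - 1) * x * v 0%N 0%N 3%N
    else x * (v 0%N 2%N 0%N + v 0%N 2%N 2%N) + x * ((m%:R - 2%:R) * x) * v 0%N
        2%N 3%N
  else if b == 0%N then x * (v 1%N 0%N 0%N + v 1%N 0%N 1%N) + x * ((m%:R -
      2%:R) * x) * v 1%N 0%N 3%N
  else if b == 1%N then x * (v 1%N 1%N 0%N + v 1%N 1%N 1%N) + x * ((m%:R -
      2%:R) * x) * v 1%N 1%N 3%N
  else x ^+ 2 * (v 1%N 2%N 0%N + v 1%N 2%N 1%N + v 1%N 2%N 2%N) + x ^+ 2 *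
      ((m%:R - 3%:R) * x) * v 1%N 2%N 3%N.
transitivity (\sum_(j1 < m) \sum_(j2 < m) \sum_(j3 < m)
    H (index j2 [:: j1]) (index j3 [:: j1; j2])).
  apply: eq_bigr => j1 _; apply: eq_bigr => j2 _; apply: eq_bigr => j3 _.
  rewrite (sum_index _ (fun c => x ^+ ((index j2 [:: j1] == 1) +
     (index j3 [:: j1; j2] == 2) + (c == 3))%N *
      v (index j2 [:: j1]) (index j3 [:: j1; j2]) c)) card_ord.
  have [<-|n12] := eqVneq j1 j2.
    have [<-|n13] := eqVneq j1 j3.
      by rewrite /= !inE !eqxx /= big_seq1 /= !eqxx /H /=; ring.
    rewrite /= !inE !eqxx (negbTE n13) /= !big_cons big_nil /= !eqxx (negbTE
        n13).
    by rewrite /H /=; ring.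
  have [<-|n13] := eqVneq j1 j3.
    have n21 : (j2 == j1) = false by rewrite eq_sym (negbTE n12).
    rewrite /= !inE !eqxx ?n21 ?(negbTE n12) ?orbT /= ?n21 !big_cons big_nil /=.
    by rewrite !eqxx ?n21 ?(negbTE n12) /H /=; ring.
  have [<-|n23] := eqVneq j2 j3.
    rewrite /= !inE ?eqxx ?(negbTE n12) /= !big_cons big_nil /=.
    by rewrite ?eqxx ?(negbTE n12) /H /=; ring.
  rewrite /= !inE ?eqxx ?(negbTE n12) ?(negbTE n13) ?(negbTE n23) /=.
  rewrite !big_cons big_nil /= ?eqxx ?(negbTE n12) ?(negbTE n13) ?(negbTE n23).
  by rewrite /H /=; ring.
pose G (a : nat) : K := if a == 0%N then H 0%N 0%N + (m%:R - 1) * H 0%N 2%N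
  else H 1%N 0%N + H 1%N 1%N + (m%:R - 2%:R) * H 1%N 2%N.
transitivity (\sum_(j1 < m) \sum_(j2 < m) G (index j2 [:: j1])).
  apply: eq_bigr => j1 _; apply: eq_bigr => j2 _.
  rewrite (sum_index _ (H (index j2 [:: j1]))) card_ord.
  have [<-|ne] := eqVneq j1 j2.
    by rewrite /= !inE !eqxx /= big_seq1 /= !eqxx /G /=.
  rewrite /= !inE (negbTE ne) /= !big_cons big_nil /= !eqxx (negbTE ne) /G /=.
  by rewrite addr0.
rewrite (eq_bigr (fun=> G 0%N + (m%:R - 1) * G 1%N)); last first.
  by move=> j1 _; rewrite sum_index card_ord /= big_seq1 /= eqxx.
by rewrite sumr_const card_ord mulr_natl /G /H /=; congr (_ *+ _); ring.
Qed.

End PatternSums.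

Section PatternMeans.
Context (R : realFieldType).

(** The values of [sum_pattern2], [sum_pattern3] and [sum_pattern4] divided by
    the number of columns. *)
Definition pattern2_mean (m : nat) (x : R) (v : nat -> R) : R :=
  v 0%N + (m%:R - 1) * x * v 1%N.

Definition pattern3_mean (m : nat) (x : R) (v : nat -> nat -> R) : R :=
  v 0%N 0%N + (m%:R - 1) * x * (v 0%N 2%N + v 1%N 0%N + v 1%N 1%N) +
  (m%:R - 1) * x * ((m%:R - 2%:R) * x) * v 1%N 2%N.

Definition pattern4_mean (m : nat) (x : R) (v : nat -> nat -> nat -> R) : R :=
  v 0%N 0%N 0%N +
  (m%:R - 1) * x * (v 0%N 0%N 3%N + v 0%N 2%N 0%N + v 0%N 2%N 2%N +
    v 1%N 0%N 0%N + v 1%N 0%N 1%N + v 1%N 1%N 0%N + v 1%N 1%N 1%N) +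
  (m%:R - 1) * x * ((m%:R - 2%:R) * x) *
    (v 0%N 2%N 3%N + v 1%N 0%N 3%N + v 1%N 1%N 3%N + v 1%N 2%N 0%N +
     v 1%N 2%N 1%N + v 1%N 2%N 2%N) +
  (m%:R - 1) * x * ((m%:R - 2%:R) * x) * ((m%:R - 3%:R) * x) * v 1%N 2%N 3%N.

Lemma pattern2_mean_near (m : nat) (x e : R) (g : 'I_m -> 'I_m -> R) v :
  (0 < m)%N -> 0 <= x ->
  (forall j1 j2, `|x ^+ (2 - (index j2 [:: j1] == 1))%N * g j1 j2 -
     v (index j2 [:: j1])| <= e) ->
  `|m%:R^-1 * \sum_(j1 < m) \sum_(j2 < m) x ^+ 2 * g j1 j2 -
    pattern2_mean m x v| <= pattern2_mean m x (fun=> e).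
Proof.
move=> m0 x0 H; have m1 : m%:R != 0 :> R by rewrite pnatr_eq0 -lt0n.
have E u : pattern2_mean m x u = m%:R^-1 * \sum_(j1 < m) \sum_(j2 < m)
    x ^+ (index j2 [:: j1] == 1)%N * u (index j2 [:: j1]).
  by rewrite sum_pattern2 mulKf.
rewrite !E -mulrBr normrM ger0_norm ?invr_ge0 // ler_wpM2l ?invr_ge0 //.
rewrite -sumrB (le_trans (ler_norm_sum _ _ _)) //; apply: ler_sum => j1 _.
rewrite -sumrB (le_trans (ler_norm_sum _ _ _)) //; apply: ler_sum => j2 _.
have := H j1 j2; set b := (_ == 1)%N => Hb; have -> : x ^+ 2 = x ^+ b * x ^+ (2
    - b).
  by rewrite -exprD subnKC // /b; case: (_ == _).
by rewrite -[X in `|X - _|]mulrA -mulrBr normrM ger0_norm ?exprn_ge0 //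
    ler_wpM2l ?exprn_ge0.
Qed.

Lemma pattern3_mean_near (m : nat) (x e : R) (g : 'I_m -> 'I_m -> 'I_m -> R) v :
  (0 < m)%N -> 0 <= x ->
  (forall j1 j2 j3,
     `|x ^+ (3 - ((index j2 [:: j1] == 1) + (index j3 [:: j1; j2] == 2)))%N *
       g j1 j2 j3 - v (index j2 [:: j1]) (index j3 [:: j1; j2])| <= e) ->
  `|m%:R^-1 * \sum_(j1 < m) \sum_(j2 < m) \sum_(j3 < m) x ^+ 3 * g j1 j2 j3 -
    pattern3_mean m x v| <= pattern3_mean m x (fun _ _ => e).
Proof.
move=> m0 x0 H; have m1 : m%:R != 0 :> R by rewrite pnatr_eq0 -lt0n.
have E u : pattern3_mean m x u = m%:R^-1 * \sum_(j1 < m) \sum_(j2 < m)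
    \sum_(j3 < m) x ^+ ((index j2 [:: j1] == 1) + (index j3 [:: j1; j2] ==
        2))%N *
      u (index j2 [:: j1]) (index j3 [:: j1; j2]).
  by rewrite sum_pattern3 mulKf.
rewrite !E -mulrBr normrM ger0_norm ?invr_ge0 // ler_wpM2l ?invr_ge0 //.
rewrite -sumrB (le_trans (ler_norm_sum _ _ _)) //; apply: ler_sum => j1 _.
rewrite -sumrB (le_trans (ler_norm_sum _ _ _)) //; apply: ler_sum => j2 _.
rewrite -sumrB (le_trans (ler_norm_sum _ _ _)) //; apply: ler_sum => j3 _.
have := H j1 j2 j3; set k := (_ + _)%N => Hk.
have -> : x ^+ 3 = x ^+ k * x ^+ (3 - k).
  by rewrite -exprD subnKC // /k; do 2!case: (_ == _).
by rewrite -[X in `|X - _|]mulrA -mulrBr normrM ger0_norm ?exprn_ge0 //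
    ler_wpM2l ?exprn_ge0.
Qed.

Lemma pattern4_mean_near (m : nat) (x e : R)
    (g : 'I_m -> 'I_m -> 'I_m -> 'I_m -> R) v :
  (0 < m)%N -> 0 <= x ->
  (forall j1 j2 j3 j4,
     `|x ^+ (4 - ((index j2 [:: j1] == 1) + (index j3 [:: j1; j2] == 2) +
                  (index j4 [:: j1; j2; j3] == 3)))%N * g j1 j2 j3 j4 -
       v (index j2 [:: j1]) (index j3 [:: j1; j2]) (index j4 [:: j1; j2; j3])|
     <= e) ->
  `|m%:R^-1 * \sum_(j1 < m) \sum_(j2 < m) \sum_(j3 < m) \sum_(j4 < m)
      x ^+ 4 * g j1 j2 j3 j4 -
    pattern4_mean m x v| <= pattern4_mean m x (fun _ _ _ => e).
Proof.
move=> m0 x0 H; have m1 : m%:R != 0 :> R by rewrite pnatr_eq0 -lt0n.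
have E u : pattern4_mean m x u = m%:R^-1 * \sum_(j1 < m) \sum_(j2 < m)
    \sum_(j3 < m) \sum_(j4 < m)
      x ^+ ((index j2 [:: j1] == 1) + (index j3 [:: j1; j2] == 2) +
            (index j4 [:: j1; j2; j3] == 3))%N *
      u (index j2 [:: j1]) (index j3 [:: j1; j2]) (index j4 [:: j1; j2; j3]).
  by rewrite sum_pattern4 mulKf.
rewrite !E -mulrBr normrM ger0_norm ?invr_ge0 // ler_wpM2l ?invr_ge0 //.
rewrite -sumrB (le_trans (ler_norm_sum _ _ _)) //; apply: ler_sum => j1 _.
rewrite -sumrB (le_trans (ler_norm_sum _ _ _)) //; apply: ler_sum => j2 _.
rewrite -sumrB (le_trans (ler_norm_sum _ _ _)) //; apply: ler_sum => j3 _.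
rewrite -sumrB (le_trans (ler_norm_sum _ _ _)) //; apply: ler_sum => j4 _.
have := H j1 j2 j3 j4; set k := (_ + _)%N => Hk.
have -> : x ^+ 4 = x ^+ k * x ^+ (4 - k).
  by rewrite -exprD subnKC // /k; do 3!case: (_ == _).
by rewrite -[X in `|X - _|]mulrA -mulrBr normrM ger0_norm ?exprn_ge0 //
    ler_wpM2l ?exprn_ge0.
Qed.

End PatternMeans.

(** When [m * x] tends to one, all patterns get the same weight in the limit:
    every new entry brings about [m] choices and one factor [x]. *)
Section PatternLimits.
Context (R : realType) (m : nat -> nat) (x : nat -> R).
Hypothesis mx_cvg : (fun n => (m n)%:R * x n : R) @ \oo --> (1 : R).
Hypothesis x_cvg : x @ \oo --> (0 : R).

Let shift_cvg k : (fun n => ((m n)%:R - k%:R) * x n : R) @ \oo --> (1 : R).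
Proof.
have -> : (fun n => ((m n)%:R - k%:R) * x n : R) =
    (fun n => (m n)%:R * x n - k%:R * x n).
  by apply/funext => n; rewrite mulrBl.
rewrite -[X in _ --> X]subr0 -[X in _ - X](mulr0 k%:R).
apply: cvgB => //; apply: cvgM => //; exact: cvg_cst.
Qed.

Lemma pattern2_mean_cvg (v : nat -> nat -> R) (l : nat -> R) :
  (forall a, (fun n => v n a) @ \oo --> l a) ->
  (fun n => pattern2_mean (m n) (x n) (v n)) @ \oo --> l 0%N + l 1%N.
Proof.
move=> vl; rewrite -[X in _ + X]mul1r /pattern2_mean.
by apply: cvgD => //; apply: cvgM => //; exact: (shift_cvg 1).
Qed.

Lemma pattern3_mean_cvg (v : nat -> nat -> nat -> R) (l : nat -> nat -> R) :
  (forall a b, (fun n => v n a b) @ \oo --> l a b) ->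
  (fun n => pattern3_mean (m n) (x n) (v n)) @ \oo -->
    l 0%N 0%N + (l 0%N 2%N + l 1%N 0%N + l 1%N 1%N) + l 1%N 2%N.
Proof.
move=> vl; rewrite -[X in _ + X + _]mul1r -[X in _ + X]mul1r.
rewrite -[X in _ + X * l 1%N 2%N](mulr1 1) /pattern3_mean.
have s1 := shift_cvg 1; have s2 := shift_cvg 2.
apply: cvgD; last by apply: cvgM => //; apply: cvgM.
apply: cvgD => //; apply: cvgM => //.
by do ![apply: cvgD => //].
Qed.

Lemma pattern4_mean_cvg (v : nat -> nat -> nat -> nat -> R)
    (l : nat -> nat -> nat -> R) :
  (forall a b c, (fun n => v n a b c) @ \oo --> l a b c) ->
  (fun n => pattern4_mean (m n) (x n) (v n)) @ \oo -->
    l 0%N 0%N 0%N +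
    (l 0%N 0%N 3%N + l 0%N 2%N 0%N + l 0%N 2%N 2%N +
      l 1%N 0%N 0%N + l 1%N 0%N 1%N + l 1%N 1%N 0%N + l 1%N 1%N 1%N) +
    (l 0%N 2%N 3%N + l 1%N 0%N 3%N + l 1%N 1%N 3%N + l 1%N 2%N 0%N +
      l 1%N 2%N 1%N + l 1%N 2%N 2%N) + l 1%N 2%N 3%N.
Proof.
move=> vl; set l1 := (X in _ + X + _ + _); set l2 := (X in _ + X + _).
rewrite (_ : _ + _ = l 0%N 0%N 0%N + 1 * l1 + 1 * 1 * l2 +
  1 * 1 * 1 * l 1%N 2%N 3%N); last by rewrite !mul1r.
have s1 := shift_cvg 1; have s2 := shift_cvg 2; have s3 := shift_cvg 3.
rewrite /pattern4_mean.
apply: cvgD; last by do ![apply: cvgM => //].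
apply: cvgD; last first.
  by apply: cvgM; [exact: cvgM|do ![apply: cvgD => //]].
by apply: cvgD => //; apply: cvgM => //; do ![apply: cvgD => //].
Qed.

End PatternLimits.

(** * Quadratic forms of polynomials in a symmetric matrix *)

Lemma trmx_horner_mx (R : comNzRingType) (n : nat) (A : 'M[R]_n.+1) (p : {poly
    R}) :
  A^T = A -> (horner_mx A p)^T = horner_mx A p.
Proof.
move=> sA; elim/poly_ind: p => [|p c IH]; first by rewrite rmorph0 trmx0.
have cA : A * horner_mx A p = horner_mx A p * A.
  by rewrite -{1 4}(horner_mx_X A) -!rmorphM mulrC.
rewrite rmorphD rmorphM /= horner_mx_X horner_mx_C raddfD /= tr_scalar_mx.
by rewrite -mulmxE trmx_mul IH sA mulmxE cA.
Qed.

Section QuadraticForms.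
Context (d : measure_display) (T : measurableType d) (R : realType).
Context (P : probability T R) (M : nat -> nat).
Context (X : forall n, 'I_n.+1 -> 'I_(M n) -> {RV P >-> R}).
Context (B : forall n, 'M[R]_n.+1).
Arguments X : clear implicits.
Arguments B : clear implicits.
Hypothesis X_indep : forall n, mutually_independent (entry (X n)).
Hypothesis X_all_moments : forall n i j, all_moments P (X n i j).
Hypothesis X_mean : forall n i j, Ex P (X n i j) = 0.
Hypothesis X_square : forall n i j, Ex P (fun w => X n i j w ^+ 2) = 1.
Arguments X_all_moments : clear implicits.
Arguments X_mean : clear implicits.
Arguments X_indep : clear implicits.
Arguments X_square : clear implicits.
Hypothesis X_moments : forall k, exists C : R, forall n i j,
  Ex P (fun w => `|X n i j w| ^+ k) <= C.
Hypothesis B_sym : forall n, (B n)^T = B n.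

Definition polB (n : nat) (p : {poly R}) : 'M[R]_n.+1 := horner_mx (B n) p.

(** All matrices are polynomials in [B n], hence symmetric and commuting, and
    polynomials do not depend on [n], so that traces can be compared with a
    limit functional. *)
Definition ntr (n : nat) (p : {poly R}) : R := n.+1%:R^-1 * \tr (polB n p).

Context (tau : {poly R} -> R).
Hypothesis ntr_cvg : forall p, (fun n => ntr n p) @ \oo --> tau p.
Arguments ntr_cvg : clear implicits.

Let ntr_bounded p : exists C : R, forall n, `|ntr n p| <= C.
Proof.
have /cvg_seq_bounded[C [_ HC]] : cvgn (fun n => ntr n p).
  by apply/cvg_ex; exists (tau p); exact: ntr_cvg.
by exists (C + 1) => n; apply: HC => //; rewrite ltrDl.
Qed.

Definition rate (n : nat) : R := (Num.sqrt n.+1%:R)^-1.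

(** Estimates are uniform over the dimension and over the columns of the random
    matrix of that dimension. *)
Definition column : Type := {n : nat & 'I_(M n)}.

Definition qf (p : {poly R}) (s : column) (w : T) : R :=
  (tag s).+1%:R^-1 * bil (X (tag s)) (polB (tag s) p) (tagged s) (tagged s) w.

Lemma rate_gt0 n : 0 < rate n.
Proof. by rewrite invr_gt0 sqrtr_gt0. Qed.

Lemma rate_sqr n : rate n ^+ 2 = n.+1%:R^-1.
Proof. by rewrite exprVn sqr_sqrtr. Qed.

Lemma polBM n p q : polB n (p * q) = polB n p *m polB n q.
Proof. by rewrite /polB rmorphM. Qed.

Lemma polB1 n : polB n 1 = 1%:M.
Proof. by rewrite /polB rmorph1. Qed.

Lemma polB_sym n p : (polB n p)^T = polB n p.
Proof. by apply: trmx_horner_mx. Qed.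

Lemma trace_polB n p : \tr (polB n p) = n.+1%:R * ntr n p.
Proof. by rewrite /ntr mulrA divff ?mul1r // pnatr_eq0. Qed.

Lemma frob_polB n p : frob (polB n p) = n.+1%:R * ntr n (p ^+ 2).
Proof. by rewrite frobE polB_sym -polBM -expr2 trace_polB. Qed.

Lemma bil_qf p n (j : 'I_(M n)) w :
  bil (X n) (polB n p) j j w = n.+1%:R * qf p (Tagged _ j) w.
Proof. by rewrite /qf /= mulrA divff ?mul1r // pnatr_eq0. Qed.

Let am_bil n A j k : all_moments P (bil (X n) A j k).
Proof. exact: (all_moments_bil (X_all_moments n)). Qed.

Lemma qf_all_moments p s : all_moments P (qf p s).
Proof. by apply: all_moments_scale; exact: am_bil. Qed.

Lemma Ex_qf p s : Ex P (qf p s) = ntr (tag s) p.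
Proof.
rewrite /qf ExZ; last exact: am_bil.
by rewrite (Ex_bil_trace (X_indep _) (X_all_moments _) (X_mean _) (X_square _)).
Qed.

Let fourth_moment : {K : R | 0 <= K & forall n i j,
  Ex P (fun w => X n i j w ^+ 4) <= K}.
Proof.
have [C HC] := cid (X_moments 4); exists `|C| => // n i j.
rewrite (le_trans _ (ler_norm C)) // (le_trans _ (HC n i j)) //.
rewrite le_eqVlt; apply/orP; left; apply/eqP; congr Ex; apply/funext => w.
by rewrite -normrX ger0_norm ?exprn_even_ge0.
Qed.

Lemma Ex_qf_sqr p : exists K : R, forall s,
  `|Ex P (fun w => qf p s w ^+ 2) - ntr (tag s) p ^+ 2| <= K * (tag s).+1%:R^-1.
Proof.
have [K K0 HK] := fourth_moment; have [C HC] := ntr_bounded (p ^+ 2).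
exists ((K + 5%:R) * C) => -[n j] /=.
set A := polB n p; set N : R := n.+1%:R.
have N0 : 0 < N by rewrite ltr0Sn.
have -> : Ex P (fun w => qf p (Tagged _ j) w ^+ 2) =
    N^-1 ^+ 2 * (\tr A * \tr A + quad_cov (X n) j A A).
  rewrite -(Ex_bil2 (X_indep n) (X_all_moments n) (X_mean n) (X_square n)) //
      -ExZ.
    by congr Ex; apply/funext => w; rewrite /qf /= exprMn -expr2.
  by apply: all_moments_mul; exact: am_bil.
have -> : N^-1 ^+ 2 * (\tr A * \tr A + quad_cov (X n) j A A) - ntr n p ^+ 2 =
    N^-1 ^+ 2 * quad_cov (X n) j A A.
  by rewrite /ntr -/A -/N; ring.
have Ni : 0 <= N^-1 by rewrite invr_ge0 ltW.
rewrite normrM (ger0_norm (exprn_ge0 2 Ni)).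
have := norm_quad_cov_le A A ltr01 (fun i => HK n i j).
rewrite invr1 !mul1r frob_polB -/N -mulr2n.
have := HC n; have := ler_norm (ntr n (p ^+ 2)) => h1 h2 h3.
rewrite expr2 -mulrA [leRHS]mulrC ler_pM2l ?invr_gt0 //.
rewrite ler_pdivrMl // (le_trans h3) //.
have -> : (K + 5) / 2 * (N * ntr n (p ^+ 2) *+ 2) =
   (K + 5) * (N * ntr n (p ^+ 2)) by field.
rewrite mulrCA ler_pM2l // ler_wpM2l ?addr_ge0 //.
exact: le_trans h1 h2.
Qed.

(** Concentration of a quadratic form around its mean, the normalized trace. *)
Lemma qf_l2_small p :
  l2_small P (fun s => rate (tag s)) (fun s w => qf p s w - ntr (tag s) p).
Proof.
split=> [s|].
  by apply: all_moments_sub; [exact: qf_all_moments|exact: all_moments_cst].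
have [K HK] := Ex_qf_sqr p; exists K => s; rewrite rate_sqr.
apply: le_trans (HK s); rewrite le_eqVlt; apply/orP; left; apply/eqP.
have a1 := qf_all_moments p s.
have -> : (fun w => (qf p s w - ntr (tag s) p) ^+ 2) = (fun w => qf p s w ^+ 2 -
    ((2%:R * ntr (tag s) p) * qf p s w - ntr (tag s) p ^+ 2)).
  by apply/funext => w; ring.
have a2 := all_moments_scale (2%:R * ntr (tag s) p) a1.
have a3 : all_moments P (fun w => (2%:R * ntr (tag s) p) * qf p s w - ntr (tag
    s) p ^+ 2).
  by apply: all_moments_sub => //; exact: all_moments_cst.
rewrite -[LHS]ger0_norm.
  rewrite ExB //; last exact: all_moments_exp.
  rewrite (ExB a2 (all_moments_cst P _)) (ExZ _ a1) Ex_qf Ex_cst.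
  by congr `|_|; ring.
apply: Ex_ge0 => w.
rewrite (_ : _ - _ = (qf p s w - ntr (tag s) p) ^+ 2) ?sqr_ge0 //; ring.
Qed.

Lemma Ex_qf_sqr_bounded p : exists C : R, forall s,
  Ex P (fun w => qf p s w ^+ 2) <= C.
Proof.
have [K HK] := Ex_qf_sqr p; have [C HC] := ntr_bounded p.
exists (`|K| + C ^+ 2) => s.
have := HK s; rewrite ler_distl => /andP[_ /le_trans]; apply.
rewrite addrC lerD //.
  apply: (@le_trans _ _ (`|K| * (tag s).+1%:R^-1)).
    by rewrite ler_wpM2r ?invr_ge0 // ler_norm.
  by rewrite ler_piMr // invf_le1 ?ler1n // ltr0Sn.
rewrite -(real_normK (num_real (ntr (tag s) p))) lerXn2r ?nnegrE //.
exact: le_trans (HC (tag s)).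
Qed.

(** Cauchy-Schwarz for the vectors [x] and [p (B n) x]. *)
Lemma qf_cauchy_schwarz p s w : qf p s w ^+ 2 <= qf 1 s w * qf (p ^+ 2) s w.
Proof.
case: s => n j; rewrite /qf /=.
set A := polB n p; set N : R := n.+1%:R.
rewrite exprMn [leRHS]mulrACA -expr2 ler_pM2l ?exprn_gt0 ?invr_gt0 ?ltr0Sn //.
set x := colX (X n) j w.
have -> : bil (X n) A j j w = \sum_a x a 0 * (A *m x) a 0.
  by rewrite /bil -mulmxA mxE; apply: eq_bigr => a _; rewrite !mxE.
have -> : bil (X n) (polB n 1) j j w = \sum_a x a 0 ^+ 2.
  rewrite /bil polB1 mulmx1 mxE; apply: eq_bigr => a _.
  by rewrite !mxE expr2.
have -> : bil (X n) (polB n (p ^+ 2)) j j w = \sum_a (A *m x) a 0 ^+ 2.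
  rewrite /bil expr2 polBM -/A -{1}[A](polB_sym n p) mulmxA -trmx_mul.
  rewrite -mulmxA mxE; apply: eq_bigr => a _.
  by rewrite mxE expr2.
exact: sum_cauchy_schwarz.
Qed.

Lemma qf1E s w : qf 1 s w =
  (tag s).+1%:R^-1 * \sum_a X (tag s) a (tagged s) w ^+ 2.
Proof.
rewrite /qf /bil polB1 mulmx1 mxE; congr (_ * _); apply: eq_bigr => a _.
by rewrite !mxE expr2.
Qed.

Lemma qf1_ge0 s w : 0 <= qf 1 s w.
Proof.
rewrite qf1E mulr_ge0 ?invr_ge0 // sumr_ge0 // => a _; exact: sqr_ge0.
Qed.

Lemma qf1_bounded_moments : bounded_moments P (qf 1).
Proof.
apply: bounded_moments_pow2 => [s|l]; first exact: qf_all_moments.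
have mean_pow (s : column) w k : qf 1 s w ^+ (2 ^ k) <=
    (tag s).+1%:R^-1 * \sum_a (X (tag s) a (tagged s) w ^+ 2) ^+ (2 ^ k).
  elim: k => [|k IH].
    by rewrite expr1 qf1E; under [X in _ <= _ * X]eq_bigr do rewrite expr1.
  rewrite expnSr exprM.
  set N : R := (tag s).+1%:R; have N0 : 0 < N by rewrite ltr0Sn.
  set y := fun a => (X (tag s) a (tagged s) w ^+ 2) ^+ (2 ^ k).
  apply: (@le_trans _ _ ((N^-1 * \sum_a y a) ^+ 2)).
    rewrite lerXn2r ?nnegrE ?exprn_ge0 ?qf1_ge0 //.
    apply: mulr_ge0; first by rewrite invr_ge0 ltW.
    by apply: sumr_ge0 => a _; rewrite exprn_ge0 ?sqr_ge0.
  rewrite exprMn [X in _ * X ^+ 2](_ : _ = \sum_a y a * 1); last first.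
    by apply: eq_bigr => a _; rewrite mulr1.
  rewrite expr2 -mulrA ler_pM2l ?invr_gt0 // ler_pdivrMl //.
  rewrite (le_trans (sum_cauchy_schwarz _ _)) // mulrC.
  under eq_bigr do rewrite expr1n.
  rewrite sumr_const card_ord -/N ler_pM2l //.
  by apply: ler_sum => a _; rewrite /y exprM.
have [C HC] := X_moments (2 * 2 ^ l.+1); exists C => s.
set N : R := (tag s).+1%:R; have N0 : 0 < N by rewrite ltr0Sn.
have aX a : all_moments P (fun w => (X (tag s) a (tagged s) w ^+ 2) ^+ (2 ^
    l.+1)).
  by do 2?apply: all_moments_exp.
apply: (@le_trans _ _ (Ex P (fun w =>
    N^-1 * \sum_a (X (tag s) a (tagged s) w ^+ 2) ^+ (2 ^ l.+1)))).
  apply: Ex_le => // [|]; first by apply: all_moments_exp; exact: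
      qf_all_moments.
  by apply: all_moments_scale; exact: all_moments_sum.
rewrite ExZ; last exact: all_moments_sum.
rewrite Ex_sum // ler_pdivrMl //.
apply: (@le_trans _ _ (\sum_(a < (tag s).+1) C)).
  apply: ler_sum => a _; rewrite (le_trans _ (HC _ a (tagged s))) //.
  rewrite le_eqVlt; apply/orP; left; apply/eqP; congr Ex; apply/funext => w.
  by rewrite -exprM -normrX ger0_norm // exprM exprn_ge0 // sqr_ge0.
by rewrite sumr_const card_ord -mulr_natl.
Qed.

(** Iterating Cauchy-Schwarz trades powers of a quadratic form for a single
    quadratic form with a power of the matrix, so that second moments of the
    latter control all moments of the former. *)
Lemma qf_pow2_le p l s w : qf p s w ^+ (2 ^ l.+1) <=
  qf 1 s w ^+ (2 ^ l.+1).-1 * qf (p ^+ (2 ^ l.+1)) s w.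
Proof.
elim: l => [|l IH]; first by rewrite expr1; exact: qf_cauchy_schwarz.
have e : (2 ^ l.+2).-1 = ((2 ^ l.+1).-1 * 2).+1.
  have := expn_gt0 2 l.+1; rewrite [(2 ^ l.+2)%N]expnSr; lia.
rewrite e [in leLHS]expnSr [in p ^+ _]expnSr !exprM.
apply: (@le_trans _ _ ((qf 1 s w ^+ (2 ^ l.+1).-1 * qf (p ^+ (2 ^ l.+1)) s w)
    ^+ 2)).
  rewrite lerXn2r // nnegrE.
    by rewrite expnSr exprM sqr_ge0.
  by rewrite (le_trans _ IH) // expnSr exprM sqr_ge0.
rewrite exprMn [X in _ <= X * _]exprSr exprM -[leRHS]mulrA ler_wpM2l ?sqr_ge0
    //.
exact: qf_cauchy_schwarz.
Qed.

Lemma qf_bounded_moments p : bounded_moments P (qf p).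
Proof.
apply: bounded_moments_pow2 => [s|l]; first exact: qf_all_moments.
have [C HC] := Ex_qf_sqr_bounded (p ^+ (2 ^ l.+1)).
have [_ /(_ 2%N)[C' HC']] := bounded_moments_exp (2 ^ l.+1).-1
    qf1_bounded_moments.
exists (C' + C) => s.
have a1 : all_moments P (fun w => qf 1 s w ^+ (2 ^ l.+1).-1).
  by apply: all_moments_exp; exact: qf_all_moments.
have a2 : all_moments P (qf (p ^+ (2 ^ l.+1)) s) by exact: qf_all_moments.
have a3 : all_moments P (fun w => `|qf 1 s w ^+ (2 ^ l.+1).-1| ^+ 2).
  by apply: all_moments_exp; exact: all_moments_norm.
have a4 : all_moments P (fun w => qf (p ^+ (2 ^ l.+1)) s w ^+ 2).
  exact: all_moments_exp.
apply: (@le_trans _ _ (Ex P (fun w => `|qf 1 s w ^+ (2 ^ l.+1).-1| ^+ 2 +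
    qf (p ^+ (2 ^ l.+1)) s w ^+ 2))).
  apply: Ex_le => [||w].
  - by apply: all_moments_exp; exact: qf_all_moments.
  - exact: all_moments_add.
  - apply: le_trans (qf_pow2_le p l s w) _; rewrite real_normK ?num_real //.
    set a := _ ^+ _; set b := qf _ _ _; nra.
by rewrite ExD // lerD.
Qed.

Lemma ntr_bounded_moments p : bounded_moments P (fun (s : column) (_ : T) =>
    ntr (tag s) p).
Proof.
have [C HC] := ntr_bounded p.
by apply: bounded_moments_cst; exists C => s.
Qed.

(** The factors are replaced by their means one after the other; the remaining
    product has bounded moments. *)
Lemma Ex_prod_qf (ps : seq {poly R}) : exists C : R, forall s,
  `|Ex P (fun w => \prod_(p <- ps) qf p s w) - \prod_(p <- ps) ntr (tag s) p|
  <= C * rate (tag s).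
Proof.
elim: ps => [|p ps [C IH]].
  exists 0 => s; under eq_fun do rewrite big_nil.
  by rewrite Ex_cst big_nil subrr normr0 mul0r.
have bq : bounded_moments P (fun s w => \prod_(q <- ps) qf q s w).
  by apply: bounded_moments_prod => q; exact: qf_bounded_moments.
have [C' HC'] := l2_small_mul (fun s : column => rate_gt0 (tag s)) (qf_l2_small
    p) bq.
have [C2 HC2] := ntr_bounded p.
exists (C' + C2 * C) => s; rewrite big_cons.
have a1 := bq.1 s; have [a2 _] := qf_l2_small p; have {}a2 := a2 s.
have -> : (fun w => \prod_(q <- p :: ps) qf q s w) =
    (fun w => (qf p s w - ntr (tag s) p) * \prod_(q <- ps) qf q s w +
       ntr (tag s) p * \prod_(q <- ps) qf q s w).
  by apply/funext => w; rewrite big_cons; ring.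
rewrite ExD; last 2 first.
- exact: all_moments_mul.
- exact: all_moments_scale.
rewrite ExZ // -addrA -mulrBr (le_trans (ler_normD _ _)) // mulrDl lerD //.
by rewrite normrM -mulrA ler_pM.
Qed.



(** * Words of length at most four *)

Definition pbil (n : nat) (p : {poly R}) (i j : 'I_(M n)) : T -> R :=
  bil (X n) (polB n p) i j.

Let q (p : {poly R}) n (j : 'I_(M n)) : T -> R := qf p (Tagged _ j).

Let q_am p n (j : 'I_(M n)) : all_moments P (q p j).
Proof. exact: qf_all_moments. Qed.

Let pbil_qf p n (j : 'I_(M n)) w : pbil p j j w = n.+1%:R * q p j w.
Proof. exact: bil_qf. Qed.

Lemma rate_le1 n : rate n <= 1.
Proof.
rewrite invf_le1 ?sqrtr_gt0 ?ltr0Sn // -(expr_ge1 (n := 2)) ?sqrtr_ge0 //.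
by rewrite sqr_sqrtr // ler1n.
Qed.

Lemma Ex_pbil_contract n p p' i j k (Z : T -> R) :
  i != j -> k != j -> free_of (X n) j Z ->
  Ex P (fun w => pbil p i j w * pbil p' j k w * Z w) =
  Ex P (fun w => pbil (p * p') i k w * Z w).
Proof.
move=> ij kj fZ; rewrite /pbil polBM.
exact: (Ex_bil_contract (X_indep n) (X_all_moments n) (X_mean n) (X_square n)).
Qed.

Lemma prod_pbil_near (ps : seq {poly R}) : exists C : R, forall n (i : 'I_(M
    n)),
  `|n.+1%:R^-1 ^+ size ps * Ex P (fun w => \prod_(p <- ps) pbil p i i w) -
    \prod_(p <- ps) ntr n p| <= C * rate n.
Proof.
have [C HC] := Ex_prod_qf ps.
exists C => n i; have := HC (Tagged _ i); apply: le_trans => /=.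
rewrite -ExZ; last first.
  apply: all_moments_prod => p.
  exact: (all_moments_bil (X_all_moments n)).
rewrite le_eqVlt; apply/orP; left; apply/eqP; congr `|Ex P _ - _|.
apply/funext => w; elim: ps {HC} => [|p ps IH].
  by rewrite !big_nil expr0 mulr1.
rewrite !big_cons exprS -IH; set e := \prod_(p <- ps) _.
by rewrite /qf /pbil /=; ring.
Qed.

(** After integrating out the second column, the main term is a product of two
    quadratic forms. The covariance is a form of [p3 (B n)] with a rank one
    matrix, whose Frobenius norms are of order [n ^ (1 / 2)] and [n]: this is
    where the weight in [norm_quad_cov_le] matters. *)
Lemma pbil_1122_near p1 p2 p3 p4 : exists C : R, forall n (i j : 'I_(M n)),
  i != j ->
  `|n.+1%:R^-1 ^+ 3 * Ex P (fun w => pbil p1 i i w * pbil p2 i j w *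
      pbil p3 j j w * pbil p4 j i w) - ntr n p1 * ntr n p3 * ntr n (p2 * p4)|
  <= C * rate n.
Proof.
have [K HK] := X_moments 4.
have [C1 HC1] := Ex_prod_qf [:: p2 * p4; p1].
have [C3 HC3] := ntr_bounded p3.
have bq p := qf_bounded_moments p.
pose g (s : column) w := (ntr (tag s) (p3 ^+ 2) +
   qf (p4 * p4) s w * qf (p2 * p2) s w) * `|qf p1 s w|.
have bg : bounded_moments P g.
  apply: bounded_moments_mul; last by apply: bounded_moments_norm; exact: bq.
  apply: bounded_moments_add; last by apply: bounded_moments_mul; exact: bq.
  exact: ntr_bounded_moments.
have [C4 HC4] := bounded_moments_Ex bg.
exists (C3 * C1 + (`|K| + 5%:R) / 2%:R * C4) => n i j ij.
set N : R := n.+1%:R; have N0 : 0 < N by rewrite ltr0Sn.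
have Nn0 : N != 0 by rewrite gt_eqF.
pose cov w := quad_cov (X n) j (polB n p3)
  (polB n p4 *m colX (X n) i w *m ((colX (X n) i w)^T *m polB n p2)).
have acov : all_moments P cov.
  exact: (all_moments_quad_cov_cst (X_all_moments n)).
have aq p := q_am p i.
have -> : N^-1 ^+ 3 * Ex P (fun w => pbil p1 i i w * pbil p2 i j w *
      pbil p3 j j w * pbil p4 j i w) =
   ntr n p3 * Ex P (fun w => \prod_(p <- [:: p2 * p4; p1]) q p i w) +
   Ex P (fun w => N^-1 ^+ 2 * cov w * q p1 i w).
  rewrite /pbil (Ex_bil_1122 (X_indep n) (X_all_moments n) (X_mean n) (X_square
      n)) //.
  have am0 A k l := all_moments_bil (X_all_moments n) A k l.
  have am1 : all_moments P (fun w => \prod_(p <- [:: p2 * p4; p1]) q p i w).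
    exact: all_moments_prod.
  have am2 : all_moments P (fun w => (\tr (polB n p3) *
      bil (X n) (polB n p2 *m polB n p4) i i w + cov w) *
      bil (X n) (polB n p1) i i w).
    by apply: all_moments_mul => //; apply: all_moments_add => //; exact:
        all_moments_scale.
  have am3 := all_moments_scale (ntr n p3) am1.
  have am4 : all_moments P (fun w => N^-1 ^+ 2 * cov w * q p1 i w).
    by apply: all_moments_mul => //; exact: all_moments_scale.
  rewrite -(ExZ _ am2) -(ExZ (ntr n p3) am1) -ExD //.
  congr Ex; apply/funext => w; rewrite !big_cons big_nil -polBM.
  rewrite -/(cov w) -/(pbil _ _ _ w) -/(pbil _ _ _ w) !pbil_qf trace_polB -/N.
  by field.
rewrite addrAC (le_trans (ler_normD _ _)) // mulrDl lerD //.
  have -> : ntr n p1 * ntr n p3 * ntr n (p2 * p4) =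
      ntr n p3 * \prod_(p <- [:: p2 * p4; p1]) ntr n p.
    by rewrite !big_cons big_nil; ring.
  rewrite -mulrBr normrM -mulrA ler_pM //; exact: (HC1 (Tagged _ i)).
set K2 := (`|K| + 5) / 2.
apply: (@le_trans _ _ (Ex P (fun w => K2 * rate n * g (Tagged _ i) w))).
  apply: Ex_norm_le => [||w].
  - by apply: all_moments_mul => //; apply: all_moments_scale.
  - by apply: all_moments_scale; exact: bg.1.
  rewrite normrM /g mulrA ler_wpM2r //.
  have HKj a : Ex P (fun w0 => X n a j w0 ^+ 4) <= `|K|.
    rewrite (le_trans _ (ler_norm K)) // (le_trans _ (HK n a j)) //.
    rewrite le_eqVlt; apply/orP; left; apply/eqP; congr Ex; apply/funext => v.
    by rewrite -normrX ger0_norm ?exprn_even_ge0.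
  have rV : 0 < (rate n)^-1 by rewrite invr_gt0 rate_gt0.
  have := norm_quad_cov_le (polB n p3)
    (polB n p4 *m colX (X n) i w *m ((colX (X n) i w)^T *m polB n p2)) rV HKj.
  rewrite -/(cov w) frob_polB // frob_outer_bil !polB_sym // -!polBM invrK.
  rewrite -/(pbil _ _ _ w) -/(pbil _ _ _ w) !pbil_qf -/N -/K2 => Hc.
  have n2 : 0 <= N^-1 ^+ 2 by rewrite exprn_ge0 // invr_ge0 ltW.
  rewrite normrM (ger0_norm n2) (le_trans (ler_wpM2l n2 Hc)) //.
  rewrite le_eqVlt; apply/orP; left; apply/eqP.
  have r0 : rate n != 0 by rewrite gt_eqF // rate_gt0.
  rewrite -/(q _ i w) -/(q _ i w).
  have NE : N = (rate n)^-1 ^+ 2 by rewrite exprVn rate_sqr invrK.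
  rewrite NE; field.
  exact: r0.
rewrite ExZ; last exact: bg.1.
rewrite [leRHS]mulrAC ler_wpM2l //; last exact: le_trans (ler_norm _) (HC4 _).
by rewrite mulr_ge0 ?divr_ge0 ?addr_ge0 // ltW // rate_gt0.
Qed.

(** The crossing pattern is negligible: it yields the same power of [n] as the
    pattern of a word in three columns would, without the third column. *)
Lemma pbil_1212_near p1 p2 p3 p4 : exists C : R, forall n (i j : 'I_(M n)),
  i != j ->
  `|n.+1%:R^-1 ^+ 3 * Ex P (fun w => pbil p1 i j w * pbil p2 j i w *
      pbil p3 i j w * pbil p4 j i w)| <= C * rate n.
Proof.
have [K HK] := X_moments 4.
have bq p := qf_bounded_moments p.
set K2 := (`|K| + 5%:R) / 2%:R.
pose g (s : column) w := `|qf (p1 * p2) s w * qf (p3 * p4) s w| +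
   K2 * (qf (p2 * p2) s w * qf (p1 * p1) s w +
         qf (p4 * p4) s w * qf (p3 * p3) s w).
have bg : bounded_moments P g.
  apply: bounded_moments_add.
    by apply: bounded_moments_norm; apply: bounded_moments_mul; exact: bq.
  apply: bounded_moments_mul; first by apply: bounded_moments_cst; exists `|K2|.
  by apply: bounded_moments_add; apply: bounded_moments_mul; exact: bq.
have [C4 HC4] := bounded_moments_Ex bg.
exists C4 => n i j ij.
set N : R := n.+1%:R; have N0 : 0 < N by rewrite ltr0Sn.
have Nn0 : N != 0 by rewrite gt_eqF.
pose cov w := quad_cov (X n) j
  (polB n p2 *m colX (X n) i w *m ((colX (X n) i w)^T *m polB n p1))
  (polB n p4 *m colX (X n) i w *m ((colX (X n) i w)^T *m polB n p3)).
have acov : all_moments P cov.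
  exact: (all_moments_quad_cov_outer (X_all_moments n)).
have aq p := q_am p i.
have -> : N^-1 ^+ 3 * Ex P (fun w => pbil p1 i j w * pbil p2 j i w *
      pbil p3 i j w * pbil p4 j i w) =
   N^-1 * Ex P (fun w => q (p1 * p2) i w * q (p3 * p4) i w + N^-1 ^+ 2 * cov w).
  rewrite /pbil (Ex_bil_1212 (X_indep n) (X_all_moments n) (X_mean n) (X_square
      n)) //.
  have am1 : all_moments P (fun w => q (p1 * p2) i w * q (p3 * p4) i w + N^-1
      ^+ 2 * cov w).
    by apply: all_moments_add; [exact: all_moments_mul|exact:
        all_moments_scale].
  rewrite -!ExZ //; last first.
    apply: all_moments_add => //.
    by apply: all_moments_mul; exact: (all_moments_bil (X_all_moments n)).
  congr Ex; apply/funext => w; rewrite -!polBM.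
  rewrite -/(cov w) -/(pbil _ _ _ w) -/(pbil _ _ _ w) !pbil_qf -/N.
  by field.
have Ni : 0 <= N^-1 by rewrite invr_ge0 ltW.
have g0 := bg.1 (Tagged _ i).
have NR : N^-1 <= rate n.
  by rewrite -rate_sqr expr2 ler_piMr ?rate_le1 // ltW // rate_gt0.
rewrite normrM (ger0_norm Ni) mulrC.
apply: ler_pM => //; apply: le_trans (HC4 (Tagged _ i)).
apply: (@le_trans _ _ (Ex P (g (Tagged _ i)))); last exact: ler_norm.
apply: Ex_norm_le => // [|w].
  by apply: all_moments_add; [exact: all_moments_mul|exact: all_moments_scale].
rewrite (le_trans (ler_normD _ _)) // lerD //.
have HKj a : Ex P (fun w0 => X n a j w0 ^+ 4) <= `|K|.
  rewrite (le_trans _ (ler_norm K)) // (le_trans _ (HK n a j)) //.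
  rewrite le_eqVlt; apply/orP; left; apply/eqP; congr Ex; apply/funext => v.
  by rewrite -normrX ger0_norm ?exprn_even_ge0.
have := norm_quad_cov_le
  (polB n p2 *m colX (X n) i w *m ((colX (X n) i w)^T *m polB n p1))
  (polB n p4 *m colX (X n) i w *m ((colX (X n) i w)^T *m polB n p3)) ltr01 HKj.
rewrite -/(cov w) !frob_outer_bil !polB_sym // -!polBM invr1 !mul1r.
rewrite -/(pbil _ _ _ w) -/(pbil _ _ _ w) -/(pbil _ _ _ w) -/(pbil _ _ _ w).
rewrite !pbil_qf -/N -/K2 => Hc.
have n2 : 0 <= N^-1 ^+ 2 by rewrite exprn_ge0.
rewrite normrM (ger0_norm n2) (le_trans (ler_wpM2l n2 Hc)) //.
rewrite le_eqVlt; apply/orP; left; apply/eqP.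
rewrite -/(q _ i w) -/(q _ i w) -/(q _ i w) -/(q _ i w).
by field.
Qed.




Lemma Ex_contract_eq n p p' i j k (Z f : T -> R) :
  i != j -> k != j -> free_of (X n) j Z ->
  (forall w, f w = pbil p i j w * pbil p' j k w * Z w) ->
  Ex P f = Ex P (fun w => pbil (p * p') i k w * Z w).
Proof.
move=> ij kj fZ fE.
rewrite -(Ex_pbil_contract _ _ ij kj fZ).
by congr Ex; apply/funext.
Qed.

Let free_pbil n p (i j k : 'I_(M n)) : i != k -> j != k ->
  free_of (X n) k (pbil p i j).
Proof. exact: free_of_bil. Qed.

Let free_mul n (k : 'I_(M n)) f g : free_of (X n) k f -> free_of (X n) k g ->
  free_of (X n) k (fun w => f w * g w).
Proof. exact: polyIn_mul. Qed.

Let free_cst n (k : 'I_(M n)) (c : R) : free_of (X n) k (fun=> c).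
Proof. exact: polyIn_cst. Qed.

(** What a tuple of columns with a given coincidence pattern contributes in the
    limit. The numbers [a], [b], [c] are those of [sum_pattern4]; [1, 0, 1] is
    the crossing pattern. *)
Definition word4_value (u : {poly R} -> R) (p1 p2 p3 p4 : {poly R})
    (a b c : nat) : R :=
  match a, b, c with
  | 0%N, 0%N, 0%N => u p1 * u p2 * u p3 * u p4
  | 0%N, 0%N, _ => u p1 * u p2 * u (p3 * p4)
  | 0%N, _, 0%N => u p1 * u p4 * u (p2 * p3)
  | 0%N, _, 2%N => u p1 * u p3 * u (p2 * p4)
  | 0%N, _, _ => u p1 * u (p2 * p3 * p4)
  | _, 0%N, 0%N => u (p1 * p2) * u p3 * u p4
  | _, 0%N, 1%N => 0
  | _, 0%N, _ => u (p1 * p2) * u (p3 * p4)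
  | _, 1%N, 0%N => u p4 * u p2 * u (p1 * p3)
  | _, 1%N, 1%N => u p2 * u p3 * u (p4 * p1)
  | _, 1%N, _ => u p2 * u (p3 * p4 * p1)
  | _, _, 0%N => u p4 * u (p1 * p2 * p3)
  | _, _, 1%N => u (p4 * p1) * u (p2 * p3)
  | _, _, 2%N => u p3 * u (p4 * p1 * p2)
  | _, _, _ => u (p1 * p2 * p3 * p4)
  end.

Definition word3_value (u : {poly R} -> R) (p1 p2 p3 : {poly R})
    (a b : nat) : R :=
  match a, b with
  | 0%N, 0%N => u p1 * u p2 * u p3
  | 0%N, _ => u p1 * u (p2 * p3)
  | _, 0%N => u (p1 * p2) * u p3
  | _, 1%N => u p2 * u (p3 * p1)
  | _, _ => u (p1 * p2 * p3)
  end.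

Definition word2_value (u : {poly R} -> R) (p1 p2 : {poly R}) (a : nat) : R :=
  if a is 0%N then u p1 * u p2 else u (p1 * p2).

Let le_sum_abs (C : R) (s : seq R) (r : R) : 0 <= r -> C \in s ->
  C * r <= (\sum_(c <- s) `|c|) * r.
Proof.
move=> r0 Cs; rewrite ler_wpM2r // (le_trans (ler_norm C)) //.
by rewrite (big_rem C) //= lerDl sumr_ge0.
Qed.

Let rate0 n : 0 <= rate n. Proof. exact: ltW (rate_gt0 _). Qed.

Let near_list (ps : seq {poly R}) (C : R) (s : seq R) (n : nat) (i : 'I_(M n))
    (f : T -> R) (k : nat) (v : R) :
  `|n.+1%:R^-1 ^+ size ps * Ex P (fun w => \prod_(p <- ps) pbil p i i w) -
    \prod_(p <- ps) ntr n p| <= C * rate n ->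
  C \in s -> k = size ps -> Ex P f = Ex P (fun w => \prod_(p <- ps) pbil p i i
      w) ->
  v = \prod_(p <- ps) ntr n p ->
  `|n.+1%:R^-1 ^+ k * Ex P f - v| <= (\sum_(c <- s) `|c|) * rate n.
Proof.
move=> H Cs -> -> ->; apply: le_trans H _; exact: le_sum_abs.
Qed.

Let prodE1 (u : {poly R} -> R) p1 : \prod_(p <- [:: p1]) u p = u p1.
Proof. by rewrite big_seq1. Qed.

Let prodE2 (u : {poly R} -> R) p1 p2 : \prod_(p <- [:: p1; p2]) u p = u p1 * u
    p2.
Proof. by rewrite !big_cons big_nil mulr1. Qed.

Let prodE3 (u : {poly R} -> R) p1 p2 p3 :
  \prod_(p <- [:: p1; p2; p3]) u p = u p1 * u p2 * u p3.
Proof. by rewrite !big_cons big_nil mulr1 mulrA. Qed.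

Let prodE4 (u : {poly R} -> R) p1 p2 p3 p4 :
  \prod_(p <- [:: p1; p2; p3; p4]) u p = u p1 * u p2 * u p3 * u p4.
Proof. by rewrite !big_cons big_nil mulr1 !mulrA. Qed.

(** In this lemma and the next two, each coincidence pattern comes with its own
    constant, and their sum serves for all patterns. *)
Lemma word2_near p1 p2 : exists C : R, forall n (j1 j2 : 'I_(M n)),
  `|n.+1%:R^-1 ^+ (2 - (index j2 [:: j1] == 1))%N *
     Ex P (fun w => pbil p1 j1 j2 w * pbil p2 j2 j1 w) -
   word2_value (ntr n) p1 p2 (index j2 [:: j1])| <= C * rate n.
Proof.
have [C1 H1] := prod_pbil_near [:: p1; p2].
have [C2 H2] := prod_pbil_near [:: p1 * p2].
exists (\sum_(c <- [:: C1; C2]) `|c|) => n j1 j2.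
have [<-|n12] := eqVneq j1 j2.
  rewrite /= eqxx; apply: near_list (H1 n j1) _ _ _ _ => //=.
  - by rewrite !inE eqxx.
  - by congr Ex; apply/funext => w; rewrite prodE2.
rewrite /= (negbTE n12); apply: near_list (H2 n j1) _ _ _ _ => //=.
- by rewrite !inE eqxx orbT.
- rewrite (@Ex_contract_eq n p1 p2 j1 j2 j1 (fun=> 1)) //.
    by congr Ex; apply/funext => w; rewrite prodE1 mulr1.
  by move=> w; rewrite mulr1.
Qed.

Lemma word3_near p1 p2 p3 : exists C : R, forall n (j1 j2 j3 : 'I_(M n)),
  `|n.+1%:R^-1 ^+ (3 - ((index j2 [:: j1] == 1) + (index j3 [:: j1; j2] ==
      2)))%N *
     Ex P (fun w => pbil p1 j1 j2 w * pbil p2 j2 j3 w *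
                    pbil p3 j3 j1 w) -
   word3_value (ntr n) p1 p2 p3 (index j2 [:: j1]) (index j3 [:: j1; j2])|
  <= C * rate n.
Proof.
have [C1 H1] := prod_pbil_near [:: p1; p2; p3].
have [C2 H2] := prod_pbil_near [:: p1; p2 * p3].
have [C3 H3] := prod_pbil_near [:: p1 * p2; p3].
have [C4 H4] := prod_pbil_near [:: p2; p3 * p1].
have [C5 H5] := prod_pbil_near [:: p1 * p2 * p3].
exists (\sum_(c <- [:: C1; C2; C3; C4; C5]) `|c|) => n j1 j2 j3.
have [<-|n12] := eqVneq j1 j2.
  have [<-|n13] := eqVneq j1 j3.
    rewrite /= !eqxx; apply: near_list (H1 n j1) _ _ _ _ => //=.
    - by rewrite !inE eqxx.
    - by congr Ex; apply/funext => w; rewrite prodE3.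
  rewrite /= !eqxx (negbTE n13); apply: near_list (H2 n j1) _ _ _ _ => //=.
  - by rewrite !inE eqxx ?orbT.
  - rewrite (@Ex_contract_eq n p2 p3 j1 j3 j1 (pbil p1 j1 j1)) //.
    + by congr Ex; apply/funext => w; rewrite prodE2 mulrC.
    + exact: free_pbil.
    + by move=> w; ring.
have n21 : j2 != j1 by rewrite eq_sym.
have [<-|n13] := eqVneq j1 j3.
  rewrite /= (negbTE n12) !eqxx; apply: near_list (H3 n j1) _ _ _ _ => //=.
  - by rewrite !inE eqxx ?orbT.
  - rewrite (@Ex_contract_eq n p1 p2 j1 j2 j1 (pbil p3 j1 j1)) //.
    + by congr Ex; apply/funext => w; rewrite prodE2.
    + exact: free_pbil.
have n31 : j3 != j1 by rewrite eq_sym.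
have [<-|n23] := eqVneq j2 j3.
  rewrite /= (negbTE n12) !eqxx; apply: near_list (H4 n j2) _ _ _ _ => //=.
  - by rewrite !inE eqxx ?orbT.
  - rewrite (@Ex_contract_eq n p3 p1 j2 j1 j2 (pbil p2 j2 j2)) //.
    + by congr Ex; apply/funext => w; rewrite prodE2 mulrC.
    + exact: free_pbil.
    + by move=> w; ring.
rewrite /= (negbTE n12) (negbTE n13) (negbTE n23).
apply: near_list (H5 n j1) _ _ _ _ => //=.
- by rewrite !inE eqxx ?orbT.
- rewrite (@Ex_contract_eq n p1 p2 j1 j2 j3 (pbil p3 j3 j1)) //.
  + rewrite (@Ex_contract_eq n (p1 * p2) p3 j1 j3 j1 (fun=> 1)) //.
      by congr Ex; apply/funext => w; rewrite prodE1 mulr1.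
    by move=> w; rewrite mulr1.
  + by rewrite eq_sym.
  + by apply: free_pbil => //; rewrite eq_sym.
Qed.

Lemma word4_near p1 p2 p3 p4 : exists C : R, forall n (j1 j2 j3 j4 : 'I_(M n)),
  `|n.+1%:R^-1 ^+ (4 - ((index j2 [:: j1] == 1) + (index j3 [:: j1; j2] == 2) +
                        (index j4 [:: j1; j2; j3] == 3)))%N *
     Ex P (fun w => pbil p1 j1 j2 w * pbil p2 j2 j3 w *
                    pbil p3 j3 j4 w * pbil p4 j4 j1 w) -
   word4_value (ntr n) p1 p2 p3 p4 (index j2 [:: j1]) (index j3 [:: j1; j2])
     (index j4 [:: j1; j2; j3])| <= C * rate n.
Proof.
have [C1 H1] := prod_pbil_near [:: p1; p2; p3; p4].
have [C2 H2] := prod_pbil_near [:: p1; p2; p3 * p4].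
have [C3 H3] := prod_pbil_near [:: p1; p4; p2 * p3].
have [C4 H4] := pbil_1122_near p1 p2 p3 p4.
have [C5 H5] := prod_pbil_near [:: p1; p2 * p3 * p4].
have [C6 H6] := prod_pbil_near [:: p1 * p2; p3; p4].
have [C7 H7] := pbil_1212_near p1 p2 p3 p4.
have [C8 H8] := prod_pbil_near [:: p1 * p2; p3 * p4].
have [C9 H9] := pbil_1122_near p4 p1 p2 p3.
have [C10 H10] := prod_pbil_near [:: p2; p3; p4 * p1].
have [C11 H11] := prod_pbil_near [:: p2; p3 * p4 * p1].
have [C12 H12] := prod_pbil_near [:: p4; p1 * p2 * p3].
have [C13 H13] := prod_pbil_near [:: p4 * p1; p2 * p3].
have [C14 H14] := prod_pbil_near [:: p3; p4 * p1 * p2].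
have [C15 H15] := prod_pbil_near [:: p1 * p2 * p3 * p4].
exists (\sum_(c <- [:: C1; C2; C3; C4; C5; C6; C7; C8; C9; C10; C11; C12; C13;
  C14; C15]) `|c|) => n j1 j2 j3 j4.
have sym (i j : 'I_(M n)) : i != j -> j != i by rewrite eq_sym.
have [<-|n12] := eqVneq j1 j2.
  have [<-|n13] := eqVneq j1 j3.
    have [<-|n14] := eqVneq j1 j4.
      rewrite /= !eqxx; apply: near_list (H1 n j1) _ _ _ _ => //=.
      - by rewrite !inE eqxx.
      - by congr Ex; apply/funext => w; rewrite prodE4.
    rewrite /= !eqxx (negbTE n14); apply: near_list (H2 n j1) _ _ _ _ => //=.
    - by rewrite !inE eqxx ?orbT.
    - rewrite (@Ex_contract_eq n p3 p4 j1 j4 j1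
        (fun w => pbil p1 j1 j1 w * pbil p2 j1 j1 w)) //.
      + by congr Ex; apply/funext => w; rewrite prodE3; ring.
      + by apply: free_mul; exact: free_pbil.
      + by move=> w; ring.
  have n31 := sym _ _ n13.
  have [<-|n14] := eqVneq j1 j4.
    rewrite /= !eqxx (negbTE n13); apply: near_list (H3 n j1) _ _ _ _ => //=.
    - by rewrite !inE eqxx ?orbT.
    - rewrite (@Ex_contract_eq n p2 p3 j1 j3 j1
        (fun w => pbil p1 j1 j1 w * pbil p4 j1 j1 w)) //.
      + by congr Ex; apply/funext => w; rewrite prodE3; ring.
      + by apply: free_mul; exact: free_pbil.
      + by move=> w; ring.
  have n41 := sym _ _ n14.
  have [<-|n34] := eqVneq j3 j4.
    rewrite /= !eqxx (negbTE n13) /=.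
    apply: le_trans (H4 n j1 j3 n13) _; apply: le_sum_abs => //.
    by rewrite !inE eqxx ?orbT.
  have n43 := sym _ _ n34.
  rewrite /= !eqxx (negbTE n13) (negbTE n14) (negbTE n34).
  apply: near_list (H5 n j1) _ _ _ _ => //=.
  - by rewrite !inE eqxx ?orbT.
  - rewrite (@Ex_contract_eq n p2 p3 j1 j3 j4
      (fun w => pbil p1 j1 j1 w * pbil p4 j4 j1 w)) //.
    + rewrite (@Ex_contract_eq n (p2 * p3) p4 j1 j4 j1 (pbil p1 j1 j1)) //.
      * by congr Ex; apply/funext => w; rewrite prodE2; ring.
      * exact: free_pbil.
      * by move=> w; ring.
    + by apply: free_mul; exact: free_pbil.
    + by move=> w; ring.
have n21 := sym _ _ n12.
have [<-|n13] := eqVneq j1 j3.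
  have [<-|n14] := eqVneq j1 j4.
    rewrite /= (negbTE n12) !eqxx; apply: near_list (H6 n j1) _ _ _ _ => //=.
    - by rewrite !inE eqxx ?orbT.
    - rewrite (@Ex_contract_eq n p1 p2 j1 j2 j1
        (fun w => pbil p3 j1 j1 w * pbil p4 j1 j1 w)) //.
      + by congr Ex; apply/funext => w; rewrite prodE3; ring.
      + by apply: free_mul; exact: free_pbil.
      + by move=> w; ring.
  have n41 := sym _ _ n14.
  have [<-|n24] := eqVneq j2 j4.
    rewrite /= (negbTE n12) !eqxx /= subr0.
    apply: le_trans (H7 n j1 j2 n12) _; apply: le_sum_abs => //.
    by rewrite !inE eqxx ?orbT.
  have n42 := sym _ _ n24.
  rewrite /= (negbTE n12) !eqxx (negbTE n14) (negbTE n24).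
  apply: near_list (H8 n j1) _ _ _ _ => //=.
  - by rewrite !inE eqxx ?orbT.
  - rewrite (@Ex_contract_eq n p1 p2 j1 j2 j1
      (fun w => pbil p3 j1 j4 w * pbil p4 j4 j1 w)) //.
    + rewrite (@Ex_contract_eq n p3 p4 j1 j4 j1 (pbil (p1 * p2) j1 j1)) //.
      * by congr Ex; apply/funext => w; rewrite prodE2; ring.
      * exact: free_pbil.
      * by move=> w; ring.
    + by apply: free_mul; exact: free_pbil.
    + by move=> w; ring.
have n31 := sym _ _ n13.
have [<-|n23] := eqVneq j2 j3.
  have [<-|n14] := eqVneq j1 j4.
    rewrite /= (negbTE n12) !eqxx /=.
    have := H9 n j1 j2 n12.
    rewrite (_ : (fun w => pbil p4 j1 j1 w * _ * _ * _) = (fun w =>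
      pbil p1 j1 j2 w * pbil p2 j2 j2 w * pbil p3 j2 j1 w *
      pbil p4 j1 j1 w)).
      move=> H; apply: le_trans H _; apply: le_sum_abs => //.
      by rewrite !inE eqxx ?orbT.
    by apply/funext => w; ring.
  have n41 := sym _ _ n14.
  have [<-|n24] := eqVneq j2 j4.
    rewrite /= (negbTE n12) !eqxx /=; apply: near_list (H10 n j2) _ _ _ _ =>
        //=.
    - by rewrite !inE eqxx ?orbT.
    - rewrite (@Ex_contract_eq n p4 p1 j2 j1 j2
        (fun w => pbil p2 j2 j2 w * pbil p3 j2 j2 w)) //.
      + by congr Ex; apply/funext => w; rewrite prodE3; ring.
      + by apply: free_mul; exact: free_pbil.
      + by move=> w; ring.
  have n42 := sym _ _ n24.
  rewrite /= (negbTE n12) !eqxx (negbTE n14) (negbTE n24).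
  apply: near_list (H11 n j2) _ _ _ _ => //=.
  - by rewrite !inE eqxx ?orbT.
  - rewrite (@Ex_contract_eq n p3 p4 j2 j4 j1
      (fun w => pbil p2 j2 j2 w * pbil p1 j1 j2 w)) //.
    + rewrite (@Ex_contract_eq n (p3 * p4) p1 j2 j1 j2 (pbil p2 j2 j2)) //.
      * by congr Ex; apply/funext => w; rewrite prodE2; ring.
      * exact: free_pbil.
      * by move=> w; ring.
    + by apply: free_mul; exact: free_pbil.
    + by move=> w; ring.
have n32 := sym _ _ n23.
have [<-|n14] := eqVneq j1 j4.
  rewrite /= (negbTE n12) (negbTE n13) (negbTE n23) !eqxx /=.
  apply: near_list (H12 n j1) _ _ _ _ => //=.
  - by rewrite !inE eqxx ?orbT.
  - rewrite (@Ex_contract_eq n p1 p2 j1 j2 j3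
      (fun w => pbil p3 j3 j1 w * pbil p4 j1 j1 w)) //.
    + rewrite (@Ex_contract_eq n (p1 * p2) p3 j1 j3 j1 (pbil p4 j1 j1)) //.
      * by congr Ex; apply/funext => w; rewrite prodE2; ring.
      * exact: free_pbil.
      * by move=> w; ring.
    + by apply: free_mul; exact: free_pbil.
    + by move=> w; ring.
have n41 := sym _ _ n14.
have [<-|n24] := eqVneq j2 j4.
  rewrite /= (negbTE n12) (negbTE n13) (negbTE n23) !eqxx /=.
  apply: near_list (H13 n j2) _ _ _ _ => //=.
  - by rewrite !inE eqxx ?orbT.
  - rewrite (@Ex_contract_eq n p4 p1 j2 j1 j2
      (fun w => pbil p2 j2 j3 w * pbil p3 j3 j2 w)) //.
    + rewrite (@Ex_contract_eq n p2 p3 j2 j3 j2 (pbil (p4 * p1) j2 j2)) //.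
      * by congr Ex; apply/funext => w; rewrite prodE2; ring.
      * exact: free_pbil.
      * by move=> w; ring.
    + by apply: free_mul; exact: free_pbil.
    + by move=> w; ring.
have n42 := sym _ _ n24.
have [<-|n34] := eqVneq j3 j4.
  rewrite /= (negbTE n12) (negbTE n13) (negbTE n23) !eqxx /=.
  apply: near_list (H14 n j3) _ _ _ _ => //=.
  - by rewrite !inE eqxx ?orbT.
  - rewrite (@Ex_contract_eq n p4 p1 j3 j1 j2
      (fun w => pbil p3 j3 j3 w * pbil p2 j2 j3 w)) //.
    + rewrite (@Ex_contract_eq n (p4 * p1) p2 j3 j2 j3 (pbil p3 j3 j3)) //.
      * by congr Ex; apply/funext => w; rewrite prodE2; ring.
      * exact: free_pbil.
      * by move=> w; ring.
    + by apply: free_mul; exact: free_pbil.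
    + by move=> w; ring.
have n43 := sym _ _ n34.
rewrite /= (negbTE n12) (negbTE n13) (negbTE n23) (negbTE n14) (negbTE n24).
rewrite (negbTE n34) /=.
apply: near_list (H15 n j1) _ _ _ _ => //=.
- by rewrite !inE eqxx ?orbT.
- rewrite (@Ex_contract_eq n p1 p2 j1 j2 j3
    (fun w => pbil p3 j3 j4 w * pbil p4 j4 j1 w)) //.
  + rewrite (@Ex_contract_eq n (p1 * p2) p3 j1 j3 j4 (pbil p4 j4 j1)) //.
    * rewrite (@Ex_contract_eq n (p1 * p2 * p3) p4 j1 j4 j1 (fun=> 1)) //.
        by congr Ex; apply/funext => w; rewrite prodE1 mulr1.
      by move=> w; rewrite mulr1.
    * exact: free_pbil.
    * by move=> w; ring.
  + by apply: free_mul; exact: free_pbil.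
  + by move=> w; ring.
Qed.

Hypothesis M_gt0 : forall n, (0 < M n)%N.
Hypothesis M_ratio : (fun n => (M n)%:R * n.+1%:R^-1 : R) @ \oo --> (1 : R).

Let rate_cvg : rate @ \oo --> (0 : R).
Proof.
have -> : rate = (fun n => Num.sqrt (harmonic n)).
  by apply/funext => n; rewrite /rate /harmonic sqrtrV.
rewrite -[X in _ --> X](sqrtr0 R).
by apply: (cvg_comp _ _ (@cvg_harmonic R)); exact: sqrt_continuous.
Qed.

Let inv_cvg : (fun n => n.+1%:R^-1 : R) @ \oo --> (0 : R).
Proof. exact: cvg_harmonic. Qed.

(** * Limits of normalized traces *)

Definition pmx (n : nat) (p : {poly R}) (w : T) : 'M[R]_(M n) :=
  n.+1%:R^-1 *: ((random_mx (X n) w)^T *m polB n p *m random_mx (X n) w).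

Definition mean_trace (n : nat) (ps : seq {poly R}) : R :=
  Ex P (fun w => (M n)%:R^-1 * \tr (\prod_(p <- ps) pmx n p w)).

Lemma pmxE n p w i j : pmx n p w i j = n.+1%:R^-1 * pbil p i j w.
Proof.
rewrite /pmx /pbil /bil mxE; congr (_ * _).
rewrite -!mulmxA !mxE; apply: eq_bigr => a _; congr (_ * _); first by rewrite
    !mxE.
by rewrite !mxE; apply: eq_bigr => b _; rewrite !mxE.
Qed.

Let apbil n p i j : all_moments P (@pbil n p i j).
Proof. exact: (all_moments_bil (X_all_moments n)). Qed.

Lemma mean_trace1 n p : mean_trace n [:: p] = ntr n p.
Proof.
rewrite /mean_trace.
have -> : (fun w => (M n)%:R^-1 * \tr (\prod_(p0 <- [:: p]) pmx n p0 w)) =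
   (fun w => ((M n)%:R^-1 * n.+1%:R^-1) * \sum_(j < M n) pbil p j j w).
  apply/funext => w; rewrite big_seq1 -mulrA; congr (_ * _); rewrite mulr_sumr.
  by apply: eq_bigr => j _; rewrite pmxE.
rewrite ExZ; last by apply: all_moments_sum.
rewrite Ex_sum // (eq_bigr (fun=> \tr (polB n p))); last first.
  move=> j _.
  exact: (Ex_bil_trace (X_indep n) (X_all_moments n) (X_mean n) (X_square n)).
rewrite sumr_const card_ord -[X in _ * X]mulr_natl /ntr -mulrA mulrCA mulKf //.
by rewrite pnatr_eq0 -lt0n.
Qed.

Lemma mean_trace2 n p1 p2 : mean_trace n [:: p1; p2] =
  (M n)%:R^-1 * \sum_(j1 < M n) \sum_(j2 < M n) n.+1%:R^-1 ^+ 2 *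
    Ex P (fun w => pbil p1 j1 j2 w * pbil p2 j2 j1 w).
Proof.
have am (j1 j2 : 'I_(M n)) : all_moments P (fun w =>
    n.+1%:R^-1 ^+ 2 * (pbil p1 j1 j2 w * pbil p2 j2 j1 w)).
  by apply: all_moments_scale; exact: all_moments_mul.
rewrite /mean_trace.
transitivity (Ex P (fun w => (M n)%:R^-1 * \sum_(j1 < M n) \sum_(j2 < M n)
    n.+1%:R^-1 ^+ 2 * (pbil p1 j1 j2 w * pbil p2 j2 j1 w))).
  congr Ex; apply/funext => w; congr (_ * _); rewrite !big_cons big_nil mulr1.
  apply: eq_bigr => j1 _; rewrite -mulmxE mxE; apply: eq_bigr => j2 _.
  by rewrite !pmxE; ring.
rewrite ExZ; last by do 2!apply: all_moments_sum => ?.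
congr (_ * _); rewrite Ex_sum; last by move=> j1; exact: all_moments_sum.
apply: eq_bigr => j1 _; rewrite Ex_sum //; apply: eq_bigr => j2 _.
by rewrite ExZ //; exact: all_moments_mul.
Qed.

Lemma mean_trace3 n p1 p2 p3 : mean_trace n [:: p1; p2; p3] =
  (M n)%:R^-1 * \sum_(j1 < M n) \sum_(j2 < M n) \sum_(j3 < M n)
    n.+1%:R^-1 ^+ 3 *
    Ex P (fun w => pbil p1 j1 j2 w * pbil p2 j2 j3 w *
      pbil p3 j3 j1 w).
Proof.
have am0 (j1 j2 j3 : 'I_(M n)) : all_moments P (fun w =>
    pbil p1 j1 j2 w * pbil p2 j2 j3 w * pbil p3 j3 j1 w).
  by do 2?apply: all_moments_mul.
have am j1 j2 j3 := all_moments_scale (n.+1%:R^-1 ^+ 3) (am0 j1 j2 j3).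
rewrite /mean_trace.
transitivity (Ex P (fun w => (M n)%:R^-1 *
    \sum_(j1 < M n) \sum_(j2 < M n) \sum_(j3 < M n) n.+1%:R^-1 ^+ 3 *
    (pbil p1 j1 j2 w * pbil p2 j2 j3 w * pbil p3 j3 j1 w))).
  congr Ex; apply/funext => w; congr (_ * _); rewrite !big_cons big_nil mulr1.
  apply: eq_bigr => j1 _; rewrite -!mulmxE mxE; apply: eq_bigr => j2 _.
  rewrite [X in _ * X]mxE mulr_sumr; apply: eq_bigr => j3 _.
  by rewrite !pmxE; ring.
rewrite ExZ; last by do 3!apply: all_moments_sum => ?.
congr (_ * _).
rewrite Ex_sum; last by move=> j1; do 2!apply: all_moments_sum => ?.
apply: eq_bigr => j1 _; rewrite Ex_sum; last by move=> j2; exact: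
    all_moments_sum.
apply: eq_bigr => j2 _; rewrite Ex_sum //; apply: eq_bigr => j3 _.
by rewrite ExZ.
Qed.

Lemma mean_trace4 n p1 p2 p3 p4 : mean_trace n [:: p1; p2; p3; p4] =
  (M n)%:R^-1 * \sum_(j1 < M n) \sum_(j2 < M n) \sum_(j3 < M n) \sum_(j4 < M n)
    n.+1%:R^-1 ^+ 4 *
    Ex P (fun w => pbil p1 j1 j2 w * pbil p2 j2 j3 w *
      pbil p3 j3 j4 w * pbil p4 j4 j1 w).
Proof.
have am0 (j1 j2 j3 j4 : 'I_(M n)) : all_moments P (fun w =>
    pbil p1 j1 j2 w * pbil p2 j2 j3 w * pbil p3 j3 j4 w *
    pbil p4 j4 j1 w).
  by do 3?apply: all_moments_mul.
have am j1 j2 j3 j4 := all_moments_scale (n.+1%:R^-1 ^+ 4) (am0 j1 j2 j3 j4).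
rewrite /mean_trace.
transitivity (Ex P (fun w => (M n)%:R^-1 *
    \sum_(j1 < M n) \sum_(j2 < M n) \sum_(j3 < M n) \sum_(j4 < M n)
    n.+1%:R^-1 ^+ 4 *
    (pbil p1 j1 j2 w * pbil p2 j2 j3 w * pbil p3 j3 j4 w *
     pbil p4 j4 j1 w))).
  congr Ex; apply/funext => w; congr (_ * _); rewrite !big_cons big_nil mulr1.
  apply: eq_bigr => j1 _; rewrite -!mulmxE mxE; apply: eq_bigr => j2 _.
  rewrite [X in _ * X]mxE mulr_sumr; apply: eq_bigr => j3 _.
  rewrite [X in _ * (_ * X)]mxE !mulr_sumr; apply: eq_bigr => j4 _.
  by rewrite !pmxE; ring.
rewrite ExZ; last by do 4!apply: all_moments_sum => ?.
congr (_ * _).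
rewrite Ex_sum; last by move=> j1; do 3!apply: all_moments_sum => ?.
apply: eq_bigr => j1 _; rewrite Ex_sum; last by move=> j2; do 2!apply:
    all_moments_sum => ?.
apply: eq_bigr => j2 _; rewrite Ex_sum; last by move=> j3; exact:
    all_moments_sum.
apply: eq_bigr => j3 _; rewrite Ex_sum //; apply: eq_bigr => j4 _.
by rewrite ExZ.
Qed.

Let cvg_near (u e v : nat -> R) (l : R) :
  (forall n, `|u n - v n| <= e n) -> e @ \oo --> (0 : R) -> v @ \oo --> l ->
  u @ \oo --> l.
Proof.
move=> H e0 vl.
have d0 : (fun n => u n - v n) @ \oo --> (0 : R).
  apply/norm_cvg0P; apply: (squeeze_cvgr _ (cvg_cst 0) e0).
  by apply: nearW => n; rewrite normr_ge0 H.
have -> : u = (fun n => (u n - v n) + v n) by apply/funext => n; rewrite subrK.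
by rewrite -[l]add0r; exact: cvgD.
Qed.

Let err_cvg (C : R) : (fun n => C * rate n) @ \oo --> (0 : R).
Proof. by rewrite -[X in _ --> X](mulr0 C); apply: cvgM => //; exact: cvg_cst.
    Qed.

Lemma mean_trace1_cvg p : (fun n => mean_trace n [:: p]) @ \oo --> tau p.
Proof. by under eq_fun do rewrite mean_trace1; exact: ntr_cvg. Qed.

Lemma mean_trace2_cvg p1 p2 : (fun n => mean_trace n [:: p1; p2]) @ \oo -->
  tau p1 * tau p2 + tau (p1 * p2).
Proof.
have [C HC] := word2_near p1 p2.
apply: (@cvg_near _ (fun n => pattern2_mean (M n) n.+1%:R^-1 (fun=> C * rate n))
  (fun n => pattern2_mean (M n) n.+1%:R^-1 (word2_value (ntr n) p1 p2))).
- move=> n; rewrite mean_trace2; apply: pattern2_mean_near => //.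
- have := pattern2_mean_cvg M_ratio inv_cvg (fun=> err_cvg C).
  by rewrite addr0.
- apply: (pattern2_mean_cvg M_ratio inv_cvg (l := word2_value tau p1 p2)).
  by move=> [|a] /=; do ?[exact: ntr_cvg | apply: cvgM].
Qed.

Lemma mean_trace3_cvg p1 p2 p3 :
  (fun n => mean_trace n [:: p1; p2; p3]) @ \oo -->
  tau p1 * tau p2 * tau p3 + (tau p1 * tau (p2 * p3) + tau (p1 * p2) * tau p3 +
  tau p2 * tau (p3 * p1)) + tau (p1 * p2 * p3).
Proof.
have [C HC] := word3_near p1 p2 p3.
apply: (@cvg_near _ (fun n => pattern3_mean (M n) n.+1%:R^-1 (fun _ _ => C *
    rate n))
  (fun n => pattern3_mean (M n) n.+1%:R^-1 (word3_value (ntr n) p1 p2 p3))).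
- move=> n; rewrite mean_trace3; apply: pattern3_mean_near => //.
- have := pattern3_mean_cvg M_ratio inv_cvg (fun _ _ => err_cvg C).
  by rewrite !addr0.
- apply: (pattern3_mean_cvg M_ratio inv_cvg (l := word3_value tau p1 p2 p3)).
  by move=> [|a] [|[|b]] /=; do ?[exact: ntr_cvg | apply: cvgM].
Qed.

Lemma mean_trace4_cvg p1 p2 p3 p4 :
  (fun n => mean_trace n [:: p1; p2; p3; p4]) @ \oo -->
  tau p1 * tau p2 * tau p3 * tau p4 +
  (tau p1 * tau p2 * tau (p3 * p4) + tau p1 * tau p4 * tau (p2 * p3) +
   tau p1 * tau p3 * tau (p2 * p4) + tau (p1 * p2) * tau p3 * tau p4 + 0 +
   tau p4 * tau p2 * tau (p1 * p3) + tau p2 * tau p3 * tau (p4 * p1)) +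
  (tau p1 * tau (p2 * p3 * p4) + tau (p1 * p2) * tau (p3 * p4) +
   tau p2 * tau (p3 * p4 * p1) + tau p4 * tau (p1 * p2 * p3) +
   tau (p4 * p1) * tau (p2 * p3) + tau p3 * tau (p4 * p1 * p2)) +
  tau (p1 * p2 * p3 * p4).
Proof.
have [C HC] := word4_near p1 p2 p3 p4.
apply: (@cvg_near _ (fun n => pattern4_mean (M n) n.+1%:R^-1 (fun _ _ _ => C *
    rate n))
  (fun n => pattern4_mean (M n) n.+1%:R^-1 (word4_value (ntr n) p1 p2 p3 p4))).
- move=> n; rewrite mean_trace4; apply: pattern4_mean_near => //.
- have := pattern4_mean_cvg M_ratio inv_cvg (fun _ _ _ => err_cvg C).
  by rewrite !addr0.
- apply: (pattern4_mean_cvg M_ratio inv_cvg (l := word4_value tau p1 p2 p3 p4)).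
  by move=> [|[|a]] [|[|b]] [|[|[|c]]] /=;
    do ?[exact: ntr_cvg | exact: cvg_cst | apply: cvgM].
Qed.


End QuadraticForms.

(** * The limit functional *)

Lemma trace_cauchy_schwarz (R : realFieldType) (n : nat) (A C : 'M[R]_n) :
  A^T = A -> C^T = C -> \tr (A *m C) ^+ 2 <= \tr (A *m A) * \tr (C *m C).
Proof.
move=> sA sC.
have E (U V : 'M[R]_n) : V^T = V ->
    \tr (U *m V) = \sum_(p : 'I_n * 'I_n) U p.1 p.2 * V p.1 p.2.
  move=> sV; rewrite -(pair_bigA _ (fun a b => U a b * V a b)) /=.
  apply: eq_bigr => a _; rewrite mxE; apply: eq_bigr => b _.
  by rewrite -{1}sV mxE.
rewrite !E //; exact: sum_cauchy_schwarz.
Qed.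

Section LimitTrace.
Context (R : realType) (B : forall n, 'M[R]_n.+1).
Arguments B : clear implicits.
Hypothesis B_sym : forall n, (B n)^T = B n.
Context (tau : {poly R} -> R).
Hypothesis ntr_cvg : forall p, (fun n => ntr B n p) @ \oo --> tau p.
Arguments ntr_cvg : clear implicits.

Lemma ntrD n p q : ntr B n (p + q) = ntr B n p + ntr B n q.
Proof. by rewrite /ntr /polB rmorphD raddfD mulrDr. Qed.

Lemma ntrZ n (c : R) p : ntr B n (c *: p) = c * ntr B n p.
Proof. by rewrite /ntr /polB linearZ /= mxtraceZ mulrCA. Qed.

Lemma ntr_coef n p : ntr B n p = \sum_(i < size p) p`_i * ntr B n ('X ^+ i).
Proof.
have n0 : ntr B n 0 = 0 by rewrite /ntr /polB rmorph0 raddf0 mulr0.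
rewrite -[in LHS](coefK p) poly_def (big_morph (ntr B n) (ntrD n) n0).
by apply: eq_bigr => i _; rewrite ntrZ.
Qed.

Lemma ntr1 n : ntr B n 1 = 1.
Proof. by rewrite /ntr polB1 mxtrace1 mulVf // pnatr_eq0. Qed.

Lemma tau1 : tau 1 = 1.
Proof.
have H : (fun n => ntr B n 1) @ \oo --> (1 : R).
  by under eq_fun do rewrite ntr1; exact: cvg_cst.
exact: (cvg_unique _ (ntr_cvg 1) H).
Qed.

Lemma tauD p q : tau (p + q) = tau p + tau q.
Proof.
have H : (fun n => ntr B n (p + q)) @ \oo --> tau p + tau q.
  by under eq_fun do rewrite ntrD; exact: cvgD.
exact: (cvg_unique _ (ntr_cvg _) H).
Qed.

Lemma tauZ c p : tau (c *: p) = c * tau p.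
Proof.
have H : (fun n => ntr B n (c *: p)) @ \oo --> c * tau p.
  by under eq_fun do rewrite ntrZ; apply: cvgM => //; exact: cvg_cst.
exact: (cvg_unique _ (ntr_cvg _) H).
Qed.

Lemma tauN p : tau (- p) = - tau p.
Proof. by rewrite -scaleN1r tauZ mulN1r. Qed.

Lemma tauB p q : tau (p - q) = tau p - tau q.
Proof. by rewrite tauD tauN. Qed.

Lemma tau_cauchy_schwarz p q : tau (p * q) ^+ 2 <= tau (p ^+ 2) * tau (q ^+ 2).
Proof.
have c1 : (fun n => ntr B n (p * q) ^+ 2) @ \oo --> tau (p * q) ^+ 2.
  under eq_fun do rewrite expr2; rewrite expr2; exact: cvgM.
have c2 : (fun n => ntr B n (p ^+ 2) * ntr B n (q ^+ 2)) @ \oo -->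
    tau (p ^+ 2) * tau (q ^+ 2) by exact: cvgM.
rewrite -(cvg_lim _ c1) // -(cvg_lim _ c2) //; apply: ler_lim.
- by apply/cvg_ex; eexists; exact: c1.
- by apply/cvg_ex; eexists; exact: c2.
apply: nearW => n; rewrite /ntr exprMn [leRHS]mulrACA -expr2.
rewrite ler_pM2l ?exprn_gt0 ?invr_gt0 ?ltr0Sn // [p ^+ 2]expr2 [q ^+ 2]expr2
    !polBM.
by apply: trace_cauchy_schwarz; exact: polB_sym.
Qed.

(** The hypothesis says that the limit spectral distribution sits on the zero
    set [{0, 1}] of [x (1 - x)], whose powers are all equal. *)
Lemma tau_power k :
  tau ('X ^+ 2 * (1 - 'X) ^+ 2) = 0 -> (0 < k)%N -> tau ('X ^+ k) = tau 'X.
Proof.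
move=> t0; case: k => // k _; elim: k => [|k IH]; first by rewrite expr1.
rewrite -IH; apply/esym/eqP; rewrite -subr_eq0 -tauB.
have -> : 'X ^+ k.+1 - 'X ^+ k.+2 = 'X ^+ k * ('X * (1 - 'X)) :> {poly R}.
  by rewrite !exprS; ring.
have := tau_cauchy_schwarz ('X ^+ k) ('X * (1 - 'X)).
by rewrite exprMn t0 mulr0 real_exprn_even_le0 ?num_real.
Qed.

Lemma tau_idempotent :
  tau ('X ^+ 2 * (1 - 'X) ^+ 2) = 0 -> 0 <= tau 'X <= 1.
Proof.
move=> t0; have t2 := tau_power t0 (ltn0Sn 1).
have := tau_cauchy_schwarz 'X 1; rewrite mulr1 expr1n tau1 mulr1 t2.
by move=> H; apply/andP; split; nra.
Qed.

End LimitTrace.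

(** * Transfer to complex matrices *)

Section ComplexTransfer.
Context (d : measure_display) (T : measurableType d) (R : realType).
Context (P : probability T R).

Lemma mx_state_real (m : nat) (M : T -> 'M[R]_m) :
  mx_state P (fun w => map_mx (real_complex R) (M w)) =
  real_complex R (Ex P (fun w => m%:R^-1 * \tr (M w))).
Proof.
rewrite /mx_state /cexpectation.
have E w : m%:R^-1 * \tr (map_mx (real_complex R) (M w)) =
    real_complex R (m%:R^-1 * \tr (M w)).
  by rewrite trace_map_mx rmorphM fmorphV rmorph_nat.
have -> : (fun w => complex.Re (m%:R^-1 * \tr (map_mx (real_complex R) (M w))))
  = (fun w => m%:R^-1 * \tr (M w)) by apply/funext => w; rewrite E.
have -> : (fun w => complex.Im (m%:R^-1 * \tr (map_mx (real_complex R) (M w))))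
  = (fun=> 0) by apply/funext => w; rewrite E.
by rewrite -!/(Ex P _) Ex_cst.
Qed.

Lemma prod_map_real_complex (m : nat) (I : Type) (s : seq I) (M : I -> 'M[R]_m)
    :
  \prod_(i <- s) map_mx (real_complex R) (M i) =
  map_mx (real_complex R) (\prod_(i <- s) M i).
Proof.
elim: s => [|i s IH]; first by rewrite !big_nil map_mx1.
by rewrite !big_cons IH -!mulmxE map_mxM.
Qed.

Lemma real_complex_cvg (u : nat -> R) (l : R) (z : R[i]) :
  u @ \oo --> l -> ((fun n => real_complex R (u n) : R[i]^o) @ \oo --> (z :
      R[i]^o)) ->
  z = real_complex R l.
Proof.
move=> ul uz; apply: (cvg_unique (@norm_hausdorff _ _) uz).
apply/cvgrPdist_le => e e0.
have eE : e = real_complex R (complex.Re e).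
  by move: e0; case: e => a b; rewrite ltcE /= => /andP[/eqP -> _].
have e1 : 0 < complex.Re e by move: e0; rewrite eE ltcR.
move/cvgrPdist_le: ul => /(_ _ e1); apply: filterS => n.
by rewrite eE -rmorphB normc_def /= expr0n addr0 sqrtr_sqr lecR.
Qed.

End ComplexTransfer.

(** * Moments of free and of free Poisson variables *)

Section FreeProbability.
Context (R : realType) (S : ncps R).
Local Notation phi := (ncps_state S).

(** With jump size one all cumulants equal the rate, so a partition counts
    through its number of blocks. *)
Lemma free_poisson_moment (a : S) (p : R) n : (0 < n)%N ->
  free_poisson a p 1 ->
  phi (\prod_(x <- nseq n a) x) = \sum_(pi in NC n) real_complex R p ^+ #|pi|.
Proof.
move=> n0 [_ _ H].
have s0 : (0 < size (nseq n a))%N by rewrite size_nseq.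
rewrite (moment_cumulant s0) -[in RHS](size_nseq n a).
apply: eq_bigr => pi; rewrite inE => /andP[part _].
rewrite -prodr_const; apply: eq_bigr => V Vpi.
have -> : restrict_seq V = nseq #|V| a.
  apply: (@eq_from_nth _ 0); rewrite size_restrict_seq; first by rewrite
      [RHS]size_nseq.
  move=> i iV; rewrite [RHS]nth_nseq iV (nth_map (Ordinal s0)) -?cardE //.
  rewrite nth_nseq; set k := nth _ _ _.
  by have := ltn_ord k; rewrite [X in (_ < X)%N]size_nseq => ->.
rewrite H ?expr1n ?mulr1 // card_gt0.
exact: (partition_neq0 part Vpi).
Qed.

Lemma generated_subalg_center (a : S) (c : R[i]) :
  generated_subalg a (a - c%:A).
Proof.
move=> U [[U1 Ulin _] aU].
have aU' : a \in mem U by apply/mem_set; exact: aU.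
have := Ulin (- c) 1 a U1 aU'.
by rewrite scaleNr addrC => /set_mem.
Qed.

(** The two instances of freeness that determine the mixed cumulants of orders
    two and four. *)
Lemma free_alternating_moments (a : 'I_2 -> S) :
  freely_independent a ->
  let b i := a i - (phi (a i))%:A in
  let i1 : 'I_2 := ord_max in
  phi (b ord0 * b i1) = 0 /\ phi (b ord0 * b i1 * b ord0 * b i1) = 0.
Proof.
move=> fr b i1.
pose i (k : nat) : 'I_2 := if odd k then i1 else ord0.
have b0 k : phi (b k) = 0.
  by rewrite /b linearB linearZ /= ncps_state1 mulr1 subrr.
have altern k : (0 < k)%N -> phi (\prod_(0 <= j < k) b (i j)) = 0.
  move=> k0; apply: (fr k i (fun j => b (i j)) k0) => j _.
    by split => //; exact: generated_subalg_center.
  by rewrite /i /=; case: (odd j).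
split.
  by have := altern 2%N isT; rewrite !big_nat_recr //= big_geq // mul1r.
by have := altern 4%N isT; rewrite !big_nat_recr //= big_geq // mul1r.
Qed.

Lemma phi_center (u v x : S) (c : R[i]) :
  phi (u * (x - c%:A) * v) = phi (u * x * v) - c * phi (u * v).
Proof.
by rewrite mulrBr mulrBl linearB -scalerAr mulr1 -scalerAl linearZ.
Qed.

Lemma phi_center_l (v x : S) (c : R[i]) :
  phi ((x - c%:A) * v) = phi (x * v) - c * phi v.
Proof. by have := phi_center 1 v x c; rewrite !mul1r. Qed.

Lemma phi_center_r (u x : S) (c : R[i]) :
  phi (u * (x - c%:A)) = phi (u * x) - c * phi u.
Proof. by have := phi_center u 1 x c; rewrite !mulr1. Qed.

Lemma phi_center0 (x : S) (c : R[i]) : phi (x - c%:A) = phi x - c.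
Proof. by rewrite linearB linearZ /= ncps_state1 mulr1. Qed.

Lemma phi_center_alternating (x y : S) (c e : R[i]) :
  phi ((x - c%:A) * (y - e%:A) * (x - c%:A) * (y - e%:A)) =
  phi (x * y * x * y) - e * phi (x * y * x) - c * phi (x * y * y) +
  c * e * phi (x * y) - e * phi (x * x * y) + e ^+ 2 * phi (x * x) +
  c * e * phi (x * y) - c * e ^+ 2 * phi x - c * phi (y * x * y) +
  c * e * phi (y * x) + c ^+ 2 * phi (y * y) - c ^+ 2 * e * phi y +
  c * e * phi (x * y) - c * e ^+ 2 * phi x - c ^+ 2 * e * phi y + c ^+ 2 * e ^+
      2.
Proof.
have K v : phi ((x - c%:A) * (y - e%:A) * v) =
    phi (x * y * v) - c * phi (y * v) - e * (phi (x * v) - c * phi v).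
  by rewrite phi_center -mulrA !phi_center_l mulrA.
have K1 : phi ((x - c%:A) * (y - e%:A)) =
    phi (x * y) - c * phi y - e * (phi x - c).
  by have := K 1; rewrite !mulr1 ncps_state1 mulr1.
rewrite phi_center_r phi_center phi_center_r -[_ * x * y]mulrA !K K1 !mulrA.
ring.
Qed.

End FreeProbability.

(** * Asymptotic freeness and free Poisson limits *)

Section RandomVariableMoments.
Context (d : measure_display) (T : measurableType d) (R : realType).
Context (P : probability T R).

Lemma all_moments_bound (f : {RV P >-> R}) :
  (forall k, (0 < k)%N -> exists C : R,
     ('E_P[fun w => (`|f w| ^+ k)%R] <= C%:E)%E) ->
  all_moments P f.
Proof.
move=> H; split=> // -[|k].
  by apply: (all_moments_integrable (f := fun=> 1)); exact: all_moments_cst.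
have [C HC] := H k.+1 isT; apply/integrableP; split.
  apply/measurable_EFinP; apply: measurable_funX.
  exact: measurableT_comp.
apply: (@le_lt_trans _ _ C%:E); last exact: ltry.
move: HC; rewrite unlock; apply: le_trans; rewrite le_eqVlt; apply/orP; left.
by apply/eqP; apply: eq_integral => w _ /=; rewrite ger0_norm ?exprn_ge0.
Qed.

Lemma Ex_square_variance (f : {RV P >-> R}) :
  all_moments P f -> ('E_P[f] = 0)%E -> ('V_P[f] = 1)%E ->
  Ex P (fun w => f w ^+ 2) = 1.
Proof.
move=> af f0; rewrite /variance covariance.unlock f0 /= => V1.
rewrite /Ex -[RHS]/(fine 1%E) -V1; congr (fine (expectation P _)).
by apply/funext => w; rewrite -[RHS]/((f w - 0) * (f w - 0)) subr0 expr2.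
Qed.

End RandomVariableMoments.

Unset Implicit Arguments.
Theorem proposition4p8 (R : realType) (d : measure_display)
    (T : measurableType d) (P : probability T R)
    (m : nat -> nat)
    (m_gt0 : forall n, (0 < n)%N -> (0 < m n)%N)
    (m_ratio : ((fun n => (m n)%:R / n%:R : R) @ \oo --> (1 : R)))
    (X : forall n, 'I_n -> 'I_(m n) -> {RV P >-> R})
    (X_indep : forall n, (0 < n)%N ->
      mutually_independent (fun ij : 'I_n * 'I_(m n) => X n ij.1 ij.2))
    (X_mean : forall n i j, (0 < n)%N -> ('E_P[X n i j] = 0)%E)
    (X_var : forall n i j, (0 < n)%N -> ('V_P[X n i j] = 1)%E)
    (X_moments : forall k, (0 < k)%N -> exists C : R, forall n i j,
      (0 < n)%N -> ('E_P[fun w => (`|X n i j w| ^+ k)%R] <= C%:E)%E)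
    (B : forall n, 'M[R]_n)
    (B_sym : forall n, (0 < n)%N -> (B n)^T = B n)
    (B_bound : exists C : R, forall k n, (0 < k)%N -> (0 < n)%N ->
      n%:R^-1 * Num.max
        ((\tr (abs_mx (B n) ^+ k)) `^ (k%:R^-1))
        ((\tr (abs_mx (1%:M - B n) ^+ k)) `^ (k%:R^-1)) <= C)
    (B_cvg : forall k, (0 < k)%N ->
      cvg ((fun n => n%:R^-1 * \tr (B n ^+ k) : R) @ \oo)) :
  (asymptotically_free P
     (fun n (i : 'I_2) =>
        if i == ord0 then sandwich (X n) (B n)
        else sandwich (X n) (1%:M - B n)) ->
   exists2 p : R, 0 <= p <= 1 &
     forall k, (0 < k)%N ->
       (fun n => n%:R^-1 * \tr (B n ^+ k) : R) @ \oo --> p)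
  /\
  (forall p : R, 0 < p <= 1 ->
   converges_to_free_poisson P (fun n => sandwich (X n) (B n)) p 1 ->
   forall k, (0 < k)%N ->
     (fun n => n%:R^-1 * \tr (B n ^+ k) : R) @ \oo --> p).
Proof.
(* Dimension zero is irrelevant for limits, so all indices are shifted by one;
   then matrices of dimension [n.+1] form a ring with evaluation of
   polynomials. *)
pose M n := m n.+1.
pose X' n : 'I_n.+1 -> 'I_(M n) -> {RV P >-> R} := X n.+1.
pose B' n : 'M[R]_n.+1 := B n.+1.
have hindep n : mutually_independent (entry (X' n)) by exact: X_indep.
have ham n (i : 'I_n.+1) (j : 'I_(M n)) : all_moments P (X' n i j).
  apply: all_moments_bound => k k0; have [C HC] := X_moments k k0.
  by exists C; exact: HC.
have hmean n (i : 'I_n.+1) (j : 'I_(M n)) : Ex P (X' n i j) = 0.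
  by rewrite /Ex X_mean.
have hsq n (i : 'I_n.+1) (j : 'I_(M n)) : Ex P (fun w => X' n i j w ^+ 2) = 1.
  by apply: Ex_square_variance; [exact: ham|exact: X_mean|exact: X_var].
have hmom k : exists C : R, forall n (i : 'I_n.+1) (j : 'I_(M n)),
    Ex P (fun w => `|X' n i j w| ^+ k) <= C.
  case: k => [|k].
    by exists 1 => n i j; under eq_fun do rewrite expr0; rewrite Ex_cst.
  have [C HC] := X_moments k.+1 isT; exists C => n i j.
  have aX := all_moments_exp k.+1 (all_moments_norm (ham n i j)).
  rewrite -lee_fin -(integral_EFin_Ex aX).
  by have := HC n.+1 i j isT; rewrite unlock.
have hsym n : (B' n)^T = B' n by exact: B_sym.
have ntrX n k : ntr B' n ('X ^+ k) = n.+1%:R^-1 * \tr (B n.+1 ^+ k).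
  by rewrite /ntr /polB rmorphXn /= horner_mx_X.
have /choice[c hc] : forall k, exists l : R,
    (fun n => ntr B' n ('X ^+ k)) @ \oo --> l.
  case=> [|k].
    exists 1; rewrite expr0; under eq_fun do rewrite ntr1; exact: cvg_cst.
  have /cvg_ex[l hl] := B_cvg k.+1 isT; exists l.
  under eq_fun do rewrite ntrX.
  by move: hl; rewrite -cvg_shiftS.
(* Convergence of the traces of powers defines the limit functional on all
   polynomials. *)
pose tau (p : {poly R}) := \sum_(i < size p) p`_i * c i.
have htau p : (fun n => ntr B' n p) @ \oo --> tau p.
  have -> : (fun n => ntr B' n p) =
      (fun n => \sum_(i < size p) p`_i * ntr B' n ('X ^+ i)).
    by apply/funext => n; rewrite ntr_coef.
  apply: cvg_big => [|i _]; [exact: add_continuous|apply: cvgM; [exact: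
      cvg_cst|exact: hc]].
have hM0 n : (0 < M n)%N by exact: m_gt0.
have hratio : (fun n => (M n)%:R * n.+1%:R^-1 : R) @ \oo --> (1 : R).
  by move: m_ratio; rewrite -cvg_shiftS.
have conclude : tau ('X ^+ 2 * (1 - 'X) ^+ 2) = 0 -> forall k, (0 < k)%N ->
    (fun n => n%:R^-1 * \tr (B n ^+ k) : R) @ \oo --> tau 'X.
  move=> t0 k k0; rewrite -(tau_power hsym htau t0 k0).
  rewrite -cvg_shiftS /=.
  by have := htau ('X ^+ k); under eq_fun do rewrite ntrX.
pose mt := @mean_trace _ _ _ P M X' B'.
have w1 p : (fun n => mt n [:: p]) @ \oo --> tau p.
  exact: (mean_trace1_cvg hindep ham hmean hsq htau hM0).
have w2 := mean_trace2_cvg hindep ham hmean hsq hmom hsym htau hM0 hratio.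
have w3 := mean_trace3_cvg hindep ham hmean hsq hmom hsym htau hM0 hratio.
have w4 := mean_trace4_cvg hindep ham hmean hsq hmom hsym htau hM0 hratio.
(* Testing joint convergence on single words identifies the moments of the
   limit variables. *)
have tr_word (r : nat) (Y : forall n, 'I_r -> T -> 'M[R[i]]_(m n))
    (pp : 'I_r -> {poly R}) (S : ncps R) (a : 'I_r -> S) :
    (forall n i w, Y n.+1 i w = map_mx (real_complex R) (pmx X' B' n (pp i) w))
        ->
    converges_jointly P Y a -> forall (l : seq 'I_r) (L : R),
    (fun n => mt n (map pp l)) @ \oo --> L ->
    ncps_state S (\prod_(i <- l) a i) = real_complex R L.
  move=> YE cY l L mL; apply: (real_complex_cvg mL).
  have := cY [:: (1, l)]; rewrite -cvg_shiftS /=.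
  rewrite /nceval big_seq1 scale1r.
  set u := (X in X @ _ --> _ -> _); set v := (X in _ -> X @ _ --> _).
  suff -> : u = v by [].
  apply/funext => n; rewrite /u /v /mt /mean_trace -mx_state_real.
  congr mx_state; apply/funext => w.
  rewrite /nceval_mx big_seq1 scale1r big_map -prod_map_real_complex.
  by apply: eq_bigr => i _; rewrite YE.
have sandX n w : sandwich (X n.+1) (B n.+1) w =
    map_mx (real_complex R) (pmx X' B' n 'X w).
  by rewrite /sandwich /pmx /polB horner_mx_X.
have sandY n w : sandwich (X n.+1) (1%:M - B n.+1) w =
    map_mx (real_complex R) (pmx X' B' n (1 - 'X) w).
  by rewrite /sandwich /pmx /polB rmorphB /= [horner_mx _ 1]rmorph1 horner_mx_X.
split.
- move=> [S [a [fr cv]]].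
  pose pp (i : 'I_2) : {poly R} := if i == ord0 then 'X else 1 - 'X.
  have YE n (i : 'I_2) w :
      (if i == ord0 then sandwich (X n.+1) (B n.+1)
       else sandwich (X n.+1) (1%:M - B n.+1)) w =
      map_mx (real_complex R) (pmx X' B' n (pp i) w).
    by rewrite /pp; case: (i == ord0); [exact: sandX|exact: sandY].
  have W := tr_word _ _ pp S a YE cv.
  have V1 i : ncps_state S (a i) = real_complex R (tau (pp i)).
    by have := W [:: i] _ (w1 _); rewrite big_seq1.
  have V2 i j := W [:: i; j] _ (w2 _ _).
  have V3 i j k := W [:: i; j; k] _ (w3 _ _ _).
  have V4 i j k l := W [:: i; j; k; l] _ (w4 _ _ _ _).
  have [] := free_alternating_moments fr.
  set x := a ord0; set y := a ord_max; rewrite !V1.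
  set p := pp ord0; set q := pp ord_max.
  have Vx : ncps_state S x = real_complex R (tau p) by exact: V1.
  have Vy : ncps_state S y = real_complex R (tau q) by exact: V1.
  have xy := V2 ord0 ord_max; have xx := V2 ord0 ord0.
  have yx := V2 ord_max ord0; have yy := V2 ord_max ord_max.
  have xyx := V3 ord0 ord_max ord0; have xyy := V3 ord0 ord_max ord_max.
  have xxy := V3 ord0 ord0 ord_max; have yxy := V3 ord_max ord0 ord_max.
  have xyxy := V4 ord0 ord_max ord0 ord_max.
  rewrite !big_cons big_nil !mulr1 -/x -/y -/p -/q in xy xx yx yy.
  rewrite !big_cons big_nil !mulr1 -/x -/y -/p -/q !mulrA in xyx xyy xxy yxy
      xyxy.
  (* In all arguments of [tau] the factors [p] are moved in front of the factors
     [q]. *)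
  rewrite !(mulrC q p) ?(mulrAC p q p) in xy xx yx yy xyx xyy xxy yxy xyxy.
  have E2 : ncps_state S ((x - (real_complex R (tau p))%:A) *
      (y - (real_complex R (tau q))%:A)) = real_complex R (tau (p * q)).
    rewrite phi_center_l phi_center_r phi_center0 Vx Vy xy.
    by rewrite !(rmorphD, rmorphM) /=; ring.
  have E4 : ncps_state S ((x - (real_complex R (tau p))%:A) *
      (y - (real_complex R (tau q))%:A) * (x - (real_complex R (tau p))%:A) *
      (y - (real_complex R (tau q))%:A)) =
      real_complex R (tau (p * p * q * q) + tau (p * q) * tau (p * q) *+ 2).
    rewrite phi_center_alternating Vx Vy xyxy.
    rewrite xyx xyy xxy yxy xy xx yx yy.
    by rewrite !(rmorphD, rmorphM) /=; ring.
  (* The centred moments are the mixed cumulants [kappa_2] and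
     [kappa_4 + 2 kappa_2 ^ 2]. *)
  rewrite E2 E4 => /(@complexI R _ 0) pq0 /(@complexI R _ 0).
  rewrite pq0 mul0r mul0rn addr0 => ppqq0.
  have t0 : tau ('X ^+ 2 * (1 - 'X) ^+ 2) = 0.
    by rewrite -ppqq0 /p /q /pp /=; congr tau; ring.
  exists (tau 'X); first exact: (tau_idempotent hsym htau t0).
  exact: conclude.
- move=> p /andP[p0 p1] [S [a [fp cv]]].
  have W := tr_word _ _ (fun=> 'X) S (fun=> a) (fun n _ w => sandX n w) cv.
  have V n L : (0 < n)%N ->
      (fun k => mt k (map (fun=> 'X) (nseq n (ord0 : 'I_1)))) @ \oo --> L ->
      real_complex R L = \sum_(pi in NC n) real_complex R p ^+ #|pi|.
    move=> n0 mL; rewrite -(free_poisson_moment n0 fp) -(W _ _ mL).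
    congr (ncps_state S _); elim: n {n0 mL} => [|n IH]; first by rewrite
        !big_nil.
    by rewrite /= !big_cons IH.
  have V1 := V 1%N _ isT (w1 'X); have V2 := V 2%N _ isT (w2 'X 'X).
  have V3 := V 3%N _ isT (w3 'X 'X 'X); have V4 := V 4%N _ isT (w4 'X 'X 'X 'X).
  rewrite sum_NC_small //= in V1; rewrite sum_NC_small //= in V2.
  rewrite sum_NC_small //= in V3; rewrite sum_NC4 in V4.
  (* Comparing moments in increasing order yields the cumulants. *)
  have c1 : tau 'X = p by apply: (@complexI R).
  have c2 : tau ('X * 'X) = p.
    apply: (@complexI R); move: V2; rewrite c1 rmorphD rmorphM /= => V2.
    by apply: (addrI (real_complex R p * real_complex R p)); rewrite V2; ring.
  have c3 : tau ('X * 'X * 'X) = p.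
    apply: (@complexI R); move: V3; rewrite c1 c2 !(rmorphD, rmorphM) /= => V3.
    apply: (addrI (real_complex R p * real_complex R p * real_complex R p +
      3%:R * (real_complex R p * real_complex R p))).
    rewrite [RHS](_ : _ = real_complex R p + 3%:R * real_complex R p ^+ 2 +
      real_complex R p ^+ 3); last by ring.
    by rewrite -V3; ring.
  have c4 : tau ('X * 'X * 'X * 'X) = p.
    apply: (@complexI R); move: V4; rewrite c1 c2 c3 !(rmorphD, rmorphM,
        rmorph0) /= => V4.
    set z := real_complex R p in V4 *.
    apply: (addrI (6%:R * z ^+ 2 + 6%:R * z ^+ 3 + z ^+ 4)).
    rewrite [RHS](_ : _ = z + 6%:R * z ^+ 2 + 6%:R * z ^+ 3 + z ^+ 4); last by
        ring.
    by rewrite -V4; ring.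
  rewrite -c1; apply: conclude.
  have -> : 'X ^+ 2 * (1 - 'X) ^+ 2 =
      'X * 'X - (2%:R *: ('X * 'X * 'X) - 'X * 'X * 'X * 'X) :> {poly R}.
    by rewrite scaler_nat; ring.
  rewrite !(tauB htau) (tauZ htau) c2 c3 c4; ring.
Qed.
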